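(* Let $r\ge2$ be an integer and $k\in\mathbb{N}$. As $n\to\infty$, $$\operatorname{T}^{[r]}_{b_k}(n)\sim\frac{(r-1)!^r\,\pi^{\frac{r(r-1)}2}(5k+2)^{\frac{r^2}4+\frac r2}}{2^{\frac{3r^2}4+2r}\,3^{\frac{r^2}4+\frac r2}\,(2k+1)^{\frac{r^2}4+\frac r2}\prod_{j=2}^{r-1}j^j}\cdot\frac{e^{\pi r\sqrt{\frac{2(5k+2)}{3(2k+1)}n}}}{n^{\frac{3r^2}4+\frac r2}},$$ $$\operatorname{T}^{[r]}_{\Delta^{[k]}(p)}(n)\sim\frac{(r-1)!^r\,\pi^{\frac{r(r-1)}2+kr}}{2^{\frac{3r^2+(2k+5)r}4}\,3^{\frac{r^2+(2k+1)r}4}\prod_{j=2}^{r-1}j^j}\cdot\frac{e^{\pi r\sqrt{\frac23n}}}{n^{\frac{3r^2+(2k+1)r}4}},$$ $$\operatorname{T}^{[r]}_{\Delta^{[k]}(\overline{p})}(n)\sim\frac{(r-1)!^r\,\pi^{\frac{r(r-1)}2+kr}}{2^{r^2+(k+2)r}\prod_{j=2}^{r-1}j^j}\cdot\frac{e^{\pi r\sqrt n}}{n^{\frac{3r^2+(2k+1)r}4}}.$$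
   Context: For a sequence $a$, $\operatorname{T}^{[r]}_a(n):=\det\left(a(n-k+\ell)\right)_{1\le k,\ell\le r}$ (considered for large $n$). For $k\in\mathbb{N}$, $b_k(n)$ (the number of broken $k$-diamond partitions of $n$) is defined by $\sum_{n\ge0}b_k(n)q^n=\frac{(-q;q)_\infty}{(q;q)_\infty^2(-q^{2k+1};q^{2k+1})_\infty}$, where $(a;q)_\infty:=\prod_{j\ge0}(1-aq^j)$. $p(n)$ is the number of partitions of $n$; $\overline{p}(n)$ is the number of overpartitions of $n$, i.e. partitions in which the first occurrence of each part may be overlined. The difference operator is $\Delta^{[1]}(a)(n):=a(n)-a(n-1)$, and for $k\ge2$, $\Delta^{[k]}(a)(n):=\Delta^{[1]}\left(\Delta^{[k-1]}(a)\right)(n)$ (considered for $n\ge k$). Empty products equal $1$. *)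

(* Defs.v *)
From HB Require Import structures.
From mathcomp Require Import all_boot all_order all_algebra.
From mathcomp Require Import all_classical all_reals all_analysis.

Set Implicit Arguments.
Unset Strict Implicit.
Unset Printing Implicit Defensive.
Import Order.TTheory GRing.Theory Num.Theory.
Import numFieldNormedType.Exports.
Local Open Scope ring_scope.

(* The row and column indices are 0-based here, which does not affect their
   difference. The natural subtraction is exact as soon as r <= n.+1. *)
Definition toeplitz_det (r : nat) (a : nat -> int) (n : nat) : int :=
  \det (\matrix_(i < r, j < r) a (n + j - i)%N).

(* At n = 0 this takes the value 0; [iter k bdiff a n] is thus the usual k-th
   backward difference for k <= n. *)
Definition bdiff (a : nat -> int) (n : nat) : int := a n - a n.-1.

(* A formal power series over int is identified with its coefficient
   sequence. *)
Definition fps_mul (f g : nat -> int) (n : nat) : int :=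
  \sum_(i < n.+1) f i * g (n - i)%N.

(* The first n coefficients of f / g, for g with constant term 1. *)
Fixpoint fps_div_seq (f g : nat -> int) (n : nat) : seq int :=
  if n is m.+1 then
    let s := fps_div_seq f g m in
    rcons s (f m - \sum_(i < m) s`_i * g (m - i)%N)
  else [::].

Definition fps_div (f g : nat -> int) (n : nat) : int :=
  (fps_div_seq f g n.+1)`_n.

Lemma size_fps_div_seq f g n : size (fps_div_seq f g n) = n.
Proof. by elim: n => //= n IHn; rewrite size_rcons IHn. Qed.

Lemma nth_fps_div_seq f g n i :
  (i < n)%N -> (fps_div_seq f g n)`_i = fps_div f g i.
Proof.
elim: n => // n IHn; rewrite ltnS leq_eqVlt => /predU1P[-> //|ltin].
by rewrite /= nth_rcons size_fps_div_seq ltin IHn.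
Qed.

Lemma fps_divK f g : g 0%N = 1 -> fps_mul (fps_div f g) g =1 f.
Proof.
move=> g0 n; rewrite /fps_mul big_ord_recr /= subnn g0 mulr1.
rewrite {2}/fps_div /= nth_rcons size_fps_div_seq ltnn eqxx addrC.
under [X in _ - X + _]eq_bigr => i _ do rewrite nth_fps_div_seq //.
by rewrite subrK.
Qed.

(* (a; q)_oo as a formal power series, for q with zero constant term: the
   factors 1 - a * q ^+ j with n < j do not affect the coefficient of 'X^n. *)
Definition qpoch (a q : {poly int}) (n : nat) : int :=
  (\prod_(j < n.+1) (1 - a * q ^+ j))`_n.

Definition broken_diamond (k : nat) : nat -> int :=
  let m := (2 * k + 1)%N in
  fps_div (qpoch (- 'X) 'X)
    (fps_mul (fps_mul (qpoch 'X 'X) (qpoch 'X 'X)) (qpoch (- 'X^m) 'X^m)).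

(* A partition of n is a nonincreasing sequence of parts with sum n, padded
   with zeros to length n. *)
Definition is_partition (n : nat) (t : n.-tuple 'I_n.+1) : bool :=
  let s := map val t in sorted geq s && (sumn s == n).

Definition partitions (n : nat) : int :=
  #|[set t : n.-tuple 'I_n.+1 | is_partition t]|%:Z.

(* The second component is the set of positions of the overlined parts; each
   must be the first occurrence of a nonzero part. *)
Definition is_overpartition (n : nat)
    (u : n.-tuple 'I_n.+1 * {set 'I_n}) : bool :=
  is_partition u.1 &&
  [forall i in u.2,
     (0 < tnth u.1 i)%N && (index (tnth u.1 i) u.1 == i :> nat)].

Definition overpartitions (n : nat) : int :=
  #|[set u : n.-tuple 'I_n.+1 * {set 'I_n} | is_overpartition u]|%:Z.

(* Main.v *)
(* Each of the three generating functions is a product F(q) = sum a_n q^n of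
   powers of P(q^a), P being the generating function of the partitions, and
   log F = sum c_N q^N with c_N >= 1 for N >= 1. The midpoint rule, with the
   constants fixed by zeta(2) and Stirling's formula, gives
     log F(e^-t) = A / t + beta log t + kappa + O(t),
   and convexity turns this into asymptotics for the sums of N^p c_N e^(-N t).
   Put t = sqrt (A / n), q = e^-t and sg^2 = t^3 / (2 A). The p-th difference of
   m |-> a_m q^m is a Fourier integral of F(q e^(i th)) against
   (2 sin(th / 2))^p; after th = sg u it converges, by dominated convergence, to
   a Gaussian integral, so the difference at n - s, for a fixed s, is equivalent
   to F(q) sg^(p+1) times a multiple of the p-th Gaussian moment. The domination
   uses c_N >= 1 to compare |F(q e^(i th)) / F(q)| with the exponential of a
   Poisson kernel.
   Unitriangular row and column operations turn the Toeplitz determinant of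
   a_m q^m into the determinant of the differences of order i + j, hence, in the
   limit, into the Hankel determinant of the Gaussian moments, which is
   0! 1! ... (r-1)! by the orthogonality of the Hermite polynomials. Taking k
   differences of a only multiplies the leading terms by (1 - q)^k. *)

Require Import Defs.
From mathcomp Require Import perm.
From mathcomp Require Import all_boot all_order all_algebra.
From mathcomp Require Import all_classical all_reals all_analysis.
From mathcomp Require Import measurable_realfun zify ring lra.

Set Implicit Arguments.
Unset Strict Implicit.
Unset Printing Implicit Defensive.
Import Order.TTheory GRing.Theory Num.Theory.
Import numFieldNormedType.Exports.
Local Open Scope ring_scope.

(** * Logarithmic derivatives of formal Euler products *)

Section FormalSeries.

Implicit Types f g h u v : nat -> int.

(** The entries of the Toeplitz matrix are all equivalent to one another, so their leading terms
    cancel and the determinant lies r(r-1) powers of [sg] below the product of the entries. An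
    asymptotic expansion to that depth is avoided: for differences of every order a limit after
    scaling is enough. The tilt by q^m is what makes a difference of order p smaller by sg^p, and it
    costs nothing, because a Toeplitz matrix with weights x^(n+j-i) splits into row and column
    factors whose total is x^(nr). The saddle point needs log F(e^-t) only up to O(t), so no
    transformation law of the eta function enters. Complex values F(q e^(i th)) appear through their
    real and imaginary parts. The circle is not cut into arcs: a single majorant K / (1 + u^2)
    serves for all u. For large u the Poisson kernel bound only yields a decay like exp(-c
    |u|^(2/3)), which still beats every power of u. *)

Definition fps_trunc n f : {poly int} := \poly_(i < n.+1) f i.

Lemma coef_fps_trunc n f i : (i <= n)%N -> (fps_trunc n f)`_i = f i.
Proof. by move=> lein; rewrite coef_poly ltnS lein. Qed.

(** Transfers the ring laws of [{poly int}] to coefficient sequences: the coefficient at [n] only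
    sees the terms up to [n]. *)
Lemma fps_mul_coef f g (p q : {poly int}) n :
  (forall i, (i <= n)%N -> p`_i = f i) -> (forall i, (i <= n)%N -> q`_i = g i) ->
  fps_mul f g n = (p * q)`_n.
Proof.
move=> pf qg; rewrite coefM; apply: eq_bigr => i _.
by rewrite pf ?qg ?leq_subr // -ltnS.
Qed.

Lemma fps_mulC f g : fps_mul f g =1 fps_mul g f.
Proof.
move=> n; rewrite (fps_mul_coef (coef_fps_trunc f) (coef_fps_trunc g)) mulrC.
by rewrite -(fps_mul_coef (coef_fps_trunc g) (coef_fps_trunc f)).
Qed.

Lemma eq_fps_mul f f' g g' n :
  (forall i, (i <= n)%N -> f i = f' i) -> (forall i, (i <= n)%N -> g i = g' i) ->
  fps_mul f g n = fps_mul f' g' n.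
Proof.
move=> ff gg; apply: eq_bigr => i _.
by rewrite ff ?gg ?leq_subr // -ltnS.
Qed.

Lemma fps_mulA f g h : fps_mul f (fps_mul g h) =1 fps_mul (fps_mul f g) h.
Proof.
move=> n; rewrite (@fps_mul_coef _ _ (fps_trunc n f) (fps_trunc n g * fps_trunc n h)).
- rewrite mulrA; apply/esym/fps_mul_coef; last exact: coef_fps_trunc.
  by move=> i lein; apply/esym/fps_mul_coef => j leji;
     apply/coef_fps_trunc/(leq_trans leji).
- exact: coef_fps_trunc.
- by move=> i lein; apply/esym/fps_mul_coef => j leji;
     apply/coef_fps_trunc/(leq_trans leji).
Qed.

Lemma fps_mulDl f g h :
  fps_mul (fun n => f n + g n) h =1 (fun n => fps_mul f h n + fps_mul g h n).
Proof. by move=> n; rewrite -big_split; apply: eq_bigr => i _; rewrite mulrDl. Qed.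

Lemma fps_mulBl f g h :
  fps_mul (fun n => f n - g n) h =1 (fun n => fps_mul f h n - fps_mul g h n).
Proof. by move=> n; rewrite -sumrB; apply: eq_bigr => i _; rewrite mulrBl. Qed.

Lemma fps_mul0_eq0 f g : g 0%N = 1 -> fps_mul f g =1 (fun=> 0) -> f =1 (fun=> 0).
Proof.
move=> g0 fg0 n; elim/ltn_ind: n => n IHn.
have := fg0 n; rewrite /fps_mul big_ord_recr /= subnn g0 mulr1 big1 ?add0r //.
by move=> i _; rewrite IHn ?mul0r.
Qed.

Definition fps_euler f n : int := n%:Z * f n.

Lemma fps_eulerM f g : fps_euler (fps_mul f g) =1
  (fun n => fps_mul (fps_euler f) g n + fps_mul f (fps_euler g) n).
Proof.
move=> n; rewrite /fps_euler /fps_mul mulr_sumr -big_split; apply: eq_bigr => i _ /=.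
by rewrite -{1}(subnKC (ltn_ord i : i <= n)%N) PoszD; ring.
Qed.

(* u = q f' / f *)
Definition log_deriv u f := fps_euler f =1 fps_mul u f.

Lemma log_derivM u v f g : log_deriv u f -> log_deriv v g ->
  log_deriv (fun n => u n + v n) (fps_mul f g).
Proof.
move=> uf vg n; rewrite fps_eulerM fps_mulDl.
rewrite (@eq_fps_mul (fps_euler f) (fps_mul u f) g g) // -fps_mulA; congr (_ + _).
rewrite (@eq_fps_mul f f _ (fps_mul v g)) // fps_mulA.
rewrite (@eq_fps_mul _ (fps_mul v f) g g) ?fps_mulA // => i _; exact: fps_mulC.
Qed.

(** [h] stands for f / g. After multiplication by [g] both sides agree by the Leibniz rule, and [g],
    having constant term 1, can be cancelled. *)
Lemma log_deriv_div u v f g h : g 0%N = 1 -> fps_mul h g =1 f ->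
  log_deriv u f -> log_deriv v g -> log_deriv (fun n => u n - v n) h.
Proof.
move=> g0 hgf uf vg n; apply/eqP; rewrite -subr_eq0; apply/eqP; move: n.
apply: (fps_mul0_eq0 g0) => n; rewrite fps_mulBl.
have := fps_eulerM h g n.
have -> : fps_mul h (fps_euler g) n = fps_mul (fps_mul v h) g n.
  rewrite (@eq_fps_mul h h _ (fps_mul v g)) // fps_mulA.
  by apply: eq_fps_mul => // i _; exact: fps_mulC.
have -> : fps_euler (fps_mul h g) n = fps_mul (fps_mul u h) g n.
  rewrite -fps_mulA (@eq_fps_mul u u _ f) // -uf /fps_euler; congr (_ * _); exact: hgf.
move=> E; rewrite (@eq_fps_mul (fps_mul _ h)
  (fun i => fps_mul u h i - fps_mul v h i) g g) //; last by move=> i _; rewrite fps_mulBl.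
by rewrite fps_mulBl E; ring.
Qed.

Lemma eq_log_deriv u v f g : u =1 v -> f =1 g -> log_deriv u f -> log_deriv v g.
Proof.
move=> uv fg uf n; rewrite /fps_euler -fg; have := uf n; rewrite /fps_euler => ->.
exact: eq_fps_mul.
Qed.

Lemma fps_div0 f g : fps_div f g 0%N = f 0%N.
Proof. by rewrite /fps_div /= big_ord0 subr0. Qed.

End FormalSeries.

(** * Products (q^m; q^m)_oo and (-q^m; q^m)_oo, and the broken diamond series *)

Section EulerProducts.

(** Minus the logarithmic derivative of (q^m; q^m)_oo, see [log_deriv_qpochXn]. *)
Definition mult_divsum (m N : nat) : int :=
  \sum_(1 <= d < N.+1 | (d %| N)%N && (m %| d)%N) d%:Z.

(** The coefficients of d q^d / (1 - q^d), minus the logarithmic derivative of 1 - q^d. The guard on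
    [N] matters because every [d] divides 0. *)
Definition qpow_log (d N : nat) : int := if (0 < N)%N && (d %| N)%N then d%:Z else 0.

Lemma log_deriv_factor d : (0 < d)%N ->
  log_deriv (fun N => - qpow_log d N) (nth 0 (1 - 'X^d : {poly int})).
Proof.
move=> d0 N; rewrite /fps_euler.
have E i : (1 - 'X^d : {poly int})`_i = (i == 0%N)%:R - (i == d)%:R.
  by rewrite coefB coef1 coefXn.
rewrite /fps_mul; under eq_bigr => i _ do rewrite E mulrBr.
rewrite sumrB E.
have -> : \sum_(i < N.+1) - qpow_log d i * ((N - i)%N == 0%N)%:R = - qpow_log d N.
  rewrite big_ord_recr /= subnn eqxx mulr1 big1 ?add0r // => i _.
  by rewrite subn_eq0 leqNgt ltn_ord mulr0.
have -> : \sum_(i < N.+1) - qpow_log d i * ((N - i)%N == d)%:R =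
   if (d <= N)%N then - qpow_log d (N - d)%N else 0.
  case: leqP => [ledN|ltNd].
    have lt : (N - d < N.+1)%N by rewrite ltnS leq_subr.
    rewrite (bigD1 (Ordinal lt)) //= subKn // eqxx mulr1 big1 ?addr0 // => i.
    rewrite -val_eqE /= => ne; case: eqP => [e|]; last by rewrite mulr0.
    by case/negP: ne; apply/eqP; have := ltn_ord i; lia.
  rewrite big1 // => i _; case: eqP => [e|]; last by rewrite mulr0.
  by have := leq_subr i N; lia.
rewrite /qpow_log; case: N => [|N] /=.
  by rewrite mul0r leqNgt d0 /= !oppr0 subrr.
rewrite mulrBr mulr0 sub0r.
case: (eqVneq N.+1 d) => [<-|ne].
  by rewrite leqnn subnn dvdnn /=; lia.
rewrite mulr0 oppr0; case: (leqP d N.+1) => [ledN|ltNd]; last first.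
  by rewrite subr0; case: ifP => // /dvdn_leq -/(_ isT); lia.
rewrite subn_gt0 ltn_neqAle ledN eq_sym ne /=.
by rewrite dvdn_subl // subrr.
Qed.

Definition euler_prod (m K : nat) : {poly int} := \prod_(j < K) (1 - 'X^(m * j.+1)).

Lemma log_deriv_euler_prod m K : (0 < m)%N ->
  log_deriv (fun N => - \sum_(j < K) qpow_log (m * j.+1) N) (nth 0 (euler_prod m K)).
Proof.
move=> m0; elim: K => [|K IHK].
  move=> N; rewrite /fps_euler /euler_prod big_ord0 coef1.
  rewrite /fps_mul big1 => [|i _]; last by rewrite big_ord0 oppr0 mul0r.
  by case: N => [|N]; rewrite ?mul0r ?mulr0.
have := log_derivM IHK (@log_deriv_factor (m * K.+1) _).
rewrite muln_gt0 m0 => /(_ isT); apply: eq_log_deriv => N /=.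
  by rewrite big_ord_recr /= opprD.
by rewrite /euler_prod big_ord_recr /= coefM.
Qed.

Lemma coef_euler_prod m K K' N : (0 < m)%N -> (N < K)%N -> (K <= K')%N ->
  (euler_prod m K')`_N = (euler_prod m K)`_N.
Proof.
move=> m0 ltNK /subnKC <-; elim: (K' - K)%N => [|j IHj]; first by rewrite addn0.
rewrite addnS /euler_prod big_ord_recr /= mulrBr mulr1 coefB coefMXn.
by rewrite ifT ?subr0 //; nia.
Qed.

Lemma qpochXnE m n : qpoch 'X^m 'X^m n = (euler_prod m n.+1)`_n.
Proof.
rewrite /qpoch /euler_prod.
by under eq_bigr => j _ do rewrite -exprM -exprD -mulnS.
Qed.

Lemma mult_divsumE m N K : (0 < m)%N -> (N < K)%N ->
  \sum_(j < K) qpow_log (m * j.+1) N = mult_divsum m N.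
Proof.
move=> m0 ltNK; rewrite /mult_divsum /qpow_log.
case: (posnP N) => [->|N0]; first by rewrite big_nil big1.
rewrite -(big_mkcond (fun j : 'I_K => m * j.+1 %| N)%N (fun j => (m * j.+1)%:Z)) /=.
rewrite -(big_map (fun j : 'I_K => m * j.+1)%N (fun d => d %| N)%N (fun d => d%:Z)).
rewrite -big_filter -[RHS]big_filter; apply: perm_big; apply: uniq_perm.
- rewrite filter_uniq // map_inj_uniq ?index_enum_uniq //.
  by move=> i j /eqP; rewrite eqn_pmul2l // eqSS => /eqP /val_inj.
- by rewrite filter_uniq // iota_uniq.
move=> d; rewrite !mem_filter mem_index_iota -andbA.
case dN : (d %| N)%N => //=; rewrite ltnS (dvdn_leq N0 dN) (dvdn_gt0 N0 dN) /= andbT.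
apply/mapP/idP => [[j _ ->]|/dvdnP[j ej]]; first exact: dvdn_mulr.
have d0 : (0 < d)%N by apply: dvdn_gt0 dN.
have ltj : (j.-1 < K)%N.
  by have := dvdn_leq N0 dN; rewrite ej; nia.
exists (Ordinal ltj); rewrite ?mem_index_enum //= prednK ?ej 1?mulnC //.
by move: d0; rewrite ej muln_gt0 => /andP[].
Qed.

Lemma log_deriv_qpochXn m : (0 < m)%N ->
  log_deriv (fun N => - mult_divsum m N) (qpoch 'X^m 'X^m).
Proof.
move=> m0 N; have := log_deriv_euler_prod N.+1 m0 N.
rewrite /fps_euler -qpochXnE => ->; apply: eq_fps_mul => i leiN.
  by rewrite mult_divsumE.
by rewrite qpochXnE (@coef_euler_prod m i.+1 N.+1).
Qed.

Lemma qpoch0 m : (0 < m)%N -> qpoch 'X^m 'X^m 0 = 1 /\ qpoch (- 'X^m) 'X^m 0 = 1.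
Proof.
move=> m0; rewrite /qpoch !big_ord1 !expr0 !mulr1 opprK coefB coefD coef1 coefXn.
by case: m m0.
Qed.

Lemma qpochN_coef m n K : (0 < m)%N -> (n < K)%N ->
  qpoch (- 'X^m) 'X^m n = (\prod_(j < K) (1 + 'X^(m * j.+1)) : {poly int})`_n.
Proof.
move=> m0 ltnK.
have -> : qpoch (- 'X^m) 'X^m n = (\prod_(j < n.+1) (1 + 'X^(m * j.+1)) : {poly int})`_n.
  by rewrite /qpoch; under eq_bigr => j _ do rewrite mulNr opprK -exprM -exprD -mulnS.
move/subnKC : ltnK => <-; elim: (K - n.+1)%N => [|j IHj]; first by rewrite addn0.
rewrite addnS [in RHS]big_ord_recr /= mulrDr mulr1 coefD coefMXn -IHj.
by rewrite ifT ?addr0 //; nia.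
Qed.

(** From (1 + x)(1 - x) = 1 - x^2. It trades the products (-q^m; q^m)_oo for quotients of products
    (q^a; q^a)_oo. *)
Lemma qpochNM m : (0 < m)%N ->
  fps_mul (qpoch (- 'X^m) 'X^m) (qpoch 'X^m 'X^m) =1 qpoch 'X^(2 * m) 'X^(2 * m).
Proof.
move=> m0 n; rewrite (@fps_mul_coef _ _ (\prod_(j < n.+1) (1 + 'X^(m * j.+1)))
   (euler_prod m n.+1)).
- rewrite /euler_prod -big_split /= qpochXnE /euler_prod.
  under eq_bigr => j _ do rewrite mulrBr mulr1 mulrDl mul1r addrKA -exprD addnn -mul2n mulnA.
  by [].
- by move=> i lein; rewrite (@qpochN_coef _ _ n.+1).
- by move=> i lein; rewrite qpochXnE (@coef_euler_prod m i.+1 n.+1).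
Qed.

Lemma log_deriv_qpochN m : (0 < m)%N ->
  log_deriv (fun N => mult_divsum m N - mult_divsum (2 * m) N) (qpoch (- 'X^m) 'X^m).
Proof.
move=> m0; have [q0 _] := qpoch0 m0.
have m20 : (0 < 2 * m)%N by rewrite muln_gt0.
apply: (eq_log_deriv _ _ (log_deriv_div q0 (qpochNM m0)
  (log_deriv_qpochXn m20) (log_deriv_qpochXn m0))) => // N /=; ring.
Qed.

(* A family of exponents [:: (a, e_a); ...] stands for the product over a of
   P(q^a)^(e_a), where P is the generating function of the partitions. *)
Definition divisor_weight (s : seq (nat * int)) (d : nat) : int :=
  \sum_(p <- s) if (p.1 %| d)%N then p.2 else 0.

Definition weighted_divsum (s : seq (nat * int)) (N : nat) : int :=
  \sum_(1 <= d < N.+1 | (d %| N)%N) divisor_weight s d * d%:Z.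

Lemma weighted_divsumE s N :
  weighted_divsum s N = \sum_(p <- s) p.2 * mult_divsum p.1 N.
Proof.
rewrite /weighted_divsum /divisor_weight.
under eq_bigr => d _ do rewrite mulr_suml.
rewrite exchange_big /=; apply: eq_bigr => p _.
rewrite /mult_divsum mulr_sumr big_mkcondr; apply: eq_bigr => d _.
by case: ifP; rewrite ?mul0r.
Qed.

(** With P(q) = 1 / (q; q)_oo one has (-q; q)_oo = P(q) / P(q^2), so the defining quotient is P(q)
    P(q^2)^-1 times P(q)^2 times P(q^(2m)) P(q^m)^-1. *)
Definition broken_diamond_exps (k : nat) : seq (nat * int) :=
  let m := (2 * k + 1)%N in [:: (1%N, 3%:Z); ((2 * m)%N, 1); (2%N, -1); (m, -1)].

Lemma fps_mul0 f g : fps_mul f g 0 = f 0%N * g 0%N.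
Proof. by rewrite /fps_mul big_ord1. Qed.

Lemma broken_diamond0 k : broken_diamond k 0 = 1.
Proof.
rewrite /broken_diamond fps_div0.
by have [_] := qpoch0 (isT : 0 < 1)%N; rewrite expr1.
Qed.

Lemma log_deriv_broken_diamond k :
  log_deriv (weighted_divsum (broken_diamond_exps k)) (broken_diamond k).
Proof.
set m := (2 * k + 1)%N; have m0 : (0 < m)%N by rewrite /m addn1.
have [q0 _] := qpoch0 (isT : 0 < 1)%N; have [_ qm0] := qpoch0 m0.
have l1 := @log_deriv_qpochXn 1 isT; have lN1 := @log_deriv_qpochN 1 isT.
rewrite !expr1 in q0 l1 lN1.
have lm := log_deriv_qpochN m0.
have ld := log_derivM (log_derivM l1 l1) lm.
have g0 : fps_mul (fps_mul (qpoch 'X 'X) (qpoch 'X 'X)) (qpoch (- 'X^m) 'X^m) 0 = 1.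
  by rewrite !fps_mul0 q0 qm0 !mulr1.
apply: (eq_log_deriv _ _ (log_deriv_div g0 (fps_divK _ g0) lN1 ld)) => // N.
rewrite weighted_divsumE /broken_diamond_exps -/m !big_cons big_nil /= muln1; ring.
Qed.

End EulerProducts.

(** * Partitions and overpartitions counted through multiplicities *)

Section PartitionCounting.

Variable n : nat.

Implicit Types (t : n.-tuple 'I_n.+1) (f : {ffun 'I_n -> 'I_n.+1}).

Definition parts_of t : seq nat := map val t.

(** [inord] loses nothing, since among [n] parts no multiplicity exceeds [n]. *)
Definition multiplicities t : {ffun 'I_n -> 'I_n.+1} :=
  [ffun j : 'I_n => inord (count_mem j.+1 (parts_of t))].

Definition mult_size f : nat := (\sum_(j < n) j.+1 * f j)%N.

(** The inverse of [multiplicities], padded with zeros to length [n]. The subtraction is exact when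
    [mult_size f = n], by [sum_mult_size]. *)
Definition parts_from f : seq nat :=
  sort geq (flatten [seq nseq (f j) j.+1 | j <- enum 'I_n]
            ++ nseq (n - \sum_(j < n) f j)%N 0%N).

Definition partition_from f : n.-tuple 'I_n.+1 :=
  [tuple inord (nth 0%N (parts_from f) i) | i < n].

Lemma multiplicitiesE t j : multiplicities t j = count_mem j.+1 (parts_of t) :> nat.
Proof.
rewrite ffunE inordK // ltnS.
by rewrite (leq_trans (count_size _ _)) // size_map size_tuple.
Qed.

Lemma count_mem_parts_from f x : count_mem x (parts_from f) =
  ((x == 0) * (n - \sum_(j < n) f j) + \sum_(j : 'I_n | j.+1 == x) f j)%N.
Proof.
rewrite /parts_from (permP (permEl (perm_sort _ _))) count_cat count_nseq addnC.
congr (_ + _)%N; first by rewrite /= eq_sym.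
rewrite count_flatten -map_comp sumnE big_map big_enum /= [RHS]big_mkcond.
apply: eq_bigr => j _ /=; rewrite count_nseq /=.
by case: eqP; rewrite ?mul1n ?mul0n.
Qed.

Lemma sum_mult_size f : (\sum_(j < n) f j <= mult_size f)%N.
Proof. by apply: leq_sum => j _; rewrite mulSn leq_addr. Qed.

Lemma size_parts_from f : mult_size f = n -> size (parts_from f) = n.
Proof.
move=> fn; rewrite size_sort size_cat size_nseq size_flatten /shape -map_comp.
rewrite sumnE big_map big_enum /=.
under eq_bigr => j _ do rewrite size_nseq.
by rewrite subnKC // -[leqRHS]fn sum_mult_size.
Qed.

Lemma sumn_parts_from f : sumn (parts_from f) = mult_size f.
Proof.
rewrite (perm_sumn (permEl (perm_sort _ _))) sumn_cat sumn_nseq mul0n addn0.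
rewrite sumn_flatten -map_comp sumnE big_map big_enum /=.
by apply: eq_bigr => j _; rewrite sumn_nseq.
Qed.

Lemma parts_from_le f x : mult_size f = n -> x \in parts_from f -> (x < n.+1)%N.
Proof.
move=> fn /seq.perm_to_rem /perm_sumn; rewrite sumn_parts_from fn => -> /=.
by rewrite ltnS leq_addr.
Qed.

Lemma parts_of_partition_from f : mult_size f = n ->
  parts_of (partition_from f) = parts_from f.
Proof.
move=> fn; apply: (@eq_from_nth _ 0%N).
  by rewrite size_map size_tuple size_parts_from.
move=> i; rewrite size_map size_tuple => ltin.
rewrite (nth_map ord0) ?size_tuple // -[i]/(nat_of_ord (Ordinal ltin)).
rewrite -tnth_nth tnth_mktuple /= inordK //.
by apply: (parts_from_le fn); rewrite mem_nth // size_parts_from.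
Qed.

Lemma partition_fromK f : mult_size f = n -> multiplicities (partition_from f) = f.
Proof.
move=> fn; apply/ffunP => j; apply/val_inj; rewrite /= multiplicitiesE.
rewrite parts_of_partition_from // count_mem_parts_from mul0n add0n (big_pred1 j) => [|i]; first by [].
by rewrite /= eqSS.
Qed.

Lemma sum_count_mem (s : seq nat) m : all (fun x => x < m)%N s ->
  (\sum_(x < m) count_mem (val x) s = size s)%N.
Proof.
elim: s => [|y s IHs] /=; first by rewrite big1.
case/andP=> ltym /IHs IH; rewrite big_split /= IH (bigD1 (Ordinal ltym)) //= eqxx.
by rewrite big1 // => i; rewrite -val_eqE /= eq_sym => /negPf->.
Qed.

Lemma sum_mul_count_mem (s : seq nat) m : all (fun x => x < m)%N s ->
  (\sum_(x < m) x * count_mem (val x) s = sumn s)%N.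
Proof.
elim: s => [|y s IHs] /=; first by rewrite big1 // => *; rewrite muln0.
case/andP=> ltym /IHs IH; under eq_bigr => i _ do rewrite mulnDr.
rewrite big_split /= IH (bigD1 (Ordinal ltym)) //= eqxx muln1.
by rewrite big1 ?addn0 // => i; rewrite -val_eqE /= eq_sym => /negPf->; rewrite muln0.
Qed.

Lemma all_parts_of t : all (fun x => x < n.+1)%N (parts_of t).
Proof. by apply/allP => x /mapP[y _ ->]; exact: ltn_ord. Qed.

Lemma mult_size_multiplicities t : mult_size (multiplicities t) = sumn (parts_of t).
Proof.
rewrite -(sum_mul_count_mem (all_parts_of t)) big_ord_recl mul0n add0n.
by apply: eq_bigr => j _; rewrite multiplicitiesE.
Qed.

Lemma multiplicitiesK t : is_partition t -> partition_from (multiplicities t) = t.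
Proof.
rewrite /is_partition -/(parts_of t) => /andP[st /eqP nt].
have fn : mult_size (multiplicities t) = n by rewrite mult_size_multiplicities.
apply/val_inj/(inj_map val_inj); rewrite -/(parts_of _) -/(parts_of t).
rewrite parts_of_partition_from //.
apply: (@sorted_eq _ geq) => //.
- by move=> y x z /= yx zy; apply: leq_trans yx.
- by move=> x y /=; rewrite andbC -eqn_leq => /eqP.
- by apply: sort_sorted => x y /=; apply: leq_total.
have cn (x : nat) : (0 < x)%N -> count_mem x (parts_from (multiplicities t)) =
    count_mem x (parts_of t).
  case: x => // x _; rewrite count_mem_parts_from mul0n add0n.
  case: (ltnP x n) => [ltxn|lenx].
    by rewrite (big_pred1 (Ordinal ltxn)) ?multiplicitiesE // => j; rewrite eqSS.
  rewrite big_pred0; last by move=> j; rewrite eqSS ltn_eqF // (leq_trans (ltn_ord j)).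
  apply/esym/count_memPn; apply/negP => /(allP (all_parts_of t)).
  by rewrite ltnS ltnNge lenx.
apply/allP => x _ /=; apply/eqP; case: x => [|x]; last exact: cn.
(* The zeros are the only parts not recorded by [multiplicities]; their number is recovered because
   both sequences have length [n]. *)
have allf : all (fun x => x < n.+1)%N (parts_from (multiplicities t)).
  by apply/allP => x; apply: parts_from_le.
have := sum_count_mem allf; have := sum_count_mem (all_parts_of t).
rewrite size_parts_from // size_map size_tuple => E1 E2.
move: (etrans E2 (esym E1)).
rewrite !big_ord_recl (eq_bigr (fun i : 'I_n => count_mem (val (lift ord0 i)) (parts_of t))).
  by move/addIn.
by move=> i _; exact: cn.
Qed.

(** Expanding the product chooses a multiplicity for every part size, and the coefficient of X^n
    keeps the choices of total size [n]. The weight [h] is 1 for partitions; for overpartitions it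
    is 2 at positive multiplicities. *)
Lemma sum_partitions (h : nat -> int) : h 0%N = 1 ->
  \sum_(t | is_partition t) \prod_(j < n) h (count_mem j.+1 (parts_of t)) =
  (\prod_(j < n) \sum_(e < n.+1) h e *: 'X^(j.+1 * e) : {poly int})`_n.
Proof.
move=> h0; rewrite bigA_distr_bigA /= coef_sum.
transitivity (\sum_(f | mult_size f == n) \prod_(j < n) h (f j)); last first.
  rewrite [LHS]big_mkcond; apply: eq_bigr => f _.
  under eq_bigr => j _ do rewrite -mul_polyC.
  rewrite big_split /= prodrXr.
  rewrite -rmorph_prod /= mul_polyC coefZ coefXn eq_sym -/(mult_size f).
  by case: eqP; rewrite ?mulr1 ?mulr0.
rewrite [RHS](reindex_onto multiplicities partition_from) /=; last first.
  by move=> f /eqP; exact: partition_fromK.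
apply: eq_big => [t|t _].
  apply/idP/andP => [pt|[/eqP fn /eqP pt]].
    rewrite multiplicitiesK // eqxx mult_size_multiplicities.
    by case/andP: pt.
  rewrite -pt /is_partition -/(parts_of _) parts_of_partition_from //.
  rewrite sumn_parts_from fn eqxx andbT.
  by apply: sort_sorted => x y /=; apply: leq_total.
by apply: eq_bigr => j _; rewrite multiplicitiesE.
Qed.

(** The admissible sets are the subsets of [B], the positions where a nonzero part occurs first, and
    [tnth t] maps [B] bijectively onto the nonzero values taken by [t]. *)
Lemma card_overlinings t : is_partition t ->
  #|[set A : {set 'I_n} | is_overpartition (t, A)]| =
  (\prod_(j < n) if count_mem j.+1 (parts_of t) == 0 then 1 else 2)%N.
Proof.
move=> pt; pose B := [set i | (0 < tnth t i)%N && (index (tnth t i) t == i :> nat)].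
rewrite (_ : [set A | _] = powerset B); last first.
  apply/setP => A; rewrite !inE /is_overpartition /= pt /=.
  by apply/forall_inP/fintype.subsetP => [H i /H|H i /H]; rewrite inE.
rewrite card_powerset.
rewrite (eq_bigr (fun j : 'I_n => if (lift ord0 j) \in t then 2 else 1)%N); last first.
  move=> j _; rewrite -leqn0 leqNgt -has_count has_pred1.
  by rewrite if_neg -[j.+1]/(val (lift ord0 j)) (mem_map val_inj).
rewrite -big_mkcond /= prod_nat_const; congr (2 ^ _)%N.
rewrite -(@card_in_imset _ _ (tnth t) B); last first.
  move=> i j; rewrite !inE => /andP[_ /eqP ei] /andP[_ /eqP ej] eij.
  by apply/val_inj; rewrite /= -ei -ej eij.
rewrite -[RHS](card_imset _ (@lift_inj _ ord0)).
apply: eq_card => x; apply/imsetP/imsetP => [[i]|[j]].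
  rewrite inE => /andP[x0 _] ->.
  have ltn' : ((tnth t i).-1 < n)%N by rewrite -ltnS prednK.
  exists (Ordinal ltn').
    rewrite -[_ \in _]/(lift ord0 (Ordinal ltn') \in val t).
    rewrite (_ : lift ord0 _ = tnth t i) ?mem_tnth //.
    by apply/val_inj; rewrite /= /bump /= add1n prednK.
  by apply/val_inj; rewrite /= /bump /= add1n prednK.
rewrite -[j \in _]/(lift ord0 j \in val t) => jt ->.
have lti : (index (lift ord0 j) t < n)%N by have := jt; rewrite -index_mem size_tuple.
have ti : tnth t (Ordinal lti) = lift ord0 j.
  by rewrite (tnth_nth ord0) /= nth_index.
by exists (Ordinal lti); rewrite // inE ti /= eqxx.
Qed.

Lemma partitionsE :
  partitions n = (\prod_(j < n) \sum_(e < n.+1) 1 *: 'X^(j.+1 * e) : {poly int})`_n.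
Proof.
rewrite -(@sum_partitions (fun=> 1)) // /partitions.
under eq_bigr => t _ do rewrite big1 //.
by rewrite sumr_const cardsE natz.
Qed.

Lemma overpartitionsE : overpartitions n =
  (\prod_(j < n) \sum_(e < n.+1)
     (if e == 0 :> nat then 1 else 2) *: 'X^(j.+1 * e) : {poly int})`_n.
Proof.
rewrite -(@sum_partitions (fun e => if e == 0%N then 1 else 2)) // /overpartitions.
transitivity (\sum_(t : n.-tuple 'I_n.+1) \sum_(A : {set 'I_n} | is_overpartition (t, A)) 1 : int).
  rewrite pair_big_dep /= sumr_const natz; congr (Posz _).
  by apply: eq_card => -[t A]; rewrite !inE.
rewrite [RHS]big_mkcond; apply: eq_bigr => t _.
case: ifP => pt; last by rewrite big_pred0 // => A; rewrite /is_overpartition /= pt.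
rewrite sumr_const -cardsE card_overlinings // natr_prod.
by apply: eq_bigr => j _; case: ifP.
Qed.

End PartitionCounting.

(** * Partition counts as quotients of formal products *)

Section TruncatedProducts.

(** Uniqueness of the quotient in low degrees; the counting polynomials depend on [n] and match the
    series only up to degree [n]. *)
Lemma fps_div_uniq f g x n : g 0%N = 1 ->
  (forall i, (i <= n)%N -> fps_mul x g i = f i) ->
  forall i, (i <= n)%N -> x i = fps_div f g i.
Proof.
move=> g0 xgf; elim/ltn_ind => i IHi lein.
have := xgf i lein; rewrite -(fps_divK f g0) /fps_mul !big_ord_recr /= subnn g0 !mulr1.
rewrite (eq_bigr (fun j : 'I_i => fps_div f g j * g (i - j)%N)); first by move/addrI.
by move=> j _; rewrite IHi // (leq_trans (ltnW (ltn_ord j))).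
Qed.

(** Computation modulo X^(n+1), with the multiples of X^(n+1) carried along explicitly. *)
Lemma coef_prod_mod n K (A B : 'I_K -> {poly int}) i : (i <= n)%N ->
  (\prod_(j < K) (A j + 'X^(n.+1) * B j))`_i = (\prod_(j < K) A j)`_i.
Proof.
move=> lein; suff [C ->] : exists C, \prod_(j < K) (A j + 'X^(n.+1) * B j) =
    \prod_(j < K) A j + 'X^(n.+1) * C.
  by rewrite coefD coefXnM ltnS lein addr0.
elim/big_rec2: _ => [|j p q _ [C ->]]; first by exists 0; rewrite mulr0 addr0.
exists (A j * C + B j * (p + 'X^(n.+1) * C)).
by rewrite mulrDl !mulrDr !mulrA -!addrA; congr (_ + (_ + _)); rewrite ['X^_ * _]mulrC.
Qed.

Lemma geometric_factor n d : (0 < d)%N ->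
  exists B : {poly int}, (\sum_(e < n.+1) 1 *: 'X^(d * e)) * (1 - 'X^d) =
    1 + 'X^(n.+1) * B.
Proof.
case: d => // d _; exists (- 'X^(d * n.+1)).
under eq_bigr => e _ do rewrite scale1r exprM.
by rewrite mulrC -opprB mulNr -subrX1 opprB mulrN -exprD -exprM mulSn.
Qed.

(** The sum 1 + 2x + 2x^2 + ... is twice the geometric series minus 1, hence (1 + x) / (1 - x). *)
Lemma geometric_factor2 n d : (0 < d)%N ->
  exists B : {poly int},
   (\sum_(e < n.+1) (if e == 0 :> nat then 1 else 2) *: 'X^(d * e)) * (1 - 'X^d) =
    (1 + 'X^d) + 'X^(n.+1) * B.
Proof.
move=> d0; have [B HB] := geometric_factor n d0; exists (B *+ 2).
have -> : \sum_(e < n.+1) (if e == 0 :> nat then 1 else 2) *: 'X^(d * e) =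
    (\sum_(e < n.+1) 1 *: 'X^(d * e)) *+ 2 - 1 :> {poly int}.
  rewrite !big_ord_recl /= muln0 expr0 scale1r mulrnDl -sumrMnl.
  rewrite mulr2n addrAC addrK; congr (_ + _); apply: eq_bigr => i _.
  by rewrite scale1r scaler_nat.
rewrite mulrBl mul1r mulrnAl HB mulrnAr; ring.
Qed.

Lemma coef_prod_last i n (c : int) : (i <= n)%N ->
  (\prod_(j < n.+1) (1 + c *: 'X^(j.+1)) : {poly int})`_i =
  (\prod_(j < n) (1 + c *: 'X^(j.+1)) : {poly int})`_i.
Proof.
move=> lein; rewrite big_ord_recr /= mulrDr mulr1 -scalerAr coefD coefZ coefMXn.
by rewrite ltnS lein mulr0 addr0.
Qed.

Lemma qpochX_coef i n : (i <= n)%N ->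
  qpoch 'X 'X i = (\prod_(j < n) (1 - 'X^(j.+1)) : {poly int})`_i.
Proof.
move=> lein; have := coef_prod_last (-1) lein.
have E K : \prod_(j < K) (1 + (-1) *: 'X^(j.+1)) = \prod_(j < K) (1 - 'X^(j.+1)) :> {poly int}.
  by apply: eq_bigr => j _; rewrite scaleN1r.
rewrite !E => <-; have := qpochXnE 1 i; rewrite expr1 => ->.
rewrite -(@coef_euler_prod 1 i.+1 n.+1) // /euler_prod.
by under eq_bigr => j _ do rewrite mul1n.
Qed.

Lemma qpochNX_coef i n : (i <= n)%N ->
  qpoch (- 'X) 'X i = (\prod_(j < n) (1 + 'X^(j.+1)) : {poly int})`_i.
Proof.
move=> lein; have := coef_prod_last 1 lein.
have E K : \prod_(j < K) (1 + 1 *: 'X^(j.+1)) = \prod_(j < K) (1 + 'X^(j.+1)) :> {poly int}.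
  by apply: eq_bigr => j _; rewrite scale1r.
rewrite !E => <-; have := @qpochN_coef 1 i n.+1 isT lein; rewrite expr1 => ->.
by under eq_bigr => j _ do rewrite mul1n.
Qed.

Lemma partitions_div : partitions =1 fps_div (fun n => (n == 0%N)%:R) (qpoch 'X 'X).
Proof.
move=> n; rewrite partitionsE.
have [q0 _] := qpoch0 (isT : 0 < 1)%N; rewrite expr1 in q0.
set p := \prod_(j < n) _; rewrite -[LHS]/(nth 0 p n).
apply: (@fps_div_uniq _ _ (nth 0 p) n q0 _ n) => // i lein; rewrite /p.
have [B HB] : exists B : 'I_n -> {poly int}, forall j : 'I_n,
    (\sum_(e < n.+1) 1 *: 'X^(j.+1 * e)) * (1 - 'X^(j.+1)) = 1 + 'X^(n.+1) * B j.
  by have [B HB] := fin_all_exists (fun j : 'I_n => geometric_factor n (ltn0Sn j)); exists B.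
rewrite (fps_mul_coef (p := \prod_(j < n) \sum_(e < n.+1) 1 *: 'X^(j.+1 * e))
  (q := \prod_(j < n) (1 - 'X^(j.+1)))) //; last first.
  by move=> k leki; rewrite (@qpochX_coef k n) // (leq_trans leki).
rewrite -big_split /=; under eq_bigr => j _ do rewrite HB.
by rewrite (coef_prod_mod (fun=> 1)) // big1 // coef1.
Qed.

Lemma overpartitions_div : overpartitions =1 fps_div (qpoch (- 'X) 'X) (qpoch 'X 'X).
Proof.
move=> n; rewrite overpartitionsE.
have [q0 _] := qpoch0 (isT : 0 < 1)%N; rewrite expr1 in q0.
set p := \prod_(j < n) _; rewrite -[LHS]/(nth 0 p n).
apply: (@fps_div_uniq _ _ (nth 0 p) n q0 _ n) => // i lein; rewrite /p.
have [B HB] : exists B : 'I_n -> {poly int}, forall j : 'I_n,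
    (\sum_(e < n.+1) (if e == 0 :> nat then 1 else 2) *: 'X^(j.+1 * e)) * (1 - 'X^(j.+1))
    = (1 + 'X^(j.+1)) + 'X^(n.+1) * B j.
  by have [B HB] := fin_all_exists (fun j : 'I_n => geometric_factor2 n (ltn0Sn j)); exists B.
rewrite (fps_mul_coef (p := \prod_(j < n) \sum_(e < n.+1)
    (if e == 0 :> nat then 1 else 2) *: 'X^(j.+1 * e))
  (q := \prod_(j < n) (1 - 'X^(j.+1)))) //; last first.
  by move=> k leki; rewrite (@qpochX_coef k n) // (leq_trans leki).
rewrite -big_split /=; under eq_bigr => j _ do rewrite HB.
by rewrite (coef_prod_mod (fun j : 'I_n => 1 + 'X^(j.+1))) // (@qpochNX_coef i n).
Qed.

Lemma log_deriv_partitions : log_deriv (weighted_divsum [:: (1%N, 1)]) partitions.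
Proof.
have [q0 _] := qpoch0 (isT : 0 < 1)%N; rewrite expr1 in q0.
have l1 := @log_deriv_qpochXn 1 isT; rewrite expr1 in l1.
have l0 : log_deriv (fun=> 0) (fun n => (n == 0%N)%:R).
  move=> n; rewrite /fps_euler /fps_mul big1 => [|i _]; last by rewrite mul0r.
  by case: n => [|n]; rewrite ?mul0r ?mulr0.
apply: (eq_log_deriv _ _ (log_deriv_div q0 (fps_divK _ q0) l0 l1)) => [N|n].
  by rewrite weighted_divsumE big_cons big_nil /=; ring.
by rewrite partitions_div.
Qed.

Lemma log_deriv_overpartitions :
  log_deriv (weighted_divsum [:: (1%N, 2%:Z); (2%N, -1)]) overpartitions.
Proof.
have [q0 _] := qpoch0 (isT : 0 < 1)%N; rewrite expr1 in q0.
have l1 := @log_deriv_qpochXn 1 isT; have lN1 := @log_deriv_qpochN 1 isT.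
rewrite !expr1 in l1 lN1.
apply: (eq_log_deriv _ _ (log_deriv_div q0 (fps_divK _ q0) lN1 l1)) => [N|n].
  by rewrite weighted_divsumE !big_cons big_nil /= muln1; ring.
by rewrite overpartitions_div.
Qed.

Lemma partitions0 : partitions 0 = 1.
Proof. by rewrite partitions_div fps_div0. Qed.

Lemma overpartitions0 : overpartitions 0 = 1.
Proof.
rewrite overpartitions_div fps_div0.
by have [_] := qpoch0 (isT : 0 < 1)%N; rewrite expr1.
Qed.

End TruncatedProducts.

Local Open Scope classical_set_scope.
Local Open Scope ring_scope.

(** * Elementary real analysis *)

Section DerivativeRules.

Variable R : realType.
Implicit Types (f g : R -> R) (x a b c : R).

Lemma is_derive1_eq f x a b : is_derive x 1 f a -> a = b -> is_derive x 1 f b.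
Proof. by move=> fa <-. Qed.

Lemma is_derive1_cst c x : is_derive x 1 (fun=> c) 0.
Proof. exact: is_derive_cst. Qed.

Lemma is_derive1_id x : is_derive x 1 (fun y => y) 1.
Proof. exact: is_derive_id. Qed.

Lemma is_derive1D f g x a b : is_derive x 1 f a -> is_derive x 1 g b ->
  is_derive x 1 (fun y => f y + g y) (a + b).
Proof. by move=> fa gb; exact: is_deriveD. Qed.

Lemma is_derive1N f x a : is_derive x 1 f a -> is_derive x 1 (fun y => - f y) (- a).
Proof. by move=> fa; exact: is_deriveN. Qed.

Lemma is_derive1M f g x a b : is_derive x 1 f a -> is_derive x 1 g b ->
  is_derive x 1 (fun y => f y * g y) (a * g x + f x * b).
Proof.
move=> fa gb; have H := is_deriveM fa gb.
by apply: (is_derive1_eq H); rewrite addrC /GRing.scale /= [g x * a]mulrC.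
Qed.

Lemma is_derive1X f n x a : is_derive x 1 f a ->
  is_derive x 1 (fun y => f y ^+ n.+1) (n.+1%:R * f x ^+ n * a).
Proof.
move=> fa; elim: n => [|n IHn].
  by under eq_fun do rewrite expr1; apply: (is_derive1_eq fa); rewrite !mul1r.
under eq_fun do rewrite exprS; apply: is_derive1_eq (is_derive1M fa IHn) _.
by rewrite exprS [in RHS]mulrS; ring.
Qed.

Lemma is_derive1V f x a : f x != 0 -> is_derive x 1 f a ->
  is_derive x 1 (fun y => (f y)^-1) (- a / f x ^+ 2).
Proof.
move=> fx0 fa; apply: (is_derive1_eq (is_deriveV fx0 fa)).
by rewrite /GRing.scale /= !mulNr mulrC.
Qed.

Lemma is_derive1_expR f x a : is_derive x 1 f a ->
  is_derive x 1 (fun y => expR (f y)) (a * expR (f x)).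
Proof.
move=> fa; apply: is_derive1_eq (is_derive1_comp (is_derive_expR (f x)) fa) _.
by rewrite mulrC.
Qed.

Lemma is_derive1_sin f x a : is_derive x 1 f a ->
  is_derive x 1 (fun y => sin (f y)) (a * cos (f x)).
Proof.
move=> fa; apply: is_derive1_eq (is_derive1_comp (is_derive_sin (f x)) fa) _.
by rewrite mulrC.
Qed.

Lemma is_derive1_cos f x a : is_derive x 1 f a ->
  is_derive x 1 (fun y => cos (f y)) (- (a * sin (f x))).
Proof.
move=> fa; apply: is_derive1_eq (is_derive1_comp (is_derive_cos (f x)) fa) _.
by rewrite mulNr mulrC.
Qed.

Lemma is_derive1_lnf f x a : 0 < f x -> is_derive x 1 f a ->
  is_derive x 1 (fun y => ln (f y)) (a / f x).
Proof.
move=> fx0 fa; apply: is_derive1_eq (is_derive1_comp (is_derive1_ln fx0) fa) _.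
by rewrite mulrC.
Qed.

End DerivativeRules.

Ltac der_eta :=
  lazymatch goal with
  | |- is_derive _ _ (fun _ => _) _ => idtac
  | |- is_derive ?x ?v ?f ?d => change (is_derive x v (fun y => f y) d)
  end.
Ltac der_step :=
  der_eta;
  match goal with
  | |- is_derive _ _ (fun y => y) _ => apply: is_derive1_id
  | |- is_derive _ _ (fun y => ?c) _ => apply: is_derive1_cst
  | |- is_derive _ _ (fun y => @?f y + @?g y) _ => notypeclasses refine (is_derive1D _ _)
  | |- is_derive _ _ (fun y => - @?f y) _ => notypeclasses refine (is_derive1N _)
  | |- is_derive _ _ (fun y => @?f y * @?g y) _ => notypeclasses refine (is_derive1M _ _)
  | |- is_derive _ _ (fun y => (@?f y)^-1) _ => notypeclasses refine (is_derive1V _ _)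
  | |- is_derive _ _ (fun y => @?f y ^+ _) _ => notypeclasses refine (is_derive1X _ _)
  | |- is_derive _ _ (fun y => expR (@?f y)) _ => notypeclasses refine (is_derive1_expR _)
  | |- is_derive _ _ (fun y => sin (@?f y)) _ => notypeclasses refine (is_derive1_sin _)
  | |- is_derive _ _ (fun y => cos (@?f y)) _ => notypeclasses refine (is_derive1_cos _)
  | |- is_derive _ _ (fun y => ln (@?f y)) _ => notypeclasses refine (is_derive1_lnf _ _)
  end.
Ltac der := notypeclasses refine (is_derive1_eq _ _); [repeat der_step|rewrite /=].

(** * Mean value arguments and Taylor bounds for sine and cosine *)

Section Monotonicity.

Variable R : realType.
Implicit Types (f g df dg : R -> R) (x a b c : R).

Definition derive_on f df a b := forall x, a <= x <= b -> is_derive x 1 f (df x).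

Lemma is_derive1_within f df a b :
  derive_on f df a b -> {within `[a, b], continuous f}.
Proof.
move=> fdf; apply: derivable_within_continuous => x; rewrite in_itv /= => /fdf.
by case.
Qed.

Lemma mean_value f df a b : a < b ->
  derive_on f df a b ->
  exists2 c, a < c < b & f b - f a = df c * (b - a).
Proof.
move=> ab fdf.
have fdf' x : x \in `]a, b[ -> is_derive x 1 f (df x).
  by rewrite in_itv /= => /andP[ax xb]; apply: fdf; rewrite !ltW.
have [c cab E] := MVT ab fdf' (is_derive1_within fdf).
by exists c => //; move: cab; rewrite in_itv.
Qed.

Lemma derive_ge0_le f df a b : a <= b ->
  derive_on f df a b ->
  (forall x, a < x < b -> 0 <= df x) -> f a <= f b.
Proof.
rewrite le_eqVlt => /predU1P[-> //|ab] fdf df0.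
have [c cab E] := mean_value ab fdf.
by rewrite -subr_ge0 E mulr_ge0 ?df0 // subr_ge0 ltW.
Qed.

Lemma derive_le f g df dg a b : a <= b ->
  derive_on f df a b ->
  derive_on g dg a b ->
  (forall x, a < x < b -> df x <= dg x) -> f b - f a <= g b - g a.
Proof.
move=> ab fdf gdg dfg.
have : g a - f a <= g b - f b.
  apply: (@derive_ge0_le (fun y => g y - f y) (fun y => dg y - df y)) => [//|x xab|x xab].
    by apply: is_derive1D; [exact: gdg | apply: is_derive1N; exact: fdf].
  by rewrite subr_ge0; exact: dfg.
lra.
Qed.

(** First rung of a ladder: each of the next three bounds compares derivatives by means of the
    previous bound. *)
Lemma sin_le_id x : 0 <= x -> sin x <= x.
Proof.
move=> x0; suff: 0 - sin 0 <= x - sin x by rewrite sin0; lra.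
apply: (@derive_ge0_le (fun y => y - sin y) (fun y => 1 - cos y)) => [//|y _|y _].
  by der; ring.
by rewrite subr_ge0 cos_le1.
Qed.

Lemma cos_ge_quad x : 1 - x ^+ 2 / 2 <= cos x.
Proof.
wlog x0 : x / 0 <= x => [hw|].
  by have [/hw //|/ltW x0] := leP 0 x; rewrite -cosN -sqrrN; apply: hw; rewrite oppr_ge0.
suff: cos 0 - (1 - 0 ^+ 2 / 2) <= cos x - (1 - x ^+ 2 / 2) by rewrite cos0; lra.
apply: (@derive_ge0_le (fun y => cos y - (1 - y ^+ 2 / 2)) (fun y => y - sin y)) => [//|y _|y].
  by der; field.
by case/andP=> y0 _; rewrite subr_ge0 sin_le_id ?ltW.
Qed.

Lemma sin_ge_cubic x : 0 <= x -> x - x ^+ 3 / 6 <= sin x.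
Proof.
move=> x0; suff: sin 0 - (0 - 0 ^+ 3 / 6) <= sin x - (x - x ^+ 3 / 6).
  by rewrite sin0; lra.
apply: (@derive_ge0_le (fun y => sin y - (y - y ^+ 3 / 6))
  (fun y => cos y - (1 - y ^+ 2 / 2))) => [//|y _|y _].
  by der; field.
by rewrite subr_ge0 cos_ge_quad.
Qed.

Lemma cos_le_quartic x : 0 <= x -> cos x <= 1 - x ^+ 2 / 2 + x ^+ 4 / 24.
Proof.
move=> x0; suff: (1 - 0 ^+ 2 / 2 + 0 ^+ 4 / 24) - cos 0 <=
   (1 - x ^+ 2 / 2 + x ^+ 4 / 24) - cos x by rewrite cos0; lra.
apply: (@derive_ge0_le (fun y => (1 - y ^+ 2 / 2 + y ^+ 4 / 24) - cos y)
  (fun y => sin y - (y - y ^+ 3 / 6))) => [//|y _|y].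
  by der; field.
by case/andP=> y0 _; rewrite subr_ge0 sin_ge_cubic ?ltW.
Qed.

Lemma cos_taylor x : `|cos x - (1 - x ^+ 2 / 2)| <= `|x| ^+ 3.
Proof.
wlog x0 : x / 0 <= x => [hw|].
  have [/hw //|/ltW x0] := leP 0 x.
  by have := hw (- x); rewrite cosN normrN sqrrN oppr_ge0; exact.
rewrite ger0_norm ?subr_ge0 ?cos_ge_quad // (ger0_norm x0).
have [x1|x1] := leP x 4.
  have := cos_le_quartic x0.
  have : 0 <= x ^+ 3 * (24 - x) by rewrite mulr_ge0 ?exprn_ge0 //; lra.
  lra.
have : 0 <= x ^+ 2 * (x - 4) by rewrite mulr_ge0 ?exprn_ge0 //; lra.
have : 0 <= (x - 1) * (x + 1) by rewrite mulr_ge0 //; lra.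
have := cos_le1 x; lra.
Qed.

Lemma sin_taylor x : `|sin x - x| <= `|x| ^+ 3.
Proof.
wlog x0 : x / 0 <= x => [hw|].
  have [/hw //|/ltW x0] := leP 0 x.
  by have := hw (- x); rewrite oppr_ge0 sinN -opprD !normrN; exact.
rewrite distrC ger0_norm ?subr_ge0 ?sin_le_id // (ger0_norm x0).
have := sin_ge_cubic x0; have : 0 <= x ^+ 3 by rewrite exprn_ge0.
lra.
Qed.

Lemma norm_sin_le x : `|sin x| <= `|x|.
Proof.
wlog x0 : x / 0 <= x => [hw|].
  have [/hw //|/ltW x0] := leP 0 x.
  by have := hw (- x); rewrite oppr_ge0 sinN !normrN; exact.
rewrite (ger0_norm x0) ler_norml sin_le_id // andbT.
have [x1|x1] := leP x 1; last by apply: le_trans (sin_geN1 _); rewrite lerN2 ltW.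
by have := sin_ge_cubic x0; have : x ^+ 3 <= x; [rewrite -[leRHS]mulr1 exprS ler_wpM2l // exprn_ile1| lra].
Qed.

Lemma sin_ge_third x : 0 <= x <= 2 -> x / 3 <= sin x.
Proof.
case/andP=> x0 x2; have := sin_ge_cubic x0.
have : x ^+ 3 <= x * 4; last by lra.
by rewrite exprS ler_wpM2l // (_ : 4 = 2 ^+ 2) ?lerXn2r ?nnegrE // -natrX.
Qed.

Lemma id_mulr_cos_le_sin x : 0 <= x <= pi -> x * cos x <= sin x.
Proof.
case/andP=> x0 xpi.
suff: sin 0 - 0 * cos 0 <= sin x - x * cos x by rewrite sin0; lra.
apply: (@derive_ge0_le (fun y => sin y - y * cos y) (fun y => y * sin y)) => [//|y _|y].
  by der; ring.
case/andP=> y0 yx; rewrite mulr_ge0 ?ltW // sin_gt0_pi // y0.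
by rewrite (lt_le_trans yx).
Qed.

(* 1 / sin^2 = 1 + cot^2, and cot x <= 1 / x on the first quadrant. *)
Lemma sin2V_bounds x : 0 < x <= pi / 2 ->
  x ^- 2 <= (sin x) ^- 2 <= x ^- 2 + 1.
Proof.
case/andP=> x0 xpi; have ph := pihalf_lt2 R.
have pi0 := pi_gt0 R.
have s0 : 0 < sin x by apply: sin_gt0_pi; lra.
have c0 : 0 <= cos x by apply: cos_ge0_pihalf; lra.
have lesx : sin x <= x by apply/sin_le_id/ltW.
have lecs : x * cos x <= sin x by apply: id_mulr_cos_le_sin; lra.
apply/andP; split.
  by rewrite lef_pV2 ?posrE ?exprn_gt0 // ler_sqr // nnegrE ltW.
have -> : sin x ^- 2 = 1 + (cos x / sin x) ^+ 2.
  have := cos2Dsin2 x; move: s0; set s := sin x; set c := cos x => s0 e.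
  by rewrite -[s ^- 2]mul1r -[in LHS]e; field; rewrite gt_eqF.
have le : cos x / sin x <= x^-1 by rewrite ler_pdivrMr // mulrC ler_pdivlMr // mulrC.
have ct0 : 0 <= cos x / sin x by rewrite divr_ge0 // ltW.
by rewrite addrC lerD2r -exprVn ler_sqr // nnegrE // invr_ge0 ltW.
Qed.

Lemma sin2V_double x : sin x != 0 -> cos x != 0 ->
  sin (x *+ 2) ^- 2 = (sin x ^- 2 + cos x ^- 2) / 4.
Proof.
move=> s0 c0; rewrite sin_mulr2n; have := cos2Dsin2 x.
move: s0 c0; set s := sin x; set c := cos x => s0 c0 e.
have -> : (c * s *+ 2) ^- 2 = (c ^+ 2 + s ^+ 2) / (4 * c ^+ 2 * s ^+ 2).
  by rewrite e mul1r; congr (_^-1); ring.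
by field; rewrite s0 c0.
Qed.

End Monotonicity.

Lemma cvgny_ge_id (u : nat -> nat) : (forall n, n <= u n)%N -> u n @[n --> \oo] --> \oo.
Proof.
move=> leu; apply/cvgnyPge => A; near=> n; apply: leq_trans (leu n).
by near: n; exact: nbhs_infty_ge.
Unshelve. all: by end_near. Qed.

(** * The Basel sum by doubling of angles *)

Section Basel.

Variable R : realType.

Let angle n k : R := (2 * k + 1)%:R * pi / 2 ^+ (n + 2).

Lemma angle_pos n k : 0 < angle n k.
Proof. by rewrite /angle divr_gt0 ?mulr_gt0 ?exprn_gt0 ?pi_gt0 // ltr0n addn1. Qed.

Lemma angle_lt n k : (k < 2 ^ n)%N -> angle n k < pi / 2.
Proof.
move=> kn; rewrite /angle ltr_pdivrMr ?exprn_gt0 // mulrAC ltr_pdivlMr //.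
rewrite mulrAC [ltRHS]mulrC ltr_pM2r ?pi_gt0 //.
by rewrite -natrX -natrM ltr_nat expnD; lia.
Qed.

(** At level n + 1 the angles come in pairs x, pi / 2 - x, with 2x an angle of level n. By
    [sin2V_double] each pair contributes four times the term of 2x, so the sum is multiplied by 4 at
    each level. *)
Lemma sum_sin2V n :
  \sum_(k < 2 ^ n) (sin (angle n k)) ^- 2 = 2 * 4 ^+ n.
Proof.
elim: n => [|n IHn].
  rewrite big_ord1 expr0 mulr1 /angle muln0 mul1r (_ : 2 ^+ (0 + 2) = 4); last by rewrite -natrX.
  have := @sin2V_double R (pi / 4).
  have pi0 := pi_gt0 R.
  have -> : (pi / 4) *+ 2 = pi / 2 :> R by field.
  have e : cos (pi / 4) = sin (pi / 4) :> R.
    have -> : pi / 4 = - (pi / 4) + pi / 2 :> R by field.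
    by rewrite cosDpihalf sinN opprK; congr sin; field.
  have s0 : 0 < sin (pi / 4) :> R by apply: sin_gt0_pi; lra.
  rewrite e sin_pihalf expr1n invr1 gt_eqF // => /(_ isT isT); lra.
rewrite exprS mulrCA -IHn expnS mul2n -addnn big_split_ord /= mulr_sumr.
rewrite [X in _ + X](reindex_inj rev_ord_inj) /= -big_split /=.
apply: eq_bigr => k _.
have e1 : angle n k = angle n.+1 k *+ 2.
  rewrite /angle addSn (exprS _ (n + 2)) -mulr_natr; field; rewrite expf_neq0 //.
have e2 : angle n.+1 (2 ^ n + (2 ^ n - k.+1)) = pi / 2 - angle n.+1 k.
  have E : (2 * (2 ^ n + (2 ^ n - k.+1)) + 1)%:R = 2 ^+ (n + 2) - (2 * k + 1)%:R :> R.
    rewrite -natrX -natrB; last by have := ltn_ord k; rewrite expnD; lia.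
    by congr (_%:R); have := ltn_ord k; rewrite expnD; lia.
  rewrite /angle E addSn (exprS _ (n + 2)); field; rewrite expf_neq0 //.
have kn : (k < 2 ^ n.+1)%N by rewrite expnS; have := ltn_ord k; lia.
have a0 := angle_pos n.+1 k; have a1 := angle_lt kn; have pi0 := pi_gt0 R.
rewrite e2 -opprB sinN sinBpihalf opprK e1 sin2V_double.
- by field; rewrite !gt_eqF ?cos_gt0_pihalf ?sin_gt0_pi //; lra.
- by rewrite gt_eqF // sin_gt0_pi //; lra.
- by rewrite gt_eqF // cos_gt0_pihalf //; lra.
Qed.

Definition odd_squares (n : nat) : R := \sum_(k < n) ((2 * k + 1)%:R ^- 2).

Lemma expr4 n : 4 ^+ n = 2 ^+ n * 2 ^+ n :> R.
Proof.
have -> : 4 = 2 ^+ 2 :> R by rewrite -natrX.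
by rewrite -exprM mulnC exprM expr2.
Qed.

(** Replacing 1 / sin^2 by 1 / x^2 costs at most 1 for each of the 2^n angles. The scaling factor
    pi^2 / (16 4^n) turns this into the error pi^2 / 16 / 2^n. *)
Lemma odd_squares_bounds n :
  pi ^+ 2 / 8 - pi ^+ 2 / 16 / 2 ^+ n <= odd_squares (2 ^ n) <= pi ^+ 2 / 8.
Proof.
have pi0 := pi_gt0 R.
have e k : (angle n k) ^- 2 = (2 * k + 1)%:R ^- 2 * (16 * 4 ^+ n / pi ^+ 2).
  rewrite /angle; have -> : 2 ^+ (n + 2) = 2 ^+ n * 4 :> R by rewrite exprD; congr (_ * _); rewrite -natrX.
  have : (2 * k + 1)%:R != 0 :> R by rewrite pnatr_eq0 addn1.
  have : 2 ^+ n != 0 :> R by rewrite expf_neq0.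
  rewrite expr4; move: (2 ^+ n) ((2 * k + 1)%:R) => q a q0 a0.
  by move: (pi : R) pi0 => p p0; field; rewrite (gt_eqF p0) q0 a0.
have b (k : 'I_(2 ^ n)) : angle n k ^- 2 <= sin (angle n k) ^- 2 <= angle n k ^- 2 + 1.
  by apply: sin2V_bounds; rewrite angle_pos ltW // angle_lt.
have lo : \sum_(k < 2 ^ n) (angle n k) ^- 2 <= 2 * 4 ^+ n.
  rewrite -sum_sin2V; apply: ler_sum => k _.
  by have /andP[] := b k.
have hi : 2 * 4 ^+ n <= \sum_(k < 2 ^ n) (angle n k) ^- 2 + 2 ^+ n.
  rewrite -sum_sin2V -natrX -[X in _ + X%:R]card_ord -sumr_const -big_split /=.
  apply: ler_sum => k _.
  by have /andP[] := b k.
have E : \sum_(k < 2 ^ n) (angle n k) ^- 2 = odd_squares (2 ^ n) * (16 * 4 ^+ n / pi ^+ 2).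
  by rewrite mulr_suml; apply: eq_bigr => k _.
rewrite E in lo hi.
have q0 : 0 < 2 ^+ n :> R by rewrite exprn_gt0.
rewrite expr4 in lo hi.
move: lo hi pi0 q0 {E e b}; move: (2 ^+ n : R) (odd_squares _) (pi : R) => q o p lo hi p0 q0.
have c0 : 0 < p ^+ 2 / (16 * (q * q)) by rewrite divr_gt0 ?exprn_gt0 ?mulr_gt0.
apply/andP; split.
  have := ler_wpM2r (ltW c0) hi.
  have -> : 2 * (q * q) * (p ^+ 2 / (16 * (q * q))) = p ^+ 2 / 8 by field; rewrite gt_eqF.
  have -> : (o * (16 * (q * q) / p ^+ 2) + q) * (p ^+ 2 / (16 * (q * q))) = o + p ^+ 2 / 16 / q.
    by field; rewrite !gt_eqF.
  by lra.
have := ler_wpM2r (ltW c0) lo.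
have -> : 2 * (q * q) * (p ^+ 2 / (16 * (q * q))) = p ^+ 2 / 8 by field; rewrite gt_eqF.
suff -> : (o * (16 * (q * q) / p ^+ 2)) * (p ^+ 2 / (16 * (q * q))) = o by [].
by field; rewrite !gt_eqF.
Qed.

Definition inv_squares : R^nat := fun n => n.+1%:R ^- 2.

Lemma series_inv_squares_double n :
  series inv_squares (n + n)%N = odd_squares n + series inv_squares n / 4.
Proof.
rewrite /odd_squares /series /= mulr_suml; elim: n => [|n IHn].
  by rewrite !big_nil big_ord0 addr0.
rewrite addSn addnS !big_nat_recr //= IHn big_ord_recr /=.
have -> : inv_squares (n + n)%N = (2 * n + 1)%:R ^- 2.
  by rewrite /inv_squares; congr (_%:R ^- 2); lia.
have -> : inv_squares (n + n).+1 = inv_squares n / 4.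
  rewrite /inv_squares; have -> : (n + n).+2%:R = 2 * n.+1%:R :> R.
    by rewrite -natrM; congr (_%:R); lia.
  have n0 : n.+1%:R != 0 :> R by rewrite pnatr_eq0.
  by move: (n.+1%:R) n0 => a a0; field.
ring.
Qed.

Lemma cvg_odd_squares2 : odd_squares (2 ^ n) @[n --> \oo] --> (pi ^+ 2 / 8 : R).
Proof.
apply: (@squeeze_cvgr _ _ _ _ (fun n => pi ^+ 2 / 8 - pi ^+ 2 / 16 / 2 ^+ n) (cst (pi ^+ 2 / 8))).
- by near=> n; exact: odd_squares_bounds.
- rewrite -[X in _ --> X]subr0; apply: cvgB; first exact: cvg_cst.
  rewrite -[X in _ --> X](mulr0 (pi ^+ 2 / 16)); apply: cvgMr.
  under eq_fun do rewrite -exprVn.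
  by apply: cvg_expr; rewrite ger0_norm ?invr_ge0 // invf_lt1 // ltr1n.
- exact: cvg_cst.
Unshelve. all: by end_near. Qed.

Lemma odd_squares_le n : odd_squares n <= pi ^+ 2 / 8.
Proof.
have [_ le] := andP (odd_squares_bounds n); apply: le_trans le.
have := subnKC (ltnW (ltn_expl n (isT : 1 < 2)%N)) => <-.
by rewrite /odd_squares big_split_ord /= lerDl sumr_ge0 // => k _; rewrite invr_ge0 exprn_ge0.
Qed.

(** Splitting the first 2n terms by parity gives l = pi^2 / 8 + l / 4 for the limit. Powers of two
    are used as indices because the odd squares are only controlled there. *)
Lemma basel : series inv_squares @ \oo --> (pi ^+ 2 / 6 : R).
Proof.
have nd : nondecreasing_seq (series inv_squares).
  by apply: nondecreasing_series => n _; rewrite invr_ge0 exprn_ge0.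
have cv : cvgn (series inv_squares).
  apply: nondecreasing_is_cvgn => //; exists (pi ^+ 2 / 6) => _ [n _ <-].
  (* S(n) <= S(2n) <= pi^2 / 8 + S(n) / 4 bounds the partial sums. *)
  have := nd _ _ (leq_addr n n); have := series_inv_squares_double n.
  have := odd_squares_le n; lra.
have /cvg_ex[/= l cvl] := cv.
suff <- : l = pi ^+ 2 / 6 by [].
have c2 : series inv_squares (2 ^ n + 2 ^ n)%N @[n --> \oo] --> l.
  apply: cvg_comp cvl; apply: cvgny_ge_id => n.
  by rewrite (leq_trans (ltnW (ltn_expl n (isT : 1 < 2)%N))) // leq_addr.
have c1 : series inv_squares (2 ^ n)%N @[n --> \oo] --> l.
  by apply: cvg_comp cvl; apply: cvgny_ge_id => n; exact/ltnW/ltn_expl.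
have c3 : series inv_squares (2 ^ n + 2 ^ n)%N @[n --> \oo] --> pi ^+ 2 / 8 + l / 4.
  under eq_fun do rewrite series_inv_squares_double.
  by apply: cvgD; [exact: cvg_odd_squares2 | exact: cvgMl].
have e : l = pi ^+ 2 / 8 + l / 4 by exact: (cvg_unique (@Rhausdorff R) c2 c3).
lra.
Qed.

End Basel.

(** * Dominated convergence with the majorant 1 / (1 + x^2) *)

Section RealDominatedConvergence.

Variable R : realType.
Let mu := @lebesgue_measure R.

Lemma Rintegral_dominated_cvg (f_ : nat -> R -> R) (f g : R -> R) :
  (forall n, measurable_fun setT (f_ n)) ->
  (forall x, f_ n x @[n --> \oo] --> f x) ->
  mu.-integrable setT (EFin \o g) ->
  (forall n x, `|f_ n x| <= g x) ->
  mu.-integrable setT (EFin \o f) /\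
  \int[mu]_x (f_ n x) @[n --> \oo] --> \int[mu]_x (f x).
Proof.
move=> mf_ f_f ig f_g.
have mf : measurable_fun setT f.
  by apply: (measurable_fun_cvg (h := f_)) => // x _; exact: f_f.
have [] := @dominated_convergence _ _ _ mu setT measurableT
  (fun n => EFin \o f_ n) (EFin \o f) (EFin \o g).
- by move=> n; apply/measurable_EFinP; exact: mf_.
- by apply/measurable_EFinP; exact: mf.
- by apply: aeW => x _; apply: cvg_EFin; [near=> n | exact: f_f].
- exact: ig.
- by apply: aeW => x n _ /=; rewrite lee_fin; exact: f_g.
move=> fi _ cv; split => //.
by apply: fine_cvg; rewrite fineK //; exact: integrable_fin_num.
Unshelve. all: by end_near. Qed.

Lemma integrable_oneDsqrV : mu.-integrable setT (EFin \o (fun x : R => (1 + x ^+ 2)^-1)).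
Proof.
have c : continuous (fun x : R => (1 + x ^+ 2)^-1) by exact: continuous_oneDsqrV.
apply/integrableP; split.
  by apply/measurable_EFinP; exact: continuous_measurable_fun.
have p (x : R) : 0 <= (1 + x ^+ 2)^-1 by rewrite invr_ge0 addr_ge0 // sqr_ge0.
under eq_integral => x _ do rewrite /= ger0_norm //.
rewrite ge0_symfun_integralT //; last by move=> x /=; rewrite sqrrN.
rewrite (_ : [set x | _] = `[0, +oo[%classic); last first.
  by apply/seteqP; split => x/=; rewrite in_itv/= andbT.
by rewrite integral0y_oneDsqr -EFinM ltry.
Qed.

Lemma expRN_le (k : nat) (y : R) : 0 < y -> expR (- y) <= k`!%:R / y ^+ k.
Proof.
move=> y0; rewrite expRN -[leRHS]invf_div lef_pV2 ?posrE ?expR_gt0 //; last first.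
  by apply: divr_gt0; rewrite ?exprn_gt0 // ltr0n fact_gt0.
case: k => [|k]; first by rewrite expr0 fact0 divr1 ltW // expR_gt1.
by apply: le_trans (expR_ge1Dxn k (ltW y0)); rewrite lerDr.
Qed.

(** The exponent [E] is only asked to grow like x^(2/3): this is what the Poisson kernel estimate
    supplies in [E_cube]. The inequality exp(-y) <= k! / y^k still beats any power. *)
Lemma pow_mul_expRN_le (p : nat) (c : R) : 0 < c ->
  {K | 0 < K & forall x E, 0 <= x -> 0 <= E -> (1 <= x -> c * x ^+ 2 <= E ^+ 3) ->
     x ^+ p * expR (- E) <= K / (1 + x ^+ 2)}.
Proof.
move=> c0; have [j jE] : {j | j = p.+1} by exists p.+1.
have K0 : 0 <= (3 * j)`!%:R / c ^+ j by rewrite divr_ge0 // exprn_ge0 // ltW.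
exists (2 * (1 + (3 * j)`!%:R / c ^+ j)); first by rewrite mulr_gt0 // ltr_wpDr.
move=> x E x0 E0 hE; rewrite ler_pdivlMr; last by rewrite ltr_wpDr // sqr_ge0.
have e1 : expR (- E) <= 1 by rewrite expR_le1 oppr_le0.
have eg := expR_ge0 (- E).
have [x1|x1] := leP x 1.
  have xp : x ^+ p <= 1 by rewrite exprn_ile1.
  have xx : x ^+ 2 <= 1 by rewrite exprn_ile1.
  have : x ^+ p * expR (- E) <= 1 by rewrite mulr_ile1 // exprn_ge0.
  have x2 : 0 <= x ^+ 2 by exact: sqr_ge0.
  have q0 : 0 <= x ^+ p * expR (- E) by rewrite mulr_ge0 // exprn_ge0.
  nra.
have hE' := hE (ltW x1).
have cx : 0 < c * x ^+ 2 by rewrite mulr_gt0 // exprn_gt0 // (lt_trans _ x1).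
have E3 : 0 < E ^+ 3 by exact: lt_le_trans hE'.
have Ep : 0 < E by rewrite lt_neqAle E0 andbT; apply: contraTneq E3 => <-; rewrite expr0n ltxx.
have le1 : expR (- E) <= (3 * j)`!%:R / (c * x ^+ 2) ^+ j.
  apply: le_trans (expRN_le (3 * j) Ep) _.
  rewrite ler_pM2l ?ltr0n ?fact_gt0 // lef_pV2 ?posrE ?exprn_gt0 //.
  by rewrite exprM lerXn2r // nnegrE ltW.
have x20 : 1 <= x ^+ 2 by rewrite exprn_ege1 // ltW.
apply: (@le_trans _ _ (x ^+ p * ((3 * j)`!%:R / (c * x ^+ 2) ^+ j) * (2 * x ^+ 2))).
  apply: ler_pM.
  - by rewrite mulr_ge0 // exprn_ge0.
  - by rewrite addr_ge0 // sqr_ge0.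
  - by rewrite ler_wpM2l // exprn_ge0.
  - by lra.
have xj : 0 < x ^+ 2 ^+ j by rewrite exprn_gt0 // exprn_gt0 // (lt_trans _ x1).
have -> : x ^+ p * ((3 * j)`!%:R / (c * x ^+ 2) ^+ j) * (2 * x ^+ 2) =
    2 * ((3 * j)`!%:R / c ^+ j) * (x ^+ p.+2 / x ^+ 2 ^+ j).
  have := exprn_gt0 j c0; move: xj; rewrite [(c * _) ^+ j]exprMn.
  have -> : x ^+ p.+2 = x * (x * x ^+ p) by rewrite !exprS.
  move: (c ^+ j) (x ^+ 2 ^+ j) ((3 * j)`!%:R) (x ^+ p) => u v w z u0 v0.
  by field; rewrite !gt_eqF.
rewrite -[leRHS]mulr1 ler_pM //.
- by rewrite mulr_ge0.
- by rewrite divr_ge0 ?exprn_ge0 // ltW.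
- by rewrite ler_pM2l // lerDr.
rewrite ler_pdivrMr // mul1r -exprM ler_weXn2l ?(ltW x1) // jE.
by rewrite mul2n -addnn addSn ltnS leq_addl.
Qed.

End RealDominatedConvergence.

(** * Gaussian moments on the line and on the half-line *)

Section GaussianMoments.

Variable R : realType.
Let mu := @lebesgue_measure R.

Definition gauss_weight (x : R) : R := expR (- (x ^+ 2 / 2)).

Lemma is_derive_gauss_weight (x : R) :
  is_derive x 1 gauss_weight (- (x * gauss_weight x)).
Proof. by rewrite /gauss_weight; der; field. Qed.

Lemma continuous_pow_gauss_weight m : continuous (fun x : R => x ^+ m * gauss_weight x).
Proof.
move=> x; apply: cvgM; first exact: exprn_continuous.
by have [/derivable1_diffP/differentiable_continuous] := is_derive_gauss_weight x.
Qed.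

Lemma measurable_pow_gauss_weight m : measurable_fun setT (fun x : R => x ^+ m * gauss_weight x).
Proof. by apply: continuous_measurable_fun; exact: continuous_pow_gauss_weight. Qed.

Lemma pow_gauss_weight_le m : {K : R | 0 < K & forall x,
  `|x ^+ m * gauss_weight x| <= K / (1 + x ^+ 2)}.
Proof.
have [K K0 HK] := @pow_mul_expRN_le R m 8^-1 ltac:(by rewrite invr_gt0).
exists K => // x; rewrite normrM normrX (ger0_norm (expR_ge0 _)) -(real_normK (num_real x)).
apply: HK => // x1; rewrite exprMn [leRHS]mulrC; have -> : 2^-1 ^+ 3 = 8^-1 :> R.
  by rewrite exprVn -natrX.
by rewrite ler_pM2l ?invr_gt0 // ler_eXnr // exprn_ege1.
Qed.

Lemma integrable_oneDsqrVZ (K : R) :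
  mu.-integrable setT (EFin \o (fun x : R => K / (1 + x ^+ 2))).
Proof.
have := @integrableZl _ _ _ mu setT measurableT K _ (integrable_oneDsqrV R).
by apply: eq_integrable => // x _.
Qed.

Lemma integrable_pow_gauss_weight m :
  mu.-integrable setT (EFin \o (fun x : R => x ^+ m * gauss_weight x)).
Proof.
have [K K0 HK] := pow_gauss_weight_le m.
apply: (le_integrable measurableT _ _ (integrable_oneDsqrVZ K)).
  by apply/measurable_EFinP; exact: measurable_pow_gauss_weight.
move=> x _ /=; rewrite lee_fin (le_trans (HK x)) // ler_norm //.
Qed.

(** Unlike [moment], positive for both parities. Its log-convexity across consecutive orders
    provides the Wallis inequalities from which the constant in Stirling's formula is found. *)
Definition half_moment m : R := \int[mu]_(x in `[0, +oo[) (x ^+ m * gauss_weight x).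

Definition moment m : R := \int[mu]_x (x ^+ m * gauss_weight x).

Lemma integrable_half m :
  mu.-integrable `[0, +oo[ (EFin \o (fun x : R => x ^+ m * gauss_weight x)).
Proof. by apply: integrableS (integrable_pow_gauss_weight m). Qed.

Lemma moment0 : moment 0 = Num.sqrt (pi *+ 2).
Proof.
have E x : normal_pdf 0 1 x = (Num.sqrt (pi *+ 2))^-1 * (x ^+ 0 * gauss_weight x) :> R.
  rewrite normal_pdfE ?oner_eq0 // /normal_peak /normal_fun /gauss_weight.
  by rewrite expr1n mul1r subr0 expr0 mul1r mulNr.
have s0 : Num.sqrt (pi *+ 2) != 0 :> R by rewrite gt_eqF // sqrtr_gt0 mulrn_wgt0 // pi_gt0.
have /(congr1 fine) := @integral_normal_pdf R 0 1; rewrite /= -/mu.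
under eq_integral do rewrite E.
rewrite -[LHS]/(\int[mu]_x ((Num.sqrt (pi *+ 2))^-1 * (x ^+ 0 * gauss_weight x))).
rewrite RintegralZl //; last exact: integrable_pow_gauss_weight.
by move/(canRL (mulKf (invr_neq0 s0))); rewrite invrK mulr1.
Qed.

Lemma moment_half m : moment (m.*2) = 2 * half_moment m.*2.
Proof.
rewrite /moment /half_moment /Rintegral ge0_symfun_integralT.
- rewrite (_ : [set x | _] = `[0, +oo[%classic); last first.
    by apply/seteqP; split => x/=; rewrite in_itv/= andbT.
  by rewrite fineM // integrable_fin_num //; exact: integrable_half.
- by move=> x; rewrite mulr_ge0 ?expR_ge0 // exprn_even_ge0 // odd_double.
- exact: continuous_pow_gauss_weight.
by move=> x /=; rewrite /gauss_weight sqrrN exprNn -signr_odd odd_double mul1r.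
Qed.

Lemma half_moment_cvg m :
  \int[mu]_(x in `[0, n%:R]) (x ^+ m * gauss_weight x) @[n --> \oo] --> half_moment m.
Proof.
have [K K0 HK] := pow_gauss_weight_le m.
rewrite /half_moment Rintegral_mkcond; under eq_fun do rewrite Rintegral_mkcond.
pose w x : R := x ^+ m * gauss_weight x.
have [||||_] := @Rintegral_dominated_cvg R (fun n => w \_ `[0, n%:R]) (w \_ `[0, +oo[)
  (fun x => K / (1 + x ^+ 2)); last by [].
- move=> n; apply/measurable_restrict => //; rewrite setTI.
  by apply: measurable_funTS; exact: measurable_pow_gauss_weight.
- move=> x; rewrite /patch; case: ifPn => [|xn].
    rewrite inE /= in_itv /= andbT => x0.
    apply: cvg_near_cst; near=> n; rewrite ifT // inE /= in_itv /= x0 /=.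
    by near: n; exact: nbhs_infty_ger.
  apply: cvg_near_cst; near=> n; rewrite ifF //; apply: contraNF xn.
  by rewrite !inE /= !in_itv /= => /andP[-> _].
- exact: integrable_oneDsqrVZ.
- move=> n x; rewrite /patch; case: ifP => _; first exact: HK.
  by rewrite (_ : point = 0 :> R) // normr0 divr_ge0 // ?(ltW K0) // addr_ge0 // sqr_ge0.
Unshelve. all: by end_near. Qed.

Lemma cvg_bound_harmonic (K : R) (u : R^nat) (l : R) :
  (forall n, (0 < n)%N -> `|u n - l| <= K / n%:R) -> u @ \oo --> l.
Proof.
move=> ul; apply/cvgrPdist_le => e e0; near=> n.
have n0 : (0 < n)%N by near: n; exact: nbhs_infty_gt.
rewrite distrC (le_trans (ul n n0)) // ler_pdivrMr ?ltr0n // mulrC -ler_pdivrMr //.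
by near: n; exact: nbhs_infty_ger.
Unshelve. all: by end_near. Qed.

Lemma cvg_pow_gauss_weight0 m : n%:R ^+ m * gauss_weight n%:R @[n --> \oo] --> (0 : R).
Proof.
have [K K0 HK] := pow_gauss_weight_le m.
apply: (@cvg_bound_harmonic K) => n n0; rewrite subr0 (le_trans (HK _)) //.
rewrite ler_pM2l // lef_pV2 ?posrE ?ltr0n //.
have n1 : 1 <= n%:R :> R by rewrite ler1n.
by rewrite expr2; nra.
Qed.

Lemma FTC_segment (f F : R -> R) (a b : R) : a < b ->
  (forall x : R, is_derive x (1 : R) F (f x)) -> continuous f ->
  \int[mu]_(x in `[a, b]) f x = F b - F a.
Proof.
move=> ab Ff cf; rewrite /Rintegral (@continuous_FTC2 _ f F a b) //.
- by apply: continuous_subspaceT.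
- have cF x : F y @[y --> x] --> F x.
    by have [/derivable1_diffP/differentiable_continuous] := Ff x.
  split; first by move=> x _; have [] := Ff x.
    by apply: cvg_at_right_filter; exact: cF.
  by apply: cvg_at_left_filter; exact: cF.
- by move=> x _; rewrite derive1E; have [_ ->] := Ff x.
Qed.

(** Integration by parts on [0, n]; the boundary term n^(m+1) exp(-n^2 / 2) disappears in the
    limit. *)
Lemma half_moment_rec m : half_moment m.+2 = m.+1%:R * half_moment m.
Proof.
have iS k (n : nat) : mu.-integrable `[0, n%:R] (EFin \o (fun x : R => x ^+ k * gauss_weight x)).
  by apply: integrableS (integrable_pow_gauss_weight k).
have E (n : nat) : (0 < n)%N ->
    m.+1%:R * \int[mu]_(x in `[0, n%:R]) (x ^+ m * gauss_weight x)
    - \int[mu]_(x in `[0, n%:R]) (x ^+ m.+2 * gauss_weight x) =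
    n%:R ^+ m.+1 * gauss_weight n%:R.
  move=> n0; rewrite -RintegralZl // -RintegralB //; last first.
    have := @integrableZl _ _ _ mu `[0, n%:R]%classic (measurable_itv _) m.+1%:R _ (iS m n).
    by apply: eq_integrable.
  have dF (x : R) : is_derive x 1 (fun x => x ^+ m.+1 * gauss_weight x)
      (m.+1%:R * (x ^+ m * gauss_weight x) - x ^+ m.+2 * gauss_weight x).
    apply: is_derive1_eq (is_derive1M (is_derive1X m (is_derive1_id x))
      (is_derive_gauss_weight x)) _.
    by rewrite /= !exprS; ring.
  rewrite (FTC_segment _ dF) ?ltr0n //; first by rewrite expr0n mul0r subr0.
  move=> x; apply: cvgB; last exact: continuous_pow_gauss_weight.
  by apply: cvgMl_tmp; exact: continuous_pow_gauss_weight.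
apply/eqP; rewrite eq_sym -subr_eq0; apply/eqP.
have c1 : m.+1%:R * \int[mu]_(x in `[0, n%:R]) (x ^+ m * gauss_weight x)
    - \int[mu]_(x in `[0, n%:R]) (x ^+ m.+2 * gauss_weight x) @[n --> \oo] -->
    m.+1%:R * half_moment m - half_moment m.+2.
  by apply: cvgB; [apply: cvgMl_tmp|]; exact: half_moment_cvg.
have c2 : m.+1%:R * \int[mu]_(x in `[0, n%:R]) (x ^+ m * gauss_weight x)
    - \int[mu]_(x in `[0, n%:R]) (x ^+ m.+2 * gauss_weight x) @[n --> \oo] --> (0 : R).
  apply: cvg_trans (@cvg_pow_gauss_weight0 m.+1); apply: near_eq_cvg.
  by near=> n; rewrite E //; near: n; exact: nbhs_infty_gt.
exact: (cvg_unique (@Rhausdorff R) c1 c2).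
Unshelve. all: by end_near. Qed.

Lemma half_moment1 : half_moment 1 = 1.
Proof.
have E (n : nat) : (0 < n)%N ->
    \int[mu]_(x in `[0, n%:R]) (x ^+ 1 * gauss_weight x) = 1 - gauss_weight n%:R.
  move=> n0.
  have dF (x : R) : is_derive x 1 (fun x => - gauss_weight x) (x ^+ 1 * gauss_weight x).
    by apply: is_derive1_eq (is_derive1N (is_derive_gauss_weight x)) _; rewrite opprK.
  rewrite (FTC_segment _ dF) ?ltr0n //; last exact: continuous_pow_gauss_weight.
  by rewrite opprK addrC {1}/gauss_weight expr0n mul0r oppr0 expR0.
have c2 : \int[mu]_(x in `[0, n%:R]) (x ^+ 1 * gauss_weight x) @[n --> \oo] --> (1 - 0 : R).
  apply: (@cvg_trans _ ((1 - n%:R ^+ 0 * gauss_weight n%:R : R) @[n --> \oo])).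
    apply: near_eq_cvg; near=> n; rewrite E ?expr0 ?mul1r //.
    by near: n; exact: nbhs_infty_gt.
  by apply: cvgB; [exact: cvg_cst | exact: cvg_pow_gauss_weight0].
by rewrite subr0 in c2; exact: (cvg_unique (@Rhausdorff R) (@half_moment_cvg 1) c2).
Unshelve. all: by end_near. Qed.

Lemma half_moment_gt0 m : 0 < half_moment m.
Proof.
suff: 0 < half_moment m /\ 0 < half_moment m.+1 by case.
elim: m => [|m [h0 h1]]; last by rewrite half_moment_rec mulr_gt0.
rewrite half_moment1 ltr01; split => //.
have := moment_half 0; rewrite moment0.
have : 0 < Num.sqrt (pi *+ 2) :> R by rewrite sqrtr_gt0 mulrn_wgt0 // pi_gt0.
by move=> + e; rewrite e /= pmulr_rgt0.
Qed.

(** Cauchy-Schwarz: the integral of x^m (x - z)^2 against the weight is nonnegative, and z = b / a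
    is its minimum. *)
Lemma half_moment_log_convex m : half_moment m.+1 ^+ 2 <= half_moment m * half_moment m.+2.
Proof.
set a := half_moment m; set b := half_moment m.+1; set c := half_moment m.+2.
have a0 : 0 < a := half_moment_gt0 m.
have : 0 <= c - 2 * (b / a) * b + (b / a) ^+ 2 * a.
  have -> : c - 2 * (b / a) * b + (b / a) ^+ 2 * a =
    \int[mu]_(x in `[0, +oo[) ((x ^+ m.+2 * gauss_weight x
      - 2 * (b / a) * (x ^+ m.+1 * gauss_weight x))
      + (b / a) ^+ 2 * (x ^+ m * gauss_weight x)).
    have iZ k (r : R) : mu.-integrable `[0, +oo[
        (EFin \o (fun x : R => r * (x ^+ k * gauss_weight x))).
      have := @integrableZl _ _ _ mu `[0, +oo[%classic (measurable_itv _) r _ (integrable_half k).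
      by apply: eq_integrable.
    rewrite RintegralD //; last first.
      have := @integrableB _ _ _ mu `[0, +oo[%classic (measurable_itv _) _ _ (integrable_half m.+2) (iZ m.+1 (2 * (b / a))).
      by apply: eq_integrable.
    by rewrite RintegralB ?integrable_half // !RintegralZl //; exact: integrable_half.
  apply: Rintegral_ge0 => x /=; rewrite in_itv /= andbT => x0.
  rewrite (_ : _ + _ = x ^+ m * gauss_weight x * (x - b / a) ^+ 2); last by rewrite !exprS; ring.
  apply: mulr_ge0; last exact: sqr_ge0.
  by apply: mulr_ge0; [exact: exprn_ge0 | exact: expR_ge0].
have -> : c - 2 * (b / a) * b + (b / a) ^+ 2 * a = c - b ^+ 2 / a by field; rewrite gt_eqF.
by rewrite subr_ge0 ler_pdivrMr // mulrC.
Qed.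

Lemma moment_odd_even_rec m : moment m.*2.+2 = m.*2.+1%:R * moment m.*2.
Proof. by rewrite -doubleS !moment_half doubleS half_moment_rec mulrCA. Qed.

End GaussianMoments.

(** * Stirling's constant through the midpoint rule *)

Section Stirling.

Variable R : realType.

(* Both bounds telescope when summed over adjacent cells. *)
Lemma midpoint_convex (W w rho : R -> R) (x h : R) : 0 <= h ->
  derive_on W w (x - h) (x + h) -> derive_on w rho (x - h) (x + h) ->
  (forall y z, x - h <= y -> y <= z -> z <= x + h -> rho y <= rho z) ->
  0 <= W (x + h) - W (x - h) - 2 * h * w x <= h ^+ 2 * (rho (x + h) - rho (x - h)).
Proof.
move=> h0 dW dw mono; set D := rho (x + h) - rho (x - h).
have dsub (f df : R -> R) s : derive_on f df (x - h) (x + h) -> 0 <= s <= h ->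
    is_derive s 1 (fun s => f (x + s)) (df (x + s)) /\
    is_derive s 1 (fun s => f (x - s)) (- df (x - s)).
  move=> dF /andP[s0 sh]; split.
    have H := dF (x + s) ltac:(lra).
    have Hs : is_derive s 1 (fun s => x + s) (1 : R) by der; ring.
    by apply: is_derive1_eq (is_derive1_comp H Hs) _; rewrite mulr1.
  have H := dF (x - s) ltac:(lra).
  have Hs : is_derive s 1 (fun s => x - s) (- 1 : R) by der; ring.
  have H2 := @is_derive1_comp R f (fun s => x - s) s _ _ H Hs.
  by apply: (is_derive1_eq H2); rewrite mulrN1.
pose Phi s := W (x + s) - W (x - s) - 2 * s * w x.
pose phi s := w (x + s) + w (x - s) - 2 * w x.
have dPhi s : 0 <= s <= h -> is_derive s 1 Phi (phi s).
  move=> sh; have [d1 d2] := dsub _ _ _ dW sh.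
  have d3 : is_derive s 1 (fun s => 2 * s * w x) (2 * w x) by der; ring.
  by apply: is_derive1_eq (is_derive1D (is_derive1D d1 (is_derive1N d2)) (is_derive1N d3)) _;
     rewrite /phi opprK.
have dphi s : 0 <= s <= h -> is_derive s 1 phi (rho (x + s) - rho (x - s)).
  move=> sh; have [d1 d2] := dsub _ _ _ dw sh.
  by apply: is_derive1_eq (is_derive1D (is_derive1D d1 d2) (is_derive1_cst (- (2 * w x)) s)) _;
     rewrite addr0.
have rD s : 0 <= s <= h -> 0 <= rho (x + s) - rho (x - s) <= D.
  move=> sh; rewrite subr_ge0 mono /=; try lra.
  by rewrite lerB // mono; lra.
have phi0 : phi 0 = 0 by rewrite /phi addr0 subr0; ring.
have Phi0 : Phi 0 = 0 by rewrite /Phi addr0 subr0; ring.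
have bphi s : 0 <= s <= h -> 0 <= phi s <= h * D.
  move=> /andP[s0 sh]; apply/andP; split.
    rewrite -phi0; apply: (@derive_ge0_le _ phi (fun s => rho (x + s) - rho (x - s))) => //.
      by move=> y yh; apply: dphi; lra.
    by move=> y yh; have /andP[] := rD y ltac:(lra).
  have D0 : 0 <= D by have /andP[] := rD h ltac:(lra).
  apply: (@le_trans _ _ (s * D)); last by rewrite ler_wpM2r.
  have := @derive_le _ phi (fun s => s * D) (fun s => rho (x + s) - rho (x - s)) (fun=> D) 0 s s0.
  rewrite phi0 mul0r !subr0; apply.
  - by move=> y yh; apply: dphi; lra.
  - by move=> y yh; der; ring.
  - by move=> y yh; have /andP[] := rD y ltac:(lra).
rewrite -/(Phi h); apply/andP; split.
  rewrite -Phi0; apply: (@derive_ge0_le _ Phi phi) => //.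
  by move=> y yh; have /andP[] := bphi y ltac:(lra).
have := @derive_le _ Phi (fun s => s * (h * D)) phi (fun=> h * D) 0 h h0.
rewrite Phi0 mul0r !subr0 expr2 mulrA; apply => //.
  by move=> y yh; der; ring.
by move=> y yh; have /andP[] := bphi y ltac:(lra).
Qed.

Definition xlnx (x : R) : R := x * ln x - x.

Lemma is_derive_xlnx (x : R) : 0 < x -> is_derive x 1 xlnx (ln x).
Proof.
move=> x0; rewrite /xlnx; der => //.
by field; rewrite gt_eqF.
Qed.

(** The gap between ln (j + 1) and the integral of ln over the unit cell centred there, [xlnx] being
    a primitive of ln. Cells abut, so the integrals telescope. *)
Definition midpoint_ln_error (j : nat) : R :=
  ln j.+1%:R - (xlnx (j.+1%:R + 2^-1) - xlnx (j.+1%:R - 2^-1)).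

Lemma midpoint_ln_error_bounds j :
  0 <= midpoint_ln_error j <= 4^-1 * ((j.+1%:R - 2^-1)^-1 - (j.+1%:R + 2^-1)^-1).
Proof.
rewrite /midpoint_ln_error; have : 1 <= j.+1%:R :> R by rewrite ler1n.
move: (j.+1%:R) => a a1.
have dG : derive_on (fun x => - xlnx x) (fun x => - ln x) (a - 2^-1) (a + 2^-1).
  by move=> y ya; apply: is_derive1N; apply: is_derive_xlnx; lra.
have dl : derive_on (fun x => - ln x) (fun x : R => - x^-1) (a - 2^-1) (a + 2^-1).
  by move=> y ya; apply: is_derive1N; apply: is_derive1_ln; lra.
have mono (y z : R) : a - 2^-1 <= y -> y <= z -> z <= a + 2^-1 -> - y^-1 <= - z^-1.
  by move=> y1 yz z1; rewrite lerN2 lef_pV2 // posrE; lra.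
have h2 : 0 <= 2^-1 :> R by rewrite invr_ge0.
have /andP[lo hi] := midpoint_convex h2 dG dl mono.
have e : 2 * 2^-1 = 1 :> R by rewrite mulfV.
have e2 : 2^-1 ^+ 2 = 4^-1 :> R by rewrite exprVn -natrX.
by move: lo hi; rewrite e e2 mul1r; lra.
Qed.

Lemma sum_midpoint_ln_error n : series midpoint_ln_error n =
  ln n`!%:R - xlnx (n%:R + 2^-1) + xlnx 2^-1.
Proof.
elim: n => [|n IHn].
  by rewrite /series /= big_nil fact0 ln1 !add0r addNr.
rewrite seriesSr IHn /midpoint_ln_error factS natrM lnM ?posrE ?ltr0n ?fact_gt0 //.
have -> : n.+1%:R - 2^-1 = n%:R + 2^-1 :> R by rewrite -natr1; lra.
ring.
Qed.

Lemma is_cvg_midpoint_ln_error : cvgn (series midpoint_ln_error).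
Proof.
apply: nondecreasing_is_cvgn.
  by apply: nondecreasing_series => j _; have /andP[] := midpoint_ln_error_bounds j.
exists 2^-1 => _ [n _ <-].
have : series midpoint_ln_error n <= 4^-1 * (2 - (n%:R + 2^-1)^-1).
  elim: n => [|n IHn].
    by rewrite /series /= big_nil add0r invrK subrr mulr0.
  rewrite seriesSr; have /andP[_] := midpoint_ln_error_bounds n.
  have -> : n.+1%:R - 2^-1 = n%:R + 2^-1 :> R by rewrite -natr1; lra.
  by move: IHn; lra.
have : 0 <= (n%:R + 2^-1)^-1 :> R by rewrite invr_ge0 addr_ge0 // invr_ge0.
lra.
Qed.

(** The central binomial coefficient divided by 4^n. *)
Definition wallis_ratio (n : nat) : R := (n.*2)`!%:R / (4 ^+ n * n`!%:R ^+ 2).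

Lemma half_moment_odd n : half_moment R n.*2.+1 = 2 ^+ n * n`!%:R.
Proof.
elim: n => [|n IHn]; first by rewrite half_moment1 expr0 fact0 mulr1.
rewrite doubleS half_moment_rec IHn factS natrM exprS.
by have -> : n.*2.+2%:R = 2 * n.+1%:R :> R; [rewrite -natrM -doubleS mul2n | ring].
Qed.

Lemma half_moment_even n :
  half_moment R n.*2 = half_moment R 0 * ((n.*2)`!%:R / (2 ^+ n * n`!%:R)).
Proof.
elim: n => [|n IHn]; first by rewrite expr0 fact0 mul1r divr1 mulr1.
rewrite doubleS half_moment_rec IHn !factS !natrM exprS.
have -> : n.*2.+2%:R = 2 * n.+1%:R :> R by rewrite -natrM -doubleS mul2n.
have : n.+1%:R != 0 :> R by rewrite pnatr_eq0.
have : n`!%:R != 0 :> R by rewrite pnatr_eq0 -lt0n fact_gt0.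
have : 2 ^+ n != 0 :> R by rewrite expf_neq0.
move: (n.+1%:R) (n`!%:R) (2 ^+ n) (n.*2.+1%:R) ((n.*2)`!%:R) => a b c d e c0 b0 a0.
by field; rewrite c0 b0 a0.
Qed.

Lemma half_moment0_sqr : half_moment R 0 ^+ 2 = pi / 2.
Proof.
have := moment_half R 0; rewrite moment0 /= => /(congr1 (fun x => x ^+ 2)).
rewrite sqr_sqrtr; last by rewrite mulrn_wge0 // pi_ge0.
by rewrite exprMn -mulr_natr; lra.
Qed.

(** Up to the factor [half_moment R 0], whose square is pi / 2, the ratio is the quotient of the
    half-moments of orders 2n and 2n + 1. Log-convexity at 2n - 1 and at 2n encloses it. *)
Lemma wallis_bounds n : (0 < n)%N ->
  2 * n%:R / (2 * n%:R + 1) / pi <= n%:R * wallis_ratio n ^+ 2 <= pi^-1.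
Proof.
move=> n0.
have c1 := half_moment_log_convex R n.*2.
have c2 := half_moment_log_convex R n.*2.-1.
have d0 : (0 < n.*2)%N by rewrite double_gt0.
have E2 : half_moment R n.*2.-1 * n.*2%:R = half_moment R n.*2.+1.
  by rewrite -[in RHS](prednK d0) half_moment_rec prednK // mulrC.
rewrite prednK // in c2; rewrite half_moment_rec in c1.
have a0 := half_moment_gt0 R n.*2; have b0 := half_moment_gt0 R n.*2.+1.
have p0 := half_moment_gt0 R n.*2.-1.
have EW : wallis_ratio n * half_moment R 0 = half_moment R n.*2 / half_moment R n.*2.+1.
  rewrite half_moment_odd half_moment_even /wallis_ratio expr4.
  have : n`!%:R != 0 :> R by rewrite pnatr_eq0 -lt0n fact_gt0.
  have : 2 ^+ n != 0 :> R by rewrite expf_neq0.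
  move: (n`!%:R) (2 ^+ n) ((n.*2)`!%:R) (half_moment R 0) => b c d e c0' b0'.
  by field; rewrite c0' b0'.
have EW2 : wallis_ratio n ^+ 2 * (pi / 2) = (half_moment R n.*2 / half_moment R n.*2.+1) ^+ 2.
  by rewrite -half_moment0_sqr -exprMn EW.
have nd : n.*2%:R = 2 * n%:R :> R by rewrite -natrM mul2n.
have nd1 : n.*2.+1%:R = 2 * n%:R + 1 :> R by rewrite -natr1 nd.
have nR : 0 < n%:R :> R by rewrite ltr0n.
have pi0 := pi_gt0 R.
rewrite nd1 in c1; rewrite nd in E2.
have E2' : half_moment R n.*2.-1 = half_moment R n.*2.+1 / (2 * n%:R).
  by rewrite -E2; field; rewrite gt_eqF.
rewrite {}E2' in c2.
move: (half_moment R n.*2) (half_moment R n.*2.+1) (n%:R : R) (wallis_ratio n) (pi : R)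
  a0 b0 nR pi0 EW2 c1 c2 => a b m w p a0 b0 m0 p0' EW2 c1 c2.
have W : m * w ^+ 2 = 2 * m * a ^+ 2 / (b ^+ 2) / p.
  have -> : w ^+ 2 = (a / b) ^+ 2 / (p / 2) by rewrite -EW2; field; rewrite gt_eqF.
  by field; rewrite !gt_eqF.
rewrite W; apply/andP; split.
  rewrite ler_pM2r ?invr_gt0 // -[leRHS]mulrA ler_pM2l ?mulr_gt0 //.
  rewrite ler_pdivlMr ?exprn_gt0 // mulrC ler_pdivrMr; last by lra.
  by move: c1; lra.
rewrite -[leRHS]mul1r ler_pM2r ?invr_gt0 // ler_pdivrMr ?exprn_gt0 // mul1r.
move: c2; rewrite -[b / _ * b]mulrA [_^-1 * b]mulrC mulrA ler_pdivlMr ?mulr_gt0 //.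
by rewrite -expr2; lra.
Qed.

Lemma ln1D_ge (x : R) : -1 < x -> x / (1 + x) <= ln (1 + x).
Proof.
move=> x1; have x0 : 0 < 1 + x by lra.
have : ln (1 + (- x / (1 + x))) <= - x / (1 + x).
  apply: le_ln1Dx; rewrite ltr_pdivlMr //; lra.
have -> : 1 + (- x / (1 + x)) = (1 + x)^-1 by field; rewrite gt_eqF.
rewrite lnV ?posrE // mulNr; lra.
Qed.

(** The limit l exists already; it is identified from S(2n) - 2 S(n), which tends to -l and in which
    the factorials combine into [wallis_ratio], known from [wallis_bounds]. *)
Lemma stirling : series midpoint_ln_error @ \oo --> (ln pi - 1) / 2.
Proof.
have /cvg_ex[/= l cl] := is_cvg_midpoint_ln_error.
suff -> : (ln pi - 1) / 2 = l by [].
pose s n := series midpoint_ln_error n.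
have cw : ln (n%:R * wallis_ratio n ^+ 2) @[n --> \oo] --> (- ln pi : R).
  rewrite -lnV ?posrE ?pi_gt0 //.
  apply: (@cvg_comp _ _ _ (fun n => n%:R * wallis_ratio n ^+ 2) (@ln R) _ (nbhs (pi^-1 : R))).
    apply: (@cvg_bound_harmonic R pi^-1) => n n0.
    have /andP[lo hi] := wallis_bounds n0.
    have nR : 0 < n%:R :> R by rewrite ltr0n.
    rewrite distrC ger0_norm ?subr_ge0 // lerBlDr.
    move: lo; have := pi_gt0 R; rewrite -invr_gt0; move: (pi^-1) (_ ^+ 2) (n%:R : R) nR => p w m m0 p0 lo.
    apply: le_trans (lerD (lexx _) lo).
    rewrite -subr_ge0 (_ : _ - p = p / m * ((m + 1) / (2 * m + 1))).
      by rewrite mulr_ge0 ?divr_ge0 // ltW //; lra.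
    field; rewrite !gt_eqF //; lra.
  by apply: continuous_ln; rewrite invr_gt0 pi_gt0.
have c2 : s (n + n)%N - 2 * s n @[n --> \oo] --> l - 2 * l.
  apply: cvgB; last by apply: cvgMl_tmp.
  by apply: cvg_comp cl; apply: cvgny_ge_id => n; exact: leq_addr.
have c3 : s (n + n)%N - 2 * s n @[n --> \oo] --> (- ln pi + 1) / 2.
  (* The left side is exactly (2n + 1) ln (1 + 1 / (2n)) - (2n + 1/2) ln (1 + 1 / (4n)), which tends
     to 1 - 1/2. *)
  have c4 : s (n + n)%N - 2 * s n - ln (n%:R * wallis_ratio n ^+ 2) / 2 @[n --> \oo] --> (2^-1 : R).
    apply: (@cvg_bound_harmonic R 1) => n n0.
    have nR : 0 < n%:R :> R by rewrite ltr0n.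
    have w0 : 0 < wallis_ratio n.
      by rewrite divr_gt0 ?mulr_gt0 ?exprn_gt0 ?ltr0n ?fact_gt0.
    have f0 : 0 < n`!%:R :> R by rewrite ltr0n fact_gt0.
    have lw : ln (wallis_ratio n) = ln (n.*2)`!%:R - (2 * n%:R * ln 2 + 2 * ln n`!%:R) :> R.
      rewrite /wallis_ratio ln_div ?posrE ?mulr_gt0 ?exprn_gt0 ?ltr0n ?fact_gt0 //.
      rewrite lnM ?posrE ?exprn_gt0 // !lnXn //.
      have -> : ln 4 = ln 2 * 2 :> R.
        by rewrite (_ : 4 = 2 ^+ 2); [rewrite lnXn // mulr_natr | rewrite -natrX].
      by rewrite -[_ *+ n]mulr_natr -[ln _`!%:R *+ 2]mulr_natr; ring.
    rewrite lnM ?posrE ?exprn_gt0 // lnXn // -[ln (wallis_ratio _) *+ 2]mulr_natr lw /s !sum_midpoint_ln_error.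
    rewrite addnn -mul2n natrM /xlnx.
    set m : R := n%:R; set F := ln (n`!%:R); set F2 := ln ((2 * n)`!%:R).
    have lm : ln (m + 2^-1) = ln m + ln (1 + (2 * m)^-1).
      rewrite -lnM ?posrE ?addr_gt0 ?invr_gt0 ?mulr_gt0 //.
      by congr ln; field; rewrite gt_eqF.
    have l2m : ln (2 * m + 2^-1) = ln 2 + ln m + ln (1 + (4 * m)^-1).
      rewrite -!lnM ?posrE ?addr_gt0 ?invr_gt0 ?mulr_gt0 //.
      by congr ln; field; rewrite gt_eqF.
    have lh : ln 2^-1 = - ln 2 :> R by rewrite lnV // posrE.
    rewrite lm l2m lh.
    have i2 : 0 < (2 * m)^-1 by rewrite invr_gt0 mulr_gt0.
    have i4 : 0 < (4 * m)^-1 by rewrite invr_gt0 mulr_gt0.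
    have u2 := @le_ln1Dx R (2 * m)^-1 ltac:(lra).
    have u4 := @le_ln1Dx R (4 * m)^-1 ltac:(lra).
    have b2 := @ln1D_ge (2 * m)^-1 ltac:(lra).
    have b4 := @ln1D_ge (4 * m)^-1 ltac:(lra).
    have e2 : (2 * m)^-1 / (1 + (2 * m)^-1) * (2 * m + 1) = 1.
      by field; rewrite !gt_eqF //; lra.
    have e4 : (4 * m)^-1 / (1 + (4 * m)^-1) * (2 * m + 2^-1) = 2^-1.
      by field; rewrite !gt_eqF //; lra.
    have w2 : (2 * m)^-1 * (2 * m + 1) = 1 + 2^-1 / m by field; rewrite gt_eqF.
    have w4 : (4 * m)^-1 * (2 * m + 2^-1) = 2^-1 + 8^-1 / m by field; rewrite gt_eqF.
    have p2 : 0 <= 2 * m + 1 by lra.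
    have p4 : 0 <= 2 * m + 2^-1 by lra.
    have := ler_wpM2r p2 u2; rewrite w2 => {}u2.
    have := ler_wpM2r p4 u4; rewrite w4 => {}u4.
    have := ler_wpM2r p2 b2; rewrite e2 => {}b2.
    have := ler_wpM2r p4 b4; rewrite e4 => {}b4.
    have im : 0 < m^-1 by rewrite invr_gt0.
    move: (ln (1 + (2 * m)^-1)) (ln (1 + (4 * m)^-1)) u2 u4 b2 b4 => X Y u2 u4 b2 b4.
    rewrite (_ : _ - 2^-1 = X * (2 * m + 1) - Y * (2 * m + 2^-1) - 2^-1); last first.
      by field.
    rewrite div1r ler_norml; apply/andP; split; lra.
  have c5 : ln (n%:R * wallis_ratio n ^+ 2) / 2 @[n --> \oo] --> (- ln pi / 2 : R).
    exact: cvgMr_tmp.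
  have -> : (- ln pi + 1) / 2 = 2^-1 + - ln pi / 2 :> R by field.
  apply: (cvg_trans _ (cvgD c4 c5)); apply: near_eq_cvg; near=> n.
  by rewrite /GRing.add /= subrK.
have e : l - 2 * l = (- ln pi + 1) / 2 by exact: (cvg_unique (@Rhausdorff R) c2 c3).
lra.
Unshelve. all: by end_near. Qed.

End Stirling.

(** * Power series and the asymptotics of the logarithm of an Euler product *)

Section PowerSeries.

Variable R : realType.
Implicit Types (f g : R^nat) (x y : R).

(** A radius of convergence at least 1, phrased by bounded terms so that it passes easily to
    products with bounded sequences. *)
Record subexp f : Prop := Subexp { subexp_bound : forall y, 0 < y < 1 -> exists2 B, 0 < B &
  forall n, `|f n| * y ^+ n <= B }.

Definition psum f x : R := limn (pseries f x).

Lemma subexp_geometric f x : subexp f -> `|x| < 1 ->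
  exists2 K, 0 < K & exists2 rho, 0 <= rho < 1 & forall n, `|f n * x ^+ n| <= K * rho ^+ n.
Proof.
move=> fe x1; pose y := (1 + `|x|) / 2.
have x0 := normr_ge0 x.
have y0 : 0 < y by rewrite /y; lra.
have y1 : y < 1 by rewrite /y; lra.
have [B B0 HB] := @subexp_bound _ fe y ltac:(by rewrite y0).
exists B => //; exists (`|x| / y).
  by rewrite divr_ge0 ?(ltW y0) //= ltr_pdivrMr // mul1r /y; lra.
move=> n; rewrite normrM normrX expr_div_n mulrA ler_pdivlMr ?exprn_gt0 //.
by rewrite mulrAC ler_wpM2r // exprn_ge0.
Qed.

Lemma is_cvg_geometric_dom (u : R^nat) K rho : 0 <= rho < 1 ->
  (forall n, `|u n| <= K * rho ^+ n) -> cvgn [normed series u].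
Proof.
move=> /andP[r0 r1] uK; apply: (@series_le_cvg _ _ (geometric K rho)) => //.
- by move=> n /=.
- by move=> n /=; apply: le_trans (uK n).
- by apply: is_cvg_geometric_series; rewrite ger0_norm.
Qed.

Lemma is_cvg_psum_norm f x : subexp f -> `|x| < 1 -> cvgn [normed pseries f x].
Proof.
move=> fe /(subexp_geometric fe)[K K0 [rho r1 HK]]; exact: is_cvg_geometric_dom HK.
Qed.

Lemma is_cvg_psum f x : subexp f -> `|x| < 1 -> cvgn (pseries f x).
Proof. by move=> fe x1; apply: normed_cvg; exact: is_cvg_psum_norm. Qed.

(** The factor n + 1 of the derivative is absorbed by a slightly larger radius [z]: Bernoulli gives
    (n + 1) d <= (z / y)^(n+1) with d = z / y - 1. *)
Lemma subexp_diffs f : subexp f -> subexp (pseries_diffs f).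
Proof.
move=> fe; split=> y /andP[y0 y1]; pose z := (1 + y) / 2.
have z0 : 0 < z by rewrite /z; lra.
have z1 : z < 1 by rewrite /z; lra.
have [B B0 HB] := @subexp_bound _ fe z ltac:(by rewrite z0).
pose d := z / y - 1.
have d0 : 0 < d by rewrite /d subr_gt0 ltr_pdivlMr // /z; lra.
exists (B / y / d); first by rewrite !divr_gt0.
move=> n; rewrite /pseries_diffs normrM (ger0_norm (ler0n _ _)).
have bern : n.+1%:R * d <= (z / y) ^+ n.+1.
  have -> : z / y = 1 + d by rewrite /d; ring.
  elim: (n.+1) => [|k IHk]; first by rewrite mul0r.
  rewrite exprS mulrDl mul1r -natr1 mulrDl mul1r.
  have p : 1 <= (1 + d) ^+ k by rewrite exprn_ege1 //; lra.
  by apply: lerD IHk _; rewrite ler_peMr // ltW.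
have h := HB n.+1.
rewrite ler_pdivlMr // ler_pdivlMr //.
have -> : n.+1%:R * `|f n.+1| * y ^+ n * d * y = n.+1%:R * d * (`|f n.+1| * y ^+ n.+1).
  by rewrite exprS; ring.
have q0 : 0 <= `|f n.+1| * y ^+ n.+1 by rewrite mulr_ge0 // exprn_ge0 // ltW.
apply: le_trans (ler_wpM2r q0 bern) _.
suff -> : (z / y) ^+ n.+1 * (`|f n.+1| * y ^+ n.+1) = `|f n.+1| * z ^+ n.+1 by [].
have : y ^+ n.+1 != 0 by rewrite expf_neq0 // gt_eqF.
rewrite expr_div_n; move: (y ^+ n.+1) (z ^+ n.+1) => a b a0.
by field.
Qed.

Lemma is_derive_psum f x : subexp f -> `|x| < 1 ->
  is_derive x 1 (psum f) (psum (pseries_diffs f) x).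
Proof.
move=> fe x1; pose K := (1 + `|x|) / 2; have x0 := normr_ge0 x.
have K0 : 0 < K by rewrite /K; lra.
have aK : `|K| < 1 by rewrite gtr0_norm // /K; lra.
apply: (@pseries_snd_diffs R f K x).
- exact: is_cvg_psum.
- by apply: is_cvg_psum => //; exact: subexp_diffs.
- by apply: is_cvg_psum => //; do 2 apply: subexp_diffs.
- by rewrite [`|K|]gtr0_norm // /K; lra.
Qed.

Lemma cvg_psum f x : subexp f -> `|x| < 1 ->
  (\sum_(0 <= i < n) f i * x ^+ i) @[n --> \oo] --> psum f x.
Proof. by move=> fe x1; have := is_cvg_psum fe x1. Qed.

Lemma psum_eq f x l : (\sum_(0 <= i < n) f i * x ^+ i) @[n --> \oo] --> l -> psum f x = l.
Proof. by move=> H; apply/cvg_lim. Qed.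

Lemma subexpD f g : subexp f -> subexp g -> subexp (fun n => f n + g n).
Proof.
move=> fe ge; split=> y /[dup] /(subexp_bound fe)[B B0 HB] /[dup] /(subexp_bound ge)[C C0 HC] /andP[y0 _].
exists (B + C); first exact: addr_gt0.
move=> n; apply: le_trans (lerD (HB n) (HC n)).
by rewrite -mulrDl ler_wpM2r // ?ler_normD // exprn_ge0 // ltW.
Qed.

Lemma subexpM_bounded f g : subexp f -> (forall n, `|g n| <= 1) -> subexp (fun n => f n * g n).
Proof.
move=> fe ge; split=> y /[dup] /(subexp_bound fe)[B B0 HB] /andP[y0 _]; exists B => // n; apply: le_trans (HB n).
by rewrite ler_wpM2r // ?exprn_ge0 ?(ltW y0) // normrM ler_piMr.
Qed.

Lemma subexpZ c f : subexp f -> subexp (fun n => c * f n).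
Proof.
move=> fe; split=> y /(subexp_bound fe)[B B0 HB]; exists ((1 + `|c|) * B); first by rewrite mulr_gt0 // ltr_pwDl.
have c1 : `|c| <= 1 + `|c| by rewrite lerDr.
move=> n; rewrite normrM -mulrA; apply: le_trans (ler_wpM2l (normr_ge0 c) (HB n)) _.
by rewrite ler_wpM2r // ltW.
Qed.

Lemma psumD f g x : subexp f -> subexp g -> `|x| < 1 ->
  psum (fun n => f n + g n) x = psum f x + psum g x.
Proof.
move=> fe ge x1; apply: psum_eq.
under eq_fun => n do (under eq_bigr => i _ do rewrite mulrDl; rewrite big_split /=).
by apply: cvgD; exact: cvg_psum.
Qed.

Lemma psumZ c f x : subexp f -> `|x| < 1 ->
  psum (fun n => c * f n) x = c * psum f x.
Proof.
move=> fe x1; apply: psum_eq.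
under eq_fun => n do (under eq_bigr => i _ do rewrite -mulrA; rewrite -mulr_sumr).
by apply: cvgMl_tmp; exact: cvg_psum.
Qed.

Lemma ler_psum f g x : subexp f -> subexp g -> `|x| < 1 ->
  (forall n, f n * x ^+ n <= g n * x ^+ n) -> psum f x <= psum g x.
Proof.
move=> fe ge x1 fg; apply: ler_cvg_to (cvg_psum fe x1) (cvg_psum ge x1) _.
by near=> n; apply: ler_sum => i _; exact: fg.
Unshelve. all: by end_near. Qed.

Lemma psum_diffs f x : subexp f -> `|x| < 1 ->
  psum (fun n => n%:R * f n) x = x * psum (pseries_diffs f) x.
Proof.
move=> fe x1; apply: psum_eq; rewrite -cvg_shiftS /=.
have E n : \sum_(0 <= i < n.+1) i%:R * f i * x ^+ i =
    x * \sum_(0 <= i < n) pseries_diffs f i * x ^+ i.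
  rewrite big_nat_recl // !mul0r add0r mulr_sumr; apply: eq_bigr => i _.
  by rewrite /pseries_diffs exprS; ring.
under eq_fun do rewrite E.
by apply: cvgMl_tmp; apply: cvg_psum => //; exact: subexp_diffs.
Qed.

Lemma psum_tail f x K rho : subexp f -> `|x| < 1 -> 0 <= rho < 1 ->
  (forall n, `|f n * x ^+ n| <= K * rho ^+ n) ->
  forall k, `|psum f x - \sum_(0 <= i < k) f i * x ^+ i| <= K / (1 - rho) * rho ^+ k.
Proof.
move=> fe x1 /andP[r0 r1] HK k.
have c : (`|\sum_(0 <= i < n) f i * x ^+ i - \sum_(0 <= i < k) f i * x ^+ i| @[n --> \oo]) -->
    `|psum f x - \sum_(0 <= i < k) f i * x ^+ i|.
  by apply: cvg_norm; apply: cvgB; [exact: cvg_psum | exact: cvg_cst].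
have cc : (K / (1 - rho) * rho ^+ k : R) @[_ --> \oo] --> K / (1 - rho) * rho ^+ k by exact: cvg_cst.
apply: (ler_cvg_to c cc); near=> n; have kn : (k <= n)%N by near: n; exact: nbhs_infty_ge.
rewrite (big_cat_nat (leq0n k) kn) /= addrAC subrr add0r.
apply: le_trans (ler_norm_sum _ _ _) _.
apply: (@le_trans _ _ (\sum_(k <= i < n) K * rho ^+ i)); first by apply: ler_sum => i _.
have K0 : 0 <= K by have := HK 0%N; rewrite !expr0 !mulr1; apply: le_trans.
have r10 : 0 < 1 - rho by rewrite subr_gt0.
have E m : (k <= m)%N -> \sum_(k <= i < m) K * rho ^+ i = K / (1 - rho) * (rho ^+ k - rho ^+ m).
  move/subnKC <-; elim: (m - k)%N => [|j IHj]; first by rewrite addn0 big_geq // subrr mulr0.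
  rewrite addnS big_nat_recr ?leq_addr //= IHj exprS; field; rewrite gt_eqF //.
by rewrite E // ler_wpM2l ?divr_ge0 ?(ltW r10) // gerBl exprn_ge0.
Unshelve. all: by end_near. Qed.

Definition cauchy_prod f g : R^nat := fun n => \sum_(i < n.+1) f i * g (n - i)%N.

Lemma sum_cauchy_prod (u v : R^nat) N :
  \sum_(0 <= n < N) cauchy_prod u v n = \sum_(0 <= i < N) u i * \sum_(0 <= j < N - i) v j.
Proof.
elim: N => [|N IHN]; first by rewrite !big_nil.
rewrite big_nat_recr //= IHN [RHS]big_nat_recr //= subSn // subnn big_nat1.
rewrite /cauchy_prod big_ord_recr /= subnn addrA; congr (_ + _).
rewrite -(big_mkord xpredT (fun i => u i * v (N - i)%N)) -big_split /=.
rewrite !big_nat; apply: eq_bigr => i /andP[_ iN].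
by rewrite subSn ?(ltnW iN) // [in RHS]big_nat_recr //= mulrDr.
Qed.

(** Against (partial sum of f) times [psum g], the truncated Cauchy product misses n tails, each at
    most a constant times r^n in total degree, and n r^n tends to 0. *)
Lemma psumM f g x : subexp f -> subexp g -> `|x| < 1 ->
  (\sum_(0 <= i < n) cauchy_prod f g i * x ^+ i) @[n --> \oo] --> psum f x * psum g x.
Proof.
move=> fe ge x1.
have [K1 K10 [r1 /andP[r10 r11] H1]] := subexp_geometric fe x1.
have [K2 K20 [r2 /andP[r20 r21] H2]] := subexp_geometric ge x1.
pose r := Num.max r1 r2; have r0 : 0 <= r by rewrite le_max r10.
have rl1 : r < 1 by rewrite gt_max r11.
have rr : 0 <= r < 1 by rewrite r0.
have H1' n : `|f n * x ^+ n| <= K1 * r ^+ n.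
  by rewrite (le_trans (H1 n)) // ler_pM2l // lerXn2r // ?nnegrE // le_max lexx.
have H2' n : `|g n * x ^+ n| <= K2 * r ^+ n.
  by rewrite (le_trans (H2 n)) // ler_pM2l // lerXn2r // ?nnegrE // le_max lexx orbT.
pose u n := f n * x ^+ n; pose v n := g n * x ^+ n.
have E n : \sum_(0 <= i < n) cauchy_prod f g i * x ^+ i = \sum_(0 <= i < n) u i * \sum_(0 <= j < n - i) v j.
  rewrite -sum_cauchy_prod; apply: eq_bigr => i _; rewrite /cauchy_prod mulr_suml; apply: eq_bigr => j _.
  rewrite /u /v mulrACA -exprD subnKC //; exact: (ltn_ord j).
have c1 : (\sum_(0 <= i < n) u i) * psum g x @[n --> \oo] --> psum f x * psum g x.
  by apply: cvgMr_tmp; exact: cvg_psum.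
suff c2 : (\sum_(0 <= i < n) u i) * psum g x - \sum_(0 <= i < n) cauchy_prod f g i * x ^+ i
    @[n --> \oo] --> (0 : R).
  rewrite -[psum f x * _]subr0; apply: (cvg_trans _ (cvgB c1 c2)); apply: near_eq_cvg; near=> n.
  by rewrite /GRing.add /GRing.opp /= subKr.
have cK : (K1 * (K2 / (1 - r))) * (n%:R * r ^+ n) @[n --> \oo] --> (0 : R).
  rewrite -[X in _ --> X](mulr0 (K1 * (K2 / (1 - r)))); apply: cvgMl_tmp.
  pose z := (1 + r) / 2; have z1 : z < 1 by rewrite /z; lra.
  have z0 : 0 < z by rewrite /z; lra.
  have se : subexp (fun=> 1 : R).
    split=> y /andP[y0 y1]; exists 1 => // n; rewrite normr1 mul1r exprn_ile1 // ltW //.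
  have [B B0 HB] := @subexp_bound _ (subexp_diffs se) z ltac:(by rewrite z0).
  have zr : r / z < 1 by rewrite ltr_pdivrMr // mul1r /z; lra.
  have cg : B * (r / z) ^+ n @[n --> \oo] --> (0 : R).
    rewrite -[X in _ --> X](mulr0 B); apply: cvgMl_tmp; apply: cvg_expr.
    by rewrite ger0_norm // divr_ge0 // ltW.
  apply: (@squeeze_cvgr _ _ _ _ (cst 0) (fun n => B * (r / z) ^+ n)) => //; last exact: cvg_cst.
  near=> n; rewrite mulr_ge0 ?exprn_ge0 //= expr_div_n mulrA ler_pdivlMr ?exprn_gt0 //.
  rewrite mulrAC ler_wpM2r ?exprn_ge0 //; apply: le_trans (HB n).
  by rewrite /pseries_diffs mulr1 ger0_norm ?ler0n // ler_wpM2r ?exprn_ge0 ?(ltW z0) // ler_nat.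
apply/cvgr0Pnorm_le => e e0; have /cvgr0Pnorm_le /(_ e e0) := cK; apply: filterS => n.
apply: le_trans; rewrite E mulr_suml -sumrB.
apply: le_trans (ler_norm_sum _ _ _) _.
apply: le_trans (ler_norm _).
apply: (@le_trans _ _ (\sum_(0 <= i < n) K1 * (K2 / (1 - r)) * r ^+ n)); last first.
  by rewrite sumr_const_nat subn0 -[_ *+ n]mulr_natl mulrCA.
rewrite !big_nat; apply: ler_sum => i /andP[_ ltin].
rewrite -mulrBr normrM; have t := psum_tail ge x1 rr H2' (n - i).
apply: le_trans (ler_pM (normr_ge0 _) (normr_ge0 _) (H1' i) t) _.
by rewrite mulrACA -exprD subnKC // ltnW.
Unshelve. all: by end_near. Qed.

End PowerSeries.

(** * The dilogarithm at e^-x *)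

Section Dilogarithm.

Variable R : realType.
Implicit Types (x y t : R).

Lemma subexp_le (f g : R^nat) C : (forall n, `|f n| <= C * g n) -> subexp g -> subexp f.
Proof.
move=> fg ge; split=> y /[dup] /(subexp_bound ge)[B B0 HB] /andP[y0 _].
exists ((1 + `|C|) * B); first by rewrite mulr_gt0 // ltr_pwDl.
move=> n; apply: le_trans (ler_wpM2r (exprn_ge0 _ (ltW y0)) (fg n)) _.
rewrite -mulrA; apply: le_trans (ler_norm _) _; rewrite normrM.
apply: ler_pM => //; first by rewrite lerDr.
by rewrite normrM [`|y ^+ n|]ger0_norm ?exprn_ge0 // ltW.
Qed.

Lemma subexp1 : subexp (fun=> 1 : R).
Proof.
by split=> y /andP[y0 y1]; exists 1 => // n; rewrite normr1 mul1r exprn_ile1 // ltW.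
Qed.

Lemma subexp_inv : subexp (fun n => n%:R^-1 : R).
Proof.
apply: (@subexp_le _ _ 1 _ subexp1) => n; rewrite mulr1 normfV ger0_norm //.
by case: n => [|n]; rewrite ?invr0 // invf_le1 ?ler1n.
Qed.

Lemma subexp_inv2 : subexp (fun n => n%:R ^- 2 : R).
Proof.
apply: (@subexp_le _ _ 1 _ subexp1) => n; rewrite mulr1 normfV ger0_norm //.
by case: n => [|n]; rewrite ?expr0n ?invr0 // invf_le1 ?exprn_ege1 ?exprn_gt0 ?ler1n.
Qed.

Lemma psum1 x : `|x| < 1 -> psum (fun=> 1 : R) x = (1 - x)^-1.
Proof.
move=> x1; apply: psum_eq; rewrite -[X in _ --> X]mul1r.
exact: cvg_geometric_series.
Qed.

Lemma psum_nth0 (f : R^nat) : subexp f -> psum f 0 = f 0%N.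
Proof.
move=> fe; apply: psum_eq; rewrite -cvg_shiftS /=.
have E n : \sum_(0 <= i < n.+1) f i * 0 ^+ i = f 0%N.
  rewrite big_nat_recl //= expr0 mulr1 big1 ?addr0 // => i _.
  by rewrite expr0n mulr0.
by under eq_fun do rewrite E; exact: cvg_cst.
Qed.

(** Both sides have the same derivative, by the geometric series, and agree at 0. The term of index
    0 vanishes because the inverse of 0 is 0. *)
Lemma psum_inv x : 0 <= x < 1 -> psum (fun n => n%:R^-1 : R) x = - ln (1 - x).
Proof.
case/andP=> x0 x1; case: (eqVneq x 0) => [->|xn0].
  by rewrite psum_nth0 ?invr0 ?subr0 ?ln1 ?oppr0 //; exact: subexp_inv.
have xp : 0 < x by rewrite lt_neqAle eq_sym xn0.
have d : derive_on (fun y => psum (fun n => n%:R^-1) y + ln (1 - y)) (fun=> 0) 0 x.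
  move=> y /andP[y0 yx]; have y1 : `|y| < 1 by rewrite ger0_norm // (le_lt_trans yx).
  have d1 := is_derive_psum subexp_inv y1.
  have d2 : is_derive y 1 (fun y : R => ln (1 - y)) (- (1 - y)^-1).
    by der; [lra | rewrite sub0r mulN1r].
  apply: is_derive1_eq (is_derive1D d1 d2) _.
  rewrite (_ : pseries_diffs _ = fun=> 1) ?psum1 ?subrr //.
  by apply/funext => n; rewrite /pseries_diffs mulfV // pnatr_eq0.
have [c _] := mean_value xp d.
rewrite mul0r psum_nth0 ?invr0 ?subr0 ?ln1; last exact: subexp_inv.
by rewrite addr0 subr0 => /eqP; rewrite addr_eq0 => /eqP.
Qed.

(** Li_2(e^-x), introduced as a primitive of ln (1 - e^-x). *)
Definition dilog_exp x : R := psum (fun n => n%:R ^- 2) (expR (- x)).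

Lemma expRN_lt1 x : 0 < x -> `|expR (- x)| < 1.
Proof. by move=> x0; rewrite ger0_norm ?expR_ge0 // expR_lt1 oppr_lt0. Qed.

Lemma is_derive_dilog_exp x : 0 < x -> is_derive x 1 dilog_exp (ln (1 - expR (- x))).
Proof.
move=> x0; have x1 := expRN_lt1 x0.
have d1 := is_derive_psum subexp_inv2 x1.
have d2 : is_derive x 1 (fun x : R => expR (- x)) (- expR (- x)) by der; ring.
have d3 := @is_derive1_comp R _ (fun x : R => expR (- x)) x _ _ d1 d2.
apply: (is_derive1_eq d3).
rewrite mulrN mulrC -psum_diffs //; last exact: subexp_inv2.
rewrite (_ : (fun n => _) = (fun n => n%:R^-1 : R)); last first.
  apply/funext => n; case: n => [|n]; first by rewrite mul0r invr0.
  have : n.+1%:R != 0 :> R by rewrite pnatr_eq0.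
  by move: (n.+1%:R) => a a0; field.
rewrite psum_inv ?opprK // expR_ge0 /=.
by move: x1; rewrite ger0_norm // expR_ge0.
Qed.

Lemma dilog_exp_ge0 x : 0 < x -> 0 <= dilog_exp x.
Proof.
move=> x0; have x1 := expRN_lt1 x0.
rewrite -(_ : psum (fun n => 0 * n%:R ^- 2) (expR (- x)) = 0).
  apply: ler_psum => //; [exact/subexpZ/subexp_inv2 | exact: subexp_inv2 | move=> n].
  by rewrite mul0r mul0r mulr_ge0 ?invr_ge0 ?exprn_ge0 ?expR_ge0.
by rewrite psumZ ?mul0r //; exact: subexp_inv2.
Qed.

Lemma ln1N_ge x : 0 < x -> - ln (1 - expR (- x)) <= x^-1.
Proof.
move=> x0; have e1 : expR (- x) < 1 by rewrite expR_lt1 oppr_lt0.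
have := @ln1D_ge R (- expR (- x)) ltac:(lra).
have ex : 1 + x <= expR x by exact: expR_ge1Dx.
have p : 0 < expR x - 1 by lra.
have -> : - expR (- x) / (1 - expR (- x)) = - (expR x - 1)^-1.
  by rewrite expRN; have := expR_gt0 x => g; field; rewrite !gt_eqF //=; nra.
have : (expR x - 1)^-1 <= x^-1 by rewrite lef_pV2 ?posrE //; lra.
lra.
Qed.

Lemma dilog_exp_le x : 0 < x -> dilog_exp x <= x^-1.
Proof.
move=> x0; have x1 := expRN_lt1 x0.
apply: le_trans (ln1N_ge x0).
rewrite -psum_inv; last first.
  by rewrite expR_ge0 /=; move: x1; rewrite ger0_norm // expR_ge0.
apply: ler_psum => //; [exact: subexp_inv2 | exact: subexp_inv | move=> n].
rewrite ler_wpM2r ?exprn_ge0 ?expR_ge0 //.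
case: n => [|n]; first by rewrite expr0n.
by rewrite lef_pV2 ?posrE ?exprn_gt0 ?ltr0n // ler_eXnr // ler1n.
Qed.

Definition zeta2 : R := pi ^+ 2 / 6.

Lemma sum_inv2 n : \sum_(0 <= i < n.+1) i%:R ^- 2 = series (inv_squares R) n.
Proof. by rewrite big_nat_recl // expr0n invr0 add0r. Qed.

Lemma sum_inv2_le n : \sum_(0 <= i < n.+1) i%:R ^- 2 <= zeta2.
Proof.
rewrite sum_inv2; have nd : nondecreasing_seq (series (inv_squares R)).
  by apply: nondecreasing_series => k _; rewrite invr_ge0 exprn_ge0.
have cv := @basel R.
rewrite /zeta2 -(cvg_lim _ cv) //; apply: nondecreasing_cvgn_le => //.
by apply/cvg_ex; exists (pi ^+ 2 / 6).
Qed.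

Lemma dilog_exp_le_zeta2 x : 0 < x -> dilog_exp x <= zeta2.
Proof.
move=> x0; have x1 := expRN_lt1 x0.
have c := cvg_psum subexp_inv2 x1.
have c2 : (zeta2 : R) @[_ --> \oo] --> zeta2 by exact: cvg_cst.
apply: (ler_cvg_to c c2); near=> n.
apply: le_trans (sum_inv2_le n); rewrite big_nat_recr //=.
apply: ler_wpDr; first by rewrite invr_ge0 exprn_ge0.
apply: ler_sum => i _; rewrite ler_piMr ?invr_ge0 ?exprn_ge0 //.
by rewrite exprn_ile1 ?expR_ge0 // ltW //; move: x1; rewrite ger0_norm // expR_ge0.
Unshelve. all: by end_near. Qed.

(** Continuity at the boundary, by positivity: a partial sum close to zeta(2) suffices, and each of
    its terms drops by at most [x], since i^-2 (1 - e^(-ix)) <= x / i. *)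
Lemma dilog_exp_cvg0 e : 0 < e -> exists2 d, 0 < d &
  forall x, 0 < x < d -> zeta2 - e <= dilog_exp x.
Proof.
move=> e0; have cv := @basel R; have e2 : 0 < e / 2 by rewrite divr_gt0.
move/cvgrPdist_le : cv => /(_ _ e2) [N _ /(_ N (leqnn N)) /= HN].
exists (e / 2 / N.+1%:R); first by rewrite divr_gt0.
move=> x /andP[x0 xd]; have x1 := expRN_lt1 x0.
apply: (@le_trans _ _ (\sum_(0 <= i < N.+1) i%:R ^- 2 * expR (- x) ^+ i)); last first.
  apply: nondecreasing_cvgn_le; last exact: is_cvg_psum subexp_inv2 x1.
  by apply: nondecreasing_series => k _; rewrite mulr_ge0 ?invr_ge0 ?exprn_ge0 ?expR_ge0.
apply: (@le_trans _ _ (\sum_(0 <= i < N.+1) (i%:R ^- 2 - x))).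
  rewrite sumrB sum_inv2 sumr_const_nat subn0 -[x *+ _]mulr_natl.
  have : N.+1%:R * x <= e / 2 by rewrite mulrC -ler_pdivlMr // ltW.
  move: HN; rewrite -/zeta2; have := ler_norm (zeta2 - series (inv_squares R) N).
  by lra.
apply: ler_sum => i _; case: i => [|i].
  by rewrite expr0n invr0 mul0r sub0r oppr_le0 ltW.
have i1 : 1 <= i.+1%:R :> R by rewrite ler1n.
rewrite -expRM_natl; have := expR_ge1Dx (i.+1%:R * - x); rewrite mulrN => h.
apply: (@le_trans _ _ (i.+1%:R ^- 2 * (1 - i.+1%:R * x))); last first.
  by rewrite ler_wpM2l ?invr_ge0 ?exprn_ge0.
rewrite mulrBr mulr1 lerB // mulrA ler_piMl ?(ltW x0) //.
rewrite mulrC ler_pdivrMr ?exprn_gt0 ?ltr0n // mul1r ler_eXnr //.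
Qed.

End Dilogarithm.

(** * The logarithm of P(e^-t) as t tends to 0 *)

Section LogEulerFunction.

Variable R : realType.
Implicit Types (x y t : R).

(* The regular part of ln (1 - e^-x) once ln x is removed, with its primitive
   and its derivative. *)
Definition reg_ln x : R := ln (1 - expR (- x)) - ln x.
Definition reg_prim x : R := dilog_exp x - xlnx x.
Definition reg_der x : R := (expR x - 1)^-1 - x^-1.

Lemma expR_gt1D x : 0 < x -> x < expR x - 1.
Proof. by move=> x0; rewrite ltrBrDl expR_gt1Dx // gt_eqF. Qed.

Lemma is_derive_reg_prim x : 0 < x -> is_derive x 1 reg_prim (reg_ln x).
Proof.
by move=> x0; exact: is_derive1D (is_derive_dilog_exp x0) (is_derive1N (is_derive_xlnx x0)).
Qed.

Lemma is_derive_reg_ln x : 0 < x -> is_derive x 1 reg_ln (reg_der x).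
Proof.
move=> x0; have e1 : expR (- x) < 1 by rewrite expR_lt1 oppr_lt0.
rewrite /reg_ln; der => //; first by lra.
rewrite /reg_der !mulN1r opprK add0r mul1r; congr (_ - _).
have ex := expR_gt1D x0; have g := expR_gt0 x.
by rewrite expRN; field; rewrite !gt_eqF //=; lra.
Qed.

(** Equivalent to x / 2 <= sinh (x / 2). Its square is the sign of the derivative of [reg_der],
    whence the convexity of [reg_ln]. *)
Lemma mul_expR_half_le x : 0 <= x -> x * expR (x / 2) <= expR x - 1.
Proof.
move=> x0.
suff: expR 0 - 1 - 0 * expR (0 / 2) <= expR x - 1 - x * expR (x / 2) by rewrite expR0; lra.
apply: (@derive_ge0_le _ (fun y => expR y - 1 - y * expR (y / 2))
  (fun y => expR (y / 2) * (expR (y / 2) - 1 - y / 2))) => // [y _|y _].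
  by der; rewrite [in RHS]mulrBr mulrBr -expRD -splitr; field.
rewrite mulr_ge0 ?expR_ge0 //; have := expR_ge1Dx (y / 2); lra.
Qed.

Lemma reg_der_mono x y : 0 < x -> x <= y -> reg_der x <= reg_der y.
Proof.
move=> x0 xy.
apply: (@derive_ge0_le _ reg_der (fun z => z ^- 2 - expR z / (expR z - 1) ^+ 2)) => // [z|z].
  case/andP=> xz _; have z0 : 0 < z by exact: lt_le_trans xz.
  have ez := expR_gt1D z0.
  by rewrite /reg_der; der; [rewrite gt_eqF //; lra | rewrite gt_eqF | ring].
case/andP=> xz _; have z0 : 0 < z by exact: lt_trans xz.
have ez := expR_gt1D z0; have h := mul_expR_half_le (ltW z0).
have e1 : 0 < expR z - 1 by lra.
rewrite subr_ge0 ler_pdivrMr ?exprn_gt0 // mulrC ler_pdivlMr ?exprn_gt0 //.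
have -> : expR z * z ^+ 2 = (z * expR (z / 2)) ^+ 2.
  by rewrite exprMn -expRM_natl mulrC; congr (_ * expR _); field.
by rewrite ler_sqr // nnegrE ?mulr_ge0 ?expR_ge0 // ltW.
Qed.

Lemma reg_der_bounds x : 0 < x -> -1 <= reg_der x <= 0.
Proof.
move=> x0; have ex := expR_gt1D x0; apply/andP; split; last first.
  by rewrite subr_le0 lef_pV2 ?posrE //; lra.
suff: x^-1 - 1 <= (expR x - 1)^-1 by rewrite /reg_der; lra.
have [x1|x1] := leP 1 x.
  have : x^-1 <= 1 by rewrite invf_le1.
  have : 0 <= (expR x - 1)^-1 by rewrite invr_ge0; lra.
  lra.
have e0 : 0 < expR x by exact: expR_gt0.
have : 1 - x <= expR (- x) by have := expR_ge1Dx (- x); lra.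
rewrite expRN -[(expR x)^-1]div1r ler_pdivlMr // => h.
have p : 0 < expR x - 1 by lra.
have -> : (expR x - 1)^-1 = x / (x * (expR x - 1)) by field; rewrite !gt_eqF.
rewrite ler_pdivlMr ?mulr_gt0 // mulrA mulrBl mulVf ?gt_eqF // mul1r.
by lra.
Qed.

Lemma reg_ln_bounds x : 0 < x -> - x <= reg_ln x <= 0.
Proof.
move=> x0; have e1 : expR (- x) < 1 by rewrite expR_lt1 oppr_lt0.
have p : 0 < 1 - expR (- x) by lra.
apply/andP; split.
  rewrite lerBrDl -[X in ln x + X]expRK -lnM ?posrE ?expR_gt0 // ler_ln ?posrE ?mulr_gt0 ?expR_gt0 //.
  have := expR_gt1D x0; rewrite expRN; have ex := expR_gt0 x => h.
  by rewrite ler_pdivrMr // mulrBl mulVf ?gt_eqF // mul1r ltW.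
rewrite subr_le0 ler_ln ?posrE //; have := expR_ge1Dx (- x); lra.
Qed.

Lemma xlnx_cvg0 e : 0 < e -> exists2 d, 0 < d & forall x, 0 < x < d -> `|xlnx x| <= e.
Proof.
move=> e0; exists (Num.min 1 ((e / 3) ^+ 2)); first by rewrite lt_min ltr01 exprn_gt0 ?divr_gt0.
move=> x; rewrite lt_min => /and3P[x0 x1 xe].
set s := Num.sqrt x; have s0 : 0 < s by rewrite sqrtr_gt0.
have xs : x = s ^+ 2 by rewrite sqr_sqrtr // ltW.
have se : s < e / 3.
  by move: xe; rewrite xs ltr_pXn2r // nnegrE ?ltW // divr_gt0.
have s1 : s < 1 by move: x1; rewrite xs expr_lt1 // ltW.
have ls : - ln s <= s^-1 by rewrite -lnV ?posrE // ltW // ln_sublinear // invr_gt0.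
have ls0 : ln s <= 0 by rewrite ln_le0 // ltW.
rewrite /xlnx {2}xs lnXn // -[ln s *+ 2]mulr_natr.
have h : - (x * ln s) <= s.
  rewrite -mulrN xs expr2 -mulrA ler_piMr // ?(ltW s0) //.
  by rewrite -ler_pdivlMl // mulr1.
have h2 : x * ln s <= 0 by rewrite mulr_ge0_le0 // ltW.
have xs' : x <= s by rewrite xs expr2 ler_piMr // ltW.
rewrite ler_norml; apply/andP; split; lra.
Qed.

(** [reg_prim] tends to zeta(2) at 0, and its derivative [reg_ln] lies between -x and 0. *)
Lemma reg_prim_bounds y : 0 < y -> zeta2 R - y ^+ 2 <= reg_prim y <= zeta2 R.
Proof.
move=> y0.
have cmp x : 0 < x < y -> reg_prim x - y ^+ 2 <= reg_prim y <= reg_prim x.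
  case/andP=> x0 xy.
  have d : derive_on reg_prim reg_ln x y.
    by move=> z /andP[xz _]; apply: is_derive_reg_prim; exact: lt_le_trans xz.
  have [c /andP[xc cy] E] := mean_value xy d.
  have /andP[l1 l2] := reg_ln_bounds (lt_trans x0 xc).
  have : - y ^+ 2 <= reg_ln c * (y - x) by rewrite expr2; nra.
  have : reg_ln c * (y - x) <= 0 by rewrite mulr_le0_ge0 // subr_ge0 ltW.
  by rewrite -E; lra.
suff near e : 0 < e -> exists2 x, 0 < x < y & `|reg_prim x - zeta2 R| <= e.
  apply/andP; split; apply/ler_addgt0Pr => e e0; have [x xy] := near e e0;
    rewrite ler_norml => /andP[h1 h2]; have /andP[] := cmp x xy; lra.
move=> e0; have e2 : 0 < e / 2 by rewrite divr_gt0.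
have [d1 d10 H1] := dilog_exp_cvg0 e2; have [d2 d20 H2] := xlnx_cvg0 e2.
pose x := Num.min y (Num.min d1 d2) / 2.
have x0 : 0 < x by rewrite divr_gt0 // !lt_min y0 d10.
have x2 : x < Num.min y (Num.min d1 d2) by rewrite /x ltr_pdivrMr // ltr_pMr ?ltr1n // !lt_min y0 d10.
move: x2; rewrite !lt_min => /and3P[xy xd1 xd2].
exists x; first by rewrite x0.
have := H1 x ltac:(by rewrite x0); have := H2 x ltac:(by rewrite x0).
have := dilog_exp_le_zeta2 x0; rewrite /reg_prim !ler_norml => h1 /andP[h2 h3] h4.
apply/andP; split; lra.
Qed.

(** A partial sum of log P(e^-t), by factors. *)
Definition log_euler t (n : nat) : R := \sum_(0 <= j < n) - ln (1 - expR (- (j.+1%:R * t))).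

(** At the nodes jt the singular part ln x sums exactly to a factorial, and the convex part [reg_ln]
    goes through the midpoint rule with step t. The quadrature error telescopes to t / 4 times the
    variation of [reg_der], which is at most 1. *)
Lemma log_euler_bounds t n m : 0 < t ->
  m = reg_prim (t / 2) / t + ln t / 2 - dilog_exp ((n%:R + 2^-1) * t) / t
   - (series (midpoint_ln_error R) n - xlnx 2^-1) ->
  m <= log_euler t n <= m + t / 4.
Proof.
move=> t0 mE.
have cell j : 0 <= (reg_prim (j.+1%:R * t + t / 2) - reg_prim (j.+1%:R * t - t / 2)) / t
    - reg_ln (j.+1%:R * t) <=
    t / 4 * (reg_der (j.+1%:R * t + t / 2) - reg_der (j.+1%:R * t - t / 2)).
  have j1 : 1 <= j.+1%:R :> R by rewrite ler1n.
  have jt : t <= j.+1%:R * t by rewrite ler_peMl // ltW.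
  have d1 : derive_on reg_prim reg_ln (j.+1%:R * t - t / 2) (j.+1%:R * t + t / 2).
    by move=> y ya; apply: is_derive_reg_prim; lra.
  have d2 : derive_on reg_ln reg_der (j.+1%:R * t - t / 2) (j.+1%:R * t + t / 2).
    by move=> y ya; apply: is_derive_reg_ln; lra.
  have h0 : 0 <= t / 2 by lra.
  have mono y z : j.+1%:R * t - t / 2 <= y -> y <= z -> z <= j.+1%:R * t + t / 2 ->
      reg_der y <= reg_der z.
    by move=> ya yz _; apply: reg_der_mono => //; lra.
  have /andP[] := midpoint_convex h0 d1 d2 mono.
  set Dp := reg_prim _ - reg_prim _; set Dr := reg_der _ - reg_der _; set w := reg_ln _ => lo hi.
  have e : 2 * (t / 2) * w = t * w by field.
  rewrite e in lo hi.
  have it : 0 < t^-1 by rewrite invr_gt0.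
  have E1 : Dp / t - w = (Dp - t * w) * t^-1 by field; rewrite gt_eqF.
  have E2 : t / 4 * Dr = (t / 2) ^+ 2 * Dr * t^-1 by field; rewrite gt_eqF.
  by rewrite E1 E2 mulr_ge0 ?(ltW it) //= ler_pM2r.
pose s := \sum_(0 <= j < n) ((reg_prim (j.+1%:R * t + t / 2) - reg_prim (j.+1%:R * t - t / 2)) / t
    - reg_ln (j.+1%:R * t)).
have tel (f : R -> R) : \sum_(0 <= j < n) (f (j.+1%:R * t + t / 2) - f (j.+1%:R * t - t / 2)) =
    f ((n%:R + 2^-1) * t) - f (t / 2).
  elim: (n) => [|k IHk]; first by rewrite big_nil add0r mulrC subrr.
  rewrite big_nat_recr //= IHk.
  have -> : k.+1%:R * t - t / 2 = (k%:R + 2^-1) * t by rewrite -natr1; field.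
  have -> : k.+1%:R * t + t / 2 = (k.+1%:R + 2^-1) * t by field.
  ring.
have E : log_euler t n = m + s.
  rewrite /s sumrB -mulr_suml tel mE /log_euler /reg_ln sumrB sumrN.
  have -> : \sum_(0 <= j < n) ln (j.+1%:R * t) = ln n`!%:R + n%:R * ln t.
    elim: (n) => [|k IHk]; first by rewrite big_nil fact0 ln1 mul0r addr0.
    rewrite big_nat_recr //= IHk factS natrM !lnM ?posrE ?ltr0n ?fact_gt0 // -natr1; ring.
  rewrite sum_midpoint_ln_error /reg_prim.
  have nR : 0 < n%:R + 2^-1 :> R by rewrite ltr_wpDl.
  have -> : xlnx ((n%:R + 2^-1) * t) = (xlnx (n%:R + 2^-1) + (n%:R + 2^-1) * ln t) * t.
    by rewrite /xlnx lnM ?posrE //; ring.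
  move: (\sum_(0 <= i < n) _) (dilog_exp _) (dilog_exp _) (xlnx (t / 2)) => a b c d.
  move: (xlnx _) (xlnx _) (ln _) (ln t) => e f g h.
  by field; rewrite gt_eqF.
rewrite E lerDl lerD2l; apply/andP; split; first by apply: sumr_ge0 => j _; have /andP[] := cell j.
apply: (@le_trans _ _ (\sum_(0 <= j < n)
   t / 4 * (reg_der (j.+1%:R * t + t / 2) - reg_der (j.+1%:R * t - t / 2)))).
  by apply: ler_sum => j _; have /andP[] := cell j.
rewrite -mulr_sumr tel -[leRHS]mulr1 ler_pM2l ?divr_gt0 //.
have n2 : 0 < (n%:R + 2^-1) * t by rewrite mulr_gt0 // ltr_wpDl.
have t2 : 0 < t / 2 by rewrite divr_gt0.
have /andP[_ h1] := reg_der_bounds n2; have /andP[h2 _] := reg_der_bounds t2.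
by lra.
Qed.

(** Of the error, t / 4 comes from the quadrature and t / 4 from replacing [reg_prim (t / 2)] by
    zeta(2). The constant ln (2 pi) / 2 is Stirling's. *)
Lemma log_euler_lim t l : 0 < t -> log_euler t @ \oo --> l ->
  `|l - (zeta2 R / t + ln t / 2 - ln (2 * pi) / 2)| <= t.
Proof.
move=> t0 cl.
have cU : dilog_exp ((n%:R + 2^-1) * t) / t @[n --> \oo] --> (0 : R).
  apply: (@cvg_bound_harmonic R (t ^- 2)) => n n0; have nR : 0 < n%:R :> R by rewrite ltr0n.
  have p : 0 < (n%:R + 2^-1) * t by rewrite mulr_gt0 // ltr_wpDl.
  have u0 := dilog_exp_ge0 p; have u1 := dilog_exp_le p.
  rewrite subr0 ger0_norm ?divr_ge0 ?(ltW t0) //.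
  rewrite ler_pdivrMr //; apply: le_trans u1 _.
  have -> : t ^- 2 / n%:R * t = (n%:R * t)^-1 by field; rewrite !gt_eqF.
  by rewrite lef_pV2 ?posrE ?mulr_gt0 // ler_pM2r // lerDl invr_ge0.
pose M := reg_prim (t / 2) / t + ln t / 2 - ln (2 * pi) / 2.
pose mm n := reg_prim (t / 2) / t + ln t / 2 - dilog_exp ((n%:R + 2^-1) * t) / t
   - (series (midpoint_ln_error R) n - xlnx 2^-1).
have cm : mm n @[n --> \oo] --> M.
  have -> : M = reg_prim (t / 2) / t + ln t / 2 - 0 - ((ln pi - 1) / 2 - xlnx 2^-1).
    rewrite /M /xlnx lnM ?posrE ?pi_gt0 // lnV ?posrE //.
    by move: (ln pi) (reg_prim _ / t) (ln t) (ln 2) => p q r s; field.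
  apply: cvgB; last by apply: cvgB; [exact: stirling | exact: cvg_cst].
  by apply: cvgB => //; exact: cvg_cst.
have lo : M <= l.
  by apply: (ler_cvg_to cm cl); near=> n; have /andP[] := @log_euler_bounds t n _ t0 (erefl _).
have hi : l <= M + t / 4.
  have cm2 : mm n + t / 4 @[n --> \oo] --> M + t / 4.
    by apply: cvgD; [exact: cm | exact: cvg_cst].
  by apply: (ler_cvg_to cl cm2); near=> n; have /andP[] := @log_euler_bounds t n _ t0 (erefl _).
have t2 : 0 < t / 2 by rewrite divr_gt0.
have /andP[b1 b2] := reg_prim_bounds t2.
have it : 0 < t^-1 by rewrite invr_gt0.
have c1 : zeta2 R / t - t / 4 <= reg_prim (t / 2) / t.
  have := ler_wpM2r (ltW it) b1; suff -> : (zeta2 R - (t / 2) ^+ 2) / t = zeta2 R / t - t / 4 by [].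
  by move: (zeta2 R) => z; field; rewrite gt_eqF.
have c2 : reg_prim (t / 2) / t <= zeta2 R / t by rewrite ler_pM2r.
rewrite ler_norml /M in lo hi *; apply/andP; split; lra.
Unshelve. all: by end_near. Qed.

End LogEulerFunction.

(** * Coefficients of log F and their generating function *)

Section LogCoefficients.

Variable R : realType.
Implicit Types (x y t : R).

(** This and the next two are the coefficients of -ln (1 - q^d), of log P(q^a) and of log F;
    division by 0 makes the constant terms vanish. *)
Definition factor_coef (d N : nat) : R := (qpow_log d N)%:~R / N%:R.
Definition divsum_coef (a N : nat) : R := (mult_divsum a N)%:~R / N%:R.
Definition log_coef (s : seq (nat * int)) (N : nat) : R :=
  (weighted_divsum s N)%:~R / N%:R.

Lemma factor_coef_ge0 d N : 0 <= factor_coef d N.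
Proof.
rewrite /factor_coef /qpow_log; case: ifP => _; rewrite ?mul0r // divr_ge0 //.
Qed.

Lemma factor_coef_le1 d N : factor_coef d N <= 1.
Proof.
rewrite /factor_coef /qpow_log; case: ifP => [/andP[N0 dN]|_]; rewrite ?mul0r ?ler01 //.
by rewrite ler_pdivrMr ?ltr0n // mul1r ler_nat dvdn_leq.
Qed.

Lemma subexp_factor_coef d : subexp (factor_coef d).
Proof.
have h n : `|factor_coef d n| <= 1 * 1.
  by rewrite mulr1 ger0_norm ?factor_coef_ge0 // factor_coef_le1.
exact: (@subexp_le R _ (fun=> 1) 1 h (subexp1 R)).
Qed.

Lemma divsum_coefE a N M : (0 < a)%N -> (N < M)%N ->
  divsum_coef a N = \sum_(0 <= j < M) factor_coef (a * j.+1) N.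
Proof.
move=> a0 NM; rewrite /divsum_coef -(mult_divsumE a0 NM) big_mkord.
by rewrite rmorph_sum /= mulr_suml.
Qed.

Lemma divsum_coef_ge a N M : (0 < a)%N ->
  \sum_(0 <= j < M) factor_coef (a * j.+1) N <= divsum_coef a N.
Proof.
move=> a0; rewrite (@divsum_coefE a N (N.+1 + M)) ?leq_addr //.
rewrite (big_cat_nat (leq0n M) (leq_addl _ _)) /= lerDl.
by apply: sumr_ge0 => j _; exact: factor_coef_ge0.
Qed.

Lemma divsum_coef_ge0 a N : (0 < a)%N -> 0 <= divsum_coef a N.
Proof. by move=> a0; have := @divsum_coef_ge a N 0 a0; rewrite big_nil. Qed.

Lemma divsum_coef_le a N : (0 < a)%N -> divsum_coef a N <= N.+1%:R.
Proof.
move=> a0; rewrite (@divsum_coefE a N N.+1) //.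
apply: (@le_trans _ _ (\sum_(0 <= j < N.+1) 1)).
  by apply: ler_sum => j _; exact: factor_coef_le1.
by rewrite sumr_const_nat subn0.
Qed.

Lemma subexp_linear : subexp (fun n => n.+1%:R : R).
Proof.
apply: (@subexp_le _ _ _ 1 _ (subexp_diffs (subexp1 R))) => n.
by rewrite /pseries_diffs mulr1 mul1r ger0_norm.
Qed.

Lemma subexp_divsum_coef a : (0 < a)%N -> subexp (divsum_coef a).
Proof.
move=> a0; have h n : `|divsum_coef a n| <= 1 * n.+1%:R.
  by rewrite mul1r ger0_norm ?divsum_coef_ge0 // divsum_coef_le.
exact: (@subexp_le R _ (fun n => n.+1%:R) 1 h subexp_linear).
Qed.

Lemma psum_factor_coef d x : (0 < d)%N -> 0 <= x < 1 ->
  psum (factor_coef d) x = - ln (1 - x ^+ d).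
Proof.
move=> d0 /andP[x0 x1].
have xd1 : 0 <= x ^+ d < 1 by rewrite exprn_ge0 //= exprn_ilt1 // -lt0n.
have ax : `|x| < 1 by rewrite ger0_norm.
have axd : `|x ^+ d| < 1 by case/andP: xd1 => h1 h2; rewrite ger0_norm.
rewrite -psum_inv //.
have c1 := cvg_psum (@subexp_factor_coef d) ax.
have c2 := cvg_psum (subexp_inv R) axd.
have E K : \sum_(0 <= i < d * K) factor_coef d i * x ^+ i =
    \sum_(0 <= i < K) i%:R^-1 * (x ^+ d) ^+ i.
  elim: K => [|K IHK]; first by rewrite muln0 !big_nil.
  rewrite big_nat_recr //= -IHK mulnS addnC.
  rewrite (big_cat_nat (leq0n (d * K)) (leq_addr _ _)) /=; congr (_ + _).
  have lt : (d * K < d * K + d)%N by rewrite -[X in (X < _)%N]addn0 ltn_add2l.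
  rewrite (big_ltn lt) big_nat big1 ?addr0.
    rewrite /factor_coef /qpow_log dvdn_mulr // andbT exprM; congr (_ * _).
    case: ifP => [dK|]; last first.
      by case: K {IHK lt} => [|K]; rewrite ?mul0r ?invr0 // muln_gt0 d0.
    have K0 : (0 < K)%N by move: dK; rewrite muln_gt0 => /andP[].
    rewrite natrM; have : K%:R != 0 :> R by rewrite pnatr_eq0 -lt0n.
    have : d%:R != 0 :> R by rewrite pnatr_eq0 -lt0n.
    rewrite -pmulrn; move: (d%:R) (K%:R) => u v u0 v0.
    by field; rewrite u0 v0.
  move=> i /andP[ltKi ltid]; rewrite /factor_coef /qpow_log.
  suff -> : (d %| i)%N = false by rewrite andbF !mul0r.
  apply/negbTE; rewrite -(subnKC (ltnW ltKi)) dvdn_addr ?dvdn_mulr //.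
  by apply/negP => /dvdn_leq; rewrite subn_gt0 ltKi => /(_ isT); lia.
have c3 : \sum_(0 <= i < d * K) factor_coef d i * x ^+ i @[K --> \oo] --> psum (factor_coef d) x.
  apply: (cvg_comp (fun K => d * K)%N (fun n => \sum_(0 <= i < n) factor_coef d i * x ^+ i) _ c1).
  by apply: cvgny_ge_id => n; rewrite leq_pmull.
rewrite (funext E) in c3; exact: (cvg_unique (@Rhausdorff R) c3 c2).
Qed.

Lemma subexp0 : subexp (fun=> 0 : R).
Proof. by split=> y _; exists 1 => // n; rewrite normr0 mul0r. Qed.

Lemma psum0 x : psum (fun=> 0 : R) x = 0.
Proof.
apply: psum_eq; have E n : \sum_(0 <= i < n) 0 * x ^+ i = 0 by rewrite big1 // => i _; rewrite mul0r.
by rewrite (funext E); exact: cvg_cst.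
Qed.

Lemma psum_sum (I : Type) (r : seq I) (f : I -> R^nat) x :
  (forall i, subexp (f i)) -> `|x| < 1 ->
  subexp (fun n => \sum_(i <- r) f i n) /\
  psum (fun n => \sum_(i <- r) f i n) x = \sum_(i <- r) psum (f i) x.
Proof.
move=> fe x1; elim: r => [|i r [IH1 IH2]].
  have e : (fun n => \sum_(i <- [::]) f i n) = (fun n => 0) :> R^nat.
    by apply/funext => n; rewrite big_nil.
  by rewrite e big_nil psum0; split => //; exact: subexp0.
have e : (fun n => \sum_(i <- i :: r) f i n) = (fun n => f i n + \sum_(i <- r) f i n).
  by apply/funext => n; rewrite big_cons.
by rewrite e big_cons psumD // IH2; split => //; exact: subexpD.
Qed.

(** Exchanges the sum over factors with the sum over powers of q. All terms are nonnegative and the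
    first M factors already give the coefficients below M, so M factors lie between the M-th partial
    sum and the full series. *)
Lemma cvg_log_euler a t : (0 < a)%N -> 0 < t ->
  log_euler (a%:R * t) @ \oo --> psum (divsum_coef a) (expR (- t)).
Proof.
move=> a0 t0; set x := expR (- t).
have x0 : 0 <= x by exact: expR_ge0.
have x1 : x < 1 by rewrite expR_lt1 oppr_lt0.
have ax : `|x| < 1 by rewrite ger0_norm.
have SE M : log_euler (a%:R * t) M = psum (fun N => \sum_(0 <= j < M) factor_coef (a * j.+1) N) x.
  rewrite (psum_sum (index_iota 0 M) (fun j => @subexp_factor_coef (a * j.+1)) ax).2.
  apply: eq_bigr => j _; rewrite psum_factor_coef ?muln_gt0 ?a0 ?x0 //.
  by rewrite /x -expRM_natl natrM; congr (- ln (1 - expR _)); ring.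
have sS M := (psum_sum (index_iota 0 M) (fun j => @subexp_factor_coef (a * j.+1)) ax).1.
have c := cvg_psum (subexp_divsum_coef a0) ax.
apply: (squeeze_cvgr _ c (cvg_cst _)); near=> M; apply/andP; split.
  rewrite SE.
  have -> : \sum_(0 <= i < M) divsum_coef a i * x ^+ i =
      \sum_(0 <= i < M) (\sum_(0 <= j < M) factor_coef (a * j.+1) i) * x ^+ i.
    by rewrite !big_nat; apply: eq_bigr => i /andP[_ iM]; rewrite (divsum_coefE a0 iM).
  apply: nondecreasing_cvgn_le; last exact: is_cvg_psum (sS M) ax.
  apply: nondecreasing_series => k _; rewrite mulr_ge0 ?exprn_ge0 //.
  by apply: sumr_ge0 => j _; exact: factor_coef_ge0.
rewrite SE; apply: ler_psum => //; first exact: subexp_divsum_coef.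
by move=> n; rewrite ler_wpM2r ?exprn_ge0 // divsum_coef_ge.
Unshelve. all: by end_near. Qed.

Lemma psum_divsum_coef a t : (0 < a)%N -> 0 < t ->
  `|psum (divsum_coef a) (expR (- t)) -
    (zeta2 R / a%:R / t + ln t / 2 + (ln a%:R - ln (2 * pi)) / 2)| <= a%:R * t.
Proof.
move=> a0 t0; have aR : 0 < a%:R :> R by rewrite ltr0n.
have := log_euler_lim (mulr_gt0 aR t0) (cvg_log_euler a0 t0).
suff -> : zeta2 R / (a%:R * t) + ln (a%:R * t) / 2 - ln (2 * pi) / 2 =
  zeta2 R / a%:R / t + ln t / 2 + (ln a%:R - ln (2 * pi)) / 2 by [].
rewrite lnM ?posrE //; move: (a%:R) aR (ln (2 * pi)) (zeta2 R) (ln t) (ln a%:R) => b b0 c z l m.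
by field; rewrite !gt_eqF.
Qed.

Lemma log_coefE s N : log_coef s N = \sum_(p <- s) p.2%:~R * divsum_coef p.1 N.
Proof.
rewrite /log_coef weighted_divsumE rmorph_sum /= mulr_suml; apply: eq_bigr => p _.
by rewrite rmorphM /= mulrA.
Qed.

(** The three constants collect log P(e^(-at)) = zeta(2) / (a t) + ln (a t) / 2 - ln (2 pi) / 2 +
    O(t) over the family of exponents. *)
Definition saddle_A (s : seq (nat * int)) : R := zeta2 R * \sum_(p <- s) p.2%:~R / p.1%:R.
Definition saddle_beta (s : seq (nat * int)) : R := (\sum_(p <- s) p.2%:~R) / 2.
Definition saddle_kappa (s : seq (nat * int)) : R :=
  (\sum_(p <- s) p.2%:~R * (ln p.1%:R - ln (2 * pi))) / 2.

Lemma log_coef_sum s x : all (fun p => 0 < p.1)%N s -> `|x| < 1 ->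
  subexp (log_coef s) /\
  psum (log_coef s) x = \sum_(p <- s) p.2%:~R * psum (divsum_coef p.1) x.
Proof.
move=> sp ax.
have e : log_coef s = (fun N => \sum_(p <- s) p.2%:~R * divsum_coef p.1 N).
  by apply/funext => N; rewrite log_coefE.
rewrite {}e; elim: s sp => [|p s IH] /=.
  move=> _; rewrite big_nil.
  have -> : (fun N => \sum_(p <- [::]) p.2%:~R * divsum_coef p.1 N) = (fun n => 0) :> R^nat.
    by apply/funext => n; rewrite big_nil.
  by rewrite psum0; split => //; exact: subexp0.
case/andP=> p0 /IH[IH1 IH2].
have -> : (fun N => \sum_(p <- p :: s) p.2%:~R * divsum_coef p.1 N) =
    (fun N => p.2%:~R * divsum_coef p.1 N + \sum_(p <- s) p.2%:~R * divsum_coef p.1 N) :> R^nat.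
  by apply/funext => N; rewrite big_cons.
have sp1 := subexp_divsum_coef p0; have sp2 : subexp (fun N => p.2%:~R * divsum_coef p.1 N) by exact: subexpZ.
by rewrite psumD // IH2 big_cons psumZ //; split => //; exact: subexpD.
Qed.

Lemma subexp_log_coef s : all (fun p => 0 < p.1)%N s -> subexp (log_coef s).
Proof. by move=> sp; have [] := @log_coef_sum s 0 sp ltac:(by rewrite normr0). Qed.

Lemma psum_log_coef s : all (fun p => 0 < p.1)%N s ->
  exists2 C : R, 0 < C & forall t, 0 < t ->
  `|psum (log_coef s) (expR (- t)) -
    (saddle_A s / t + saddle_beta s * ln t + saddle_kappa s)| <= C * t.
Proof.
move=> sp; exists (1 + \sum_(p <- s) `|p.2%:~R| * p.1%:R).
  by rewrite ltr_pwDl // sumr_ge0.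
move=> t t0; set x := expR (- t).
have x0 : 0 <= x by exact: expR_ge0.
have x1 : x < 1 by rewrite expR_lt1 oppr_lt0.
have ax : `|x| < 1 by rewrite ger0_norm.
apply: (@le_trans _ _ ((\sum_(p <- s) `|p.2%:~R| * p.1%:R) * t)); last first.
  by rewrite ler_pM2r // lerDr.
have [se pe] := log_coef_sum sp ax.
rewrite pe; elim: s sp {se pe} => [|p s IH] /=.
  by rewrite /saddle_A /saddle_beta /saddle_kappa !big_nil !(mul0r, mulr0, addr0, subr0) normr0.
case/andP=> p0 /IH {}IH; have h := psum_divsum_coef p0 t0.
rewrite !big_cons mulrDl.
have -> : p.2%:~R * psum (divsum_coef p.1) x + \sum_(j <- s) j.2%:~R * psum (divsum_coef j.1) x -
    (saddle_A (p :: s) / t + saddle_beta (p :: s) * ln t + saddle_kappa (p :: s)) =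
    p.2%:~R * (psum (divsum_coef p.1) x -
      (zeta2 R / p.1%:R / t + ln t / 2 + (ln p.1%:R - ln (2 * pi)) / 2)) +
    (\sum_(j <- s) j.2%:~R * psum (divsum_coef j.1) x -
    (saddle_A s / t + saddle_beta s * ln t + saddle_kappa s)).
  rewrite /saddle_A /saddle_beta /saddle_kappa !big_cons.
  move: (\sum_(_ <- s) _) (\sum_(_ <- s) _) (\sum_(_ <- s) _) (\sum_(_ <- s) _) => a b c d.
  move: (ln t) (ln (2 * pi)) (ln p.1%:R) (psum _ _) (zeta2 R) (p.2%:~R : R) => e f g h' z k.
  field; rewrite pnatr_eq0 -lt0n p0 andbT gt_eqF //.
apply: le_trans (ler_normD _ _) (lerD _ IH).
by rewrite normrM -[leRHS]mulrA ler_wpM2l.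
Qed.

End LogCoefficients.

(** * Asymptotics of the derivatives of log F(e^-t) *)

Section Cumulants.

Variable R : realType.

Lemma subexp_mul_nat (f : R^nat) : subexp f -> subexp (fun n => n%:R * f n).
Proof.
move=> fe; split=> y /[dup] yy /(subexp_bound (subexp_diffs fe))[B B0 HB].
exists B => //; case=> [|n]; first by rewrite mul0r normr0 mul0r ltW.
case/andP: yy => y0 y1; apply: le_trans (HB n); rewrite /pseries_diffs exprS.
by rewrite mulrCA ler_piMl ?(ltW y1) // mulr_ge0 // exprn_ge0 // ltW.
Qed.

Variables (c : R^nat) (A beta kappa C : R).
Hypothesis ce : subexp c.
Hypothesis c_ge0 : forall n, 0 <= c n.
Hypothesis A0 : 0 < A.
Hypothesis C0 : 0 < C.
Hypothesis c_asymp : forall t, 0 < t ->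
  `|psum c (expR (- t)) - (A / t + beta * ln t + kappa)| <= C * t.

(** Up to the sign (-1)^p, the derivative of order p of log F(e^-t) in t. *)
Definition cumulant (p : nat) (t : R) : R :=
  psum (fun n => n%:R ^+ p * c n) (expR (- t)).

Lemma subexp_cumulant p : subexp (fun n => n%:R ^+ p * c n).
Proof.
elim: p => [|p IH].
  by rewrite (_ : (fun n => _) = c) //; apply/funext => n; rewrite mul1r.
rewrite (_ : (fun n => _) = (fun n => n%:R * (n%:R ^+ p * c n))); last first.
  by apply/funext => n; rewrite exprS mulrA.
exact: subexp_mul_nat.
Qed.

Lemma cvg_cumulant p t : 0 < t ->
  (\sum_(0 <= n < N) n%:R ^+ p * c n * expR (- (n%:R * t))) @[N --> \oo] --> cumulant p t.
Proof.
move=> t0; have e N : \sum_(0 <= n < N) n%:R ^+ p * c n * expR (- (n%:R * t)) =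
    \sum_(0 <= n < N) n%:R ^+ p * c n * expR (- t) ^+ n.
  by apply: eq_bigr => i _; rewrite -expRM_natl mulrN.
by rewrite (funext e); exact: cvg_psum (subexp_cumulant p) (expRN_lt1 t0).
Qed.

Lemma cumulant0 t : cumulant 0 t = psum c (expR (- t)).
Proof.
by rewrite /cumulant (_ : (fun n => _) = c) //; apply/funext => n; rewrite mul1r.
Qed.

Lemma cumulant_ge0 p t : 0 < t -> 0 <= cumulant p t.
Proof.
move=> t0; have c0 : (fun _ : nat => 0 : R) @ \oo --> (0 : R) by exact: cvg_cst.
have c1 := @cvg_cumulant p t t0.
apply: (ler_cvg_to c0 c1); near=> N; apply: sumr_ge0 => n _.
by rewrite !mulr_ge0 ?exprn_ge0 ?expR_ge0.
Unshelve. all: by end_near. Qed.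

(** Termwise exp(nh) >= 1 + nh. With the bound on the right it encloses the derivative between
    difference quotients, so asymptotics pass to the next order although error terms cannot be
    differentiated. *)
Lemma cumulant_convex_left p t h : 0 <= h < t ->
  h * cumulant p.+1 t <= cumulant p (t - h) - cumulant p t.
Proof.
case/andP=> h0 ht; have t0 : 0 < t by exact: le_lt_trans ht.
have th : 0 < t - h by rewrite subr_gt0.
have c1 : h * (\sum_(0 <= n < N) n%:R ^+ p.+1 * c n * expR (- (n%:R * t))) @[N --> \oo] -->
  h * cumulant p.+1 t by apply: cvgMl_tmp; exact: cvg_cumulant.
have c2 : \sum_(0 <= n < N) n%:R ^+ p * c n * expR (- (n%:R * (t - h))) - \sum_(0 <= n < N) n%:R ^+ p * c n * expR (- (n%:R * t)) @[N --> \oo] -->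
    cumulant p (t - h) - cumulant p t by apply: cvgB; exact: cvg_cumulant.
apply: (ler_cvg_to c1 c2); near=> N.
rewrite -sumrB mulr_sumr; apply: ler_sum => n _.
have -> : - (n%:R * (t - h)) = n%:R * h + - (n%:R * t) by ring.
rewrite expRD; have ex := expR_ge1Dx (n%:R * h).
have q : 0 <= n%:R ^+ p * c n * expR (- (n%:R * t)) by rewrite !mulr_ge0 ?exprn_ge0 ?expR_ge0.
rewrite exprS; have := ler_wpM2l q ex; lra.
Unshelve. all: by end_near. Qed.

Lemma cumulant_convex_right p t h : 0 < t -> 0 <= h ->
  cumulant p t - cumulant p (t + h) <= h * cumulant p.+1 t.
Proof.
move=> t0 h0; have th : 0 < t + h by rewrite ltr_pwDl.
have c1 : h * (\sum_(0 <= n < N) n%:R ^+ p.+1 * c n * expR (- (n%:R * t))) @[N --> \oo] -->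
  h * cumulant p.+1 t by apply: cvgMl_tmp; exact: cvg_cumulant.
have c2 : \sum_(0 <= n < N) n%:R ^+ p * c n * expR (- (n%:R * t)) - \sum_(0 <= n < N) n%:R ^+ p * c n * expR (- (n%:R * (t + h))) @[N --> \oo] -->
    cumulant p t - cumulant p (t + h) by apply: cvgB; exact: cvg_cumulant.
apply: (ler_cvg_to c2 c1); near=> N.
rewrite -sumrB mulr_sumr; apply: ler_sum => n _.
have -> : - (n%:R * (t + h)) = - (n%:R * h) + - (n%:R * t) by ring.
rewrite expRD; have ex := expR_ge1Dx (- (n%:R * h)).
have q : 0 <= n%:R ^+ p * c n * expR (- (n%:R * t)) by rewrite !mulr_ge0 ?exprn_ge0 ?expR_ge0.
rewrite exprS; have := ler_wpM2l q ex; lra.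
Unshelve. all: by end_near. Qed.

Lemma cumulant1_asymp : exists2 K, 0 < K & forall t, 0 < t <= 2^-1 ->
  `|cumulant 1 t - A / t ^+ 2| <= K / t.
Proof.
exists (2 * A + 2 * `|beta| + 3 * C).
  by rewrite ltr_pwDr ?mulr_gt0 // addr_ge0 // mulr_ge0 // ltW.
move=> t /andP[t0 t2]; have b0 := normr_ge0 beta.
(* The step h = t^2 balances the given error O(t) / h against the curvature term of size h / t^3;
   both become O(1 / t). *)
have h0 : 0 < t ^+ 2 by rewrite exprn_gt0.
have ht : t ^+ 2 < t by rewrite expr2 gtr_pMr //; lra.
have tm : 0 < t - t ^+ 2 by lra.
have tp : 0 < t + t ^+ 2 by lra.
have := @cumulant_convex_left 0 t (t ^+ 2) ltac:(by rewrite (ltW h0)).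
have := cumulant_convex_right 0 t0 (ltW h0).
rewrite !cumulant0.
have := c_asymp t0; have := c_asymp tm; have := c_asymp tp.
rewrite (_ : t - t ^+ 2 = t * (1 - t)); last by ring.
rewrite (_ : t + t ^+ 2 = t * (1 + t)); last by ring.
rewrite !lnM ?posrE //; try lra.
set m := cumulant 1 t; set P := psum c _; set Pm := psum c _; set Pp := psum c _.
have l1 : ln (1 + t) <= t by apply: le_ln1Dx; lra.
have l2 : 0 <= ln (1 + t) by rewrite ln_ge0 //; lra.
have l3 : ln (1 - t) <= 0 by rewrite ln_le0 //; lra.
have l4 : - (2 * t) <= ln (1 - t).
  have := @ln1D_ge R (- t) ltac:(lra); apply: le_trans.
  by rewrite ler_pdivlMr; [nra | lra].
have lb1 : `|beta * ln (1 + t)| <= 2 * `|beta| * t by rewrite normrM (ger0_norm l2); nra.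
have lb2 : `|beta * ln (1 - t)| <= 2 * `|beta| * t.
  by rewrite normrM (ler0_norm l3); nra.
move: lb1 lb2; rewrite ![beta * (_ + _)]mulrDr !ler_norml.
move: (beta * ln (1 + t)) (beta * ln (1 - t)) (beta * ln t) => u v w.
move=> /andP[u1 u2] /andP[v1 v2] /andP[p1 p2] /andP[m1 m2] /andP[q1 q2] r1 r2.
have E1 : A / (t * (1 - t)) <= A / t + A + 2 * A * t.
  rewrite ler_pdivrMr ?mulr_gt0 //; last by lra.
  have -> : (A / t + A + 2 * A * t) * (t * (1 - t)) = A + A * t ^+ 2 * (1 - 2 * t).
    by field; rewrite gt_eqF.
  by rewrite lerDl mulr_ge0 ?mulr_ge0 ?(ltW A0) ?(ltW h0) //; lra.
have E2 : A / (t * (1 + t)) <= A / t - A + A * t.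
  rewrite ler_pdivrMr ?mulr_gt0 //; last by lra.
  have -> : (A / t - A + A * t) * (t * (1 + t)) = A + A * t ^+ 3 by field; rewrite gt_eqF.
  by rewrite lerDl mulr_ge0 ?exprn_ge0 // ltW.
have it : 0 < t^-1 by rewrite invr_gt0.
have E3 : (2 * A + 2 * `|beta| + 3 * C) / t * t ^+ 2 = (2 * A + 2 * `|beta| + 3 * C) * t.
  by field; rewrite gt_eqF.
have E4 : A / t ^+ 2 * t ^+ 2 = A by rewrite divfK // gt_eqF.
have Ct : C * (t * (1 - t)) <= C * t by rewrite ler_pM2l //; nra.
have Ct2 : C * (t * (1 + t)) <= 2 * C * t by nra.
have At : 0 <= A * t by rewrite mulr_ge0 // ltW.
have Ct0 : 0 <= C * t by rewrite mulr_ge0 // ltW.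
by apply/andP; split; rewrite -(ler_pM2r h0) mulrBl ?mulNr E3 E4 (mulrC m); lra.
Qed.

Lemma cumulant2_asymp : exists2 K, 0 < K & forall t, 0 < t <= 4^-1 ->
  `|t ^+ 3 * cumulant 2 t - 2 * A| <= K * Num.sqrt t.
Proof.
have [K K0 HK] := cumulant1_asymp.
exists (16 * A + 4 * K); first by rewrite addr_gt0 // mulr_gt0.
move=> t /andP[t0 t4]; set s := Num.sqrt t.
have s0 : 0 < s by rewrite sqrtr_gt0.
have ts : t = s ^+ 2 by rewrite sqr_sqrtr // ltW.
have s2 : s <= 2^-1.
  have : s ^+ 2 <= 2^-1 ^+ 2 by rewrite -ts exprVn -natrX.
  by rewrite ler_sqr // nnegrE ?invr_ge0 // ltW.
(* Here the step is h = t^(3/2): the error O(1 / t) / h and the curvature term h / t^4 are both of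
   order t^(-5/2). *)
have h0 : 0 < s ^+ 3 by rewrite exprn_gt0.
have ht : s ^+ 3 < t by rewrite ts exprS gtr_pMl ?exprn_gt0 //; lra.
have := @cumulant_convex_left 1 t (s ^+ 3) ltac:(by rewrite (ltW h0)).
have := cumulant_convex_right 1 t0 (ltW h0).
have t2 : 0 < t <= 2^-1 by rewrite t0 /=; lra.
have tm : 0 < t - s ^+ 3 <= 2^-1 by apply/andP; split; lra.
have tp : 0 < t + s ^+ 3 <= 2^-1.
  apply/andP; split; first by rewrite addr_gt0.
  have : s ^+ 3 <= t * 2^-1 by rewrite ts exprSr ler_pM2l ?exprn_gt0.
  by lra.
have := HK _ t2; have := HK _ tm; have := HK _ tp.
rewrite (_ : t - s ^+ 3 = s ^+ 2 * (1 - s)); last by rewrite ts; ring.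
rewrite (_ : t + s ^+ 3 = s ^+ 2 * (1 + s)); last by rewrite ts; ring.
move: (cumulant 1 _) (cumulant 1 _) (cumulant 1 t) (cumulant 2 t).
rewrite ts => Pm Pp P m; rewrite !ler_norml.
move=> /andP[p1 p2] /andP[m1 m2] /andP[q1 q2] r1 r2.
have is0 : 0 < s^-1 by rewrite invr_gt0.
have i2 : 0 < s ^- 2 by rewrite invr_gt0 exprn_gt0.
have As : 0 < A / s ^+ 4 by rewrite divr_gt0 // exprn_gt0.
have a1 : A / (s ^+ 2 * (1 - s)) ^+ 2 <= A / s ^+ 4 * (1 + 2 * s + 12 * s ^+ 2).
  have -> : A / (s ^+ 2 * (1 - s)) ^+ 2 = A / s ^+ 4 * (1 - s) ^- 2.
    by field; rewrite !gt_eqF //; lra.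
  have p1s : 0 < (1 - s) ^+ 2 by rewrite exprn_gt0 //; lra.
  rewrite ler_pM2l // -[_ ^- 2]div1r ler_pdivrMr //.
  have -> : (1 + 2 * s + 12 * s ^+ 2) * (1 - s) ^+ 2 = 1 + s ^+ 2 * (9 - 22 * s + 12 * s ^+ 2) by ring.
  rewrite lerDl mulr_ge0 ?exprn_ge0 ?(ltW s0) //; nra.
have a2 : A / (s ^+ 2 * (1 + s)) ^+ 2 <= A / s ^+ 4 * (1 - 2 * s + 4 * s ^+ 2).
  have -> : A / (s ^+ 2 * (1 + s)) ^+ 2 = A / s ^+ 4 * (1 + s) ^- 2.
    by field; rewrite !gt_eqF //; lra.
  have p1s : 0 < (1 + s) ^+ 2 by rewrite exprn_gt0 //; lra.
  rewrite ler_pM2l // -[_ ^- 2]div1r ler_pdivrMr //.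
  have -> : (1 - 2 * s + 4 * s ^+ 2) * (1 + s) ^+ 2 = 1 + s ^+ 2 * (1 + 6 * s + 4 * s ^+ 2) by ring.
  by rewrite lerDl mulr_ge0 ?exprn_ge0 ?(ltW s0) //; nra.
have a3 : K / (s ^+ 2 * (1 - s)) <= 2 * K / s ^+ 2.
  have -> : 2 * K / s ^+ 2 = K / (s ^+ 2 * 2^-1) by field; rewrite gt_eqF.
  by rewrite ler_pM2l // lef_pV2 ?posrE ?mulr_gt0 ?exprn_gt0 ?ler_pM2l ?exprn_gt0 //; lra.
have a4 : K / (s ^+ 2 * (1 + s)) <= K / s ^+ 2.
  by rewrite ler_pM2l // lef_pV2 ?posrE ?mulr_gt0 ?exprn_gt0 ?ler_peMr //; lra.
have e4 : A / s ^+ 2 ^+ 2 = A / s ^+ 4 by rewrite -exprM.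
rewrite e4 in q1 q2.
have up : Pm - P <= A / s ^+ 4 * (2 * s + 12 * s ^+ 2) + 3 * K / s ^+ 2 by lra.
have lo : A / s ^+ 4 * (2 * s - 4 * s ^+ 2) - 2 * K / s ^+ 2 <= P - Pp by lra.
have up' := ler_wpM2l (ltW h0) (le_trans r2 up).
have lo' := ler_wpM2l (ltW h0) (le_trans lo r1).
have eu : s ^+ 3 * (A / s ^+ 4 * (2 * s + 12 * s ^+ 2) + 3 * K / s ^+ 2) =
    2 * A + 12 * A * s + 3 * K * s by field; rewrite gt_eqF.
have el : s ^+ 3 * (A / s ^+ 4 * (2 * s - 4 * s ^+ 2) - 2 * K / s ^+ 2) =
    2 * A - 4 * A * s - 2 * K * s by field; rewrite gt_eqF.
rewrite eu in up'; rewrite el in lo'.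
have -> : s ^+ 2 ^+ 3 * m = s ^+ 3 * (s ^+ 3 * m) by ring.
have As0 : 0 < A * s by rewrite mulr_gt0.
have Ks0 : 0 < K * s by rewrite mulr_gt0.
apply/andP; split; lra.
Qed.

(** An upper bound is enough for the Taylor remainders. It uses n^3 exp(-nt / 2) <= 48 / t^3, where
    48 = 3! 2^3, and the size 1 / t of log F at e^(-t/2). *)
Lemma cumulant3_bound : exists2 K, 0 < K & forall t, 0 < t <= 1 ->
  t ^+ 4 * cumulant 3 t <= K.
Proof.
exists (48 * (2 * A + 2 * `|beta| + `|kappa| + C)).
  by rewrite mulr_gt0 // ltr_pwDr // !addr_ge0 ?mulr_ge0 // ltW.
move=> t /andP[t0 t1]; have t2 : 0 < t / 2 by rewrite divr_gt0.
have le1 : t ^+ 3 * cumulant 3 t <= 48 * cumulant 0 (t / 2).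
  have c1 : t ^+ 3 * (\sum_(0 <= n < N) n%:R ^+ 3 * c n * expR (- (n%:R * t))) @[N --> \oo] -->
     t ^+ 3 * cumulant 3 t by apply: cvgMl_tmp; exact: cvg_cumulant.
  have c2 : 48 * (\sum_(0 <= n < N) n%:R ^+ 0 * c n * expR (- (n%:R * (t / 2)))) @[N --> \oo] -->
     48 * cumulant 0 (t / 2) by apply: cvgMl_tmp; exact: cvg_cumulant.
  apply: (ler_cvg_to c1 c2); near=> N; rewrite !mulr_sumr; apply: ler_sum => n _.
  case: n => [|n]; first by rewrite expr0n !mul0r mulr0 !mulr_ge0 ?expR_ge0.
  have nt : 0 < n.+1%:R * (t / 2) by rewrite mulr_gt0.
  have := expRN_le 3 nt; rewrite expr0 mul1r.
  have -> : - (n.+1%:R * t) = - (n.+1%:R * (t / 2)) + - (n.+1%:R * (t / 2)) by field.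
  rewrite expRD; have e0 := expR_ge0 (- (n.+1%:R * (t / 2))).
  move: e0 (c_ge0 n.+1); rewrite ler_pdivlMr ?exprn_gt0 //.
  have -> : 3`! = 6%N by [].
  move: (expR _) => e; move: (c _) => d; move: (n.+1%:R : R) => m e0 d0 H.
  have q : 0 <= d * e by rewrite mulr_ge0.
  have := ler_wpM2l q H.
  have -> : d * e * (e * (m * (t / 2)) ^+ 3) = d * e * e * m ^+ 3 * t ^+ 3 / 8 by field.
  lra.
have := c_asymp t2; rewrite cumulant0 in le1; move: le1; set P := psum _ _ => le1.
rewrite ler_norml => /andP[_ hi].
have lt0 : ln (t / 2) <= 0 by rewrite ln_le0 //; lra.
have lt1 : - ln (t / 2) <= 2 / t.
  by rewrite -lnV ?posrE // invf_div ltW // ln_sublinear // divr_gt0.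
have b1 : beta * ln (t / 2) <= `|beta| * (2 / t).
  apply: le_trans (ler_norm _) _; rewrite normrM (ler0_norm lt0) ler_wpM2l //.
have k1 := ler_norm kappa.
have A2 : A / (t / 2) = 2 * A / t by field; rewrite gt_eqF.
rewrite exprS -mulrA.
have h1 : t * (t ^+ 3 * cumulant 3 t) <= t * (48 * P) by rewrite ler_pM2l.
apply: le_trans h1 _.
have h2 : P <= 2 * A / t + `|beta| * (2 / t) + `|kappa| + C * (t / 2) by lra.
have h3 := ler_wpM2l (ltW t0) h2.
have E : t * (2 * A / t + `|beta| * (2 / t) + `|kappa| + C * (t / 2)) =
   2 * A + 2 * `|beta| + `|kappa| * t + C * t ^+ 2 / 2 by field; rewrite gt_eqF.
rewrite E in h3.
have h4 : `|kappa| * t <= `|kappa| by rewrite ler_piMr.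
have h5 : C * t ^+ 2 <= C by rewrite ler_piMr ?(ltW C0) // exprn_ile1 // ltW.
rewrite mulrCA ler_pM2l //; apply: le_trans h3 _.
by rewrite lerD // ?lerD //; move: h5 C0; lra.
Unshelve. all: by end_near. Qed.

End Cumulants.

(** * Local limit theorem for the coefficients *)

Section ExponentialTransform.

Variable R : realType.

(* Real and imaginary parts of the coefficients of [f] along [q = x e^(i th)]. *)
Definition cos_part (f : R^nat) (th : R) : R^nat := fun n => f n * cos (n%:R * th).
Definition sin_part (f : R^nat) (th : R) : R^nat := fun n => f n * sin (n%:R * th).

Lemma subexp_cos_part f th : subexp f -> subexp (cos_part f th).
Proof. by move=> fe; apply: subexpM_bounded => // n; rewrite ler_norml cos_geN1 cos_le1. Qed.

Lemma subexp_sin_part f th : subexp f -> subexp (sin_part f th).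
Proof. by move=> fe; apply: subexpM_bounded => // n; rewrite ler_norml sin_geN1 sin_le1. Qed.

Variables (a c : R^nat).
Hypothesis a0 : a 0%N = 1.
Hypothesis c00 : c 0%N = 0.
Hypothesis c_ge0 : forall n, 0 <= c n.
Hypothesis ce : subexp c.
Hypothesis a_rec : forall n,
  n%:R * a n = \sum_(i < n.+1) i%:R * c i * a (n - i)%N.

Lemma exp_coef_rec n :
  n.+1%:R * a n.+1 = \sum_(i < n.+1) i.+1%:R * c i.+1 * a (n - i)%N.
Proof. by rewrite a_rec big_ord_recl !mul0r add0r; apply: eq_bigr. Qed.

Lemma exp_coef_ge0 n : 0 <= a n.
Proof.
elim/ltn_ind: n => -[|n] IH; first by rewrite a0.
rewrite -(pmulr_rge0 _ (ltr0Sn R n)) exp_coef_rec.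
by apply: sumr_ge0 => i _; rewrite !mulr_ge0 // IH // ltnS leq_subr.
Qed.

(** By the recurrence, (n + 1) a_(n+1) y^(n+1) is at most S times a bound for the earlier terms, S
    being the sum of n c_n y^n. Once n + 1 >= S that bound no longer grows. *)
Lemma subexp_exp_coef : subexp a.
Proof.
split=> y /[dup] yy /andP[y0 y1].
have y1' : `|y| < 1 by rewrite gtr0_norm.
pose f n := n%:R * c n; have fe : subexp f by exact: subexp_mul_nat.
have f0 n : 0 <= f n by rewrite mulr_ge0.
pose S := psum f y.
have HS n : \sum_(0 <= i < n) f i * y ^+ i <= S.
  apply: nondecreasing_cvgn_le; last exact: is_cvg_psum.
  by apply/nondecreasing_seqP => m; rewrite /pseries /series /= big_nat_recr //= lerDl mulr_ge0 ?exprn_ge0 // ltW.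
have [N0 HN0] : exists N, S <= N%:R.
  by exists (Num.trunc S).+1; apply/ltW/truncnS_gt.
pose B := 1 + \sum_(i < N0) a i * y ^+ i.
have ay n : 0 <= a n * y ^+ n by rewrite mulr_ge0 ?exp_coef_ge0 ?exprn_ge0 // ltW.
have B0 : 0 < B by rewrite ltr_pwDl // sumr_ge0.
exists B => // n; rewrite ger0_norm ?exp_coef_ge0 //.
elim/ltn_ind: n => n IH; have [nN|nN] := ltnP n N0.
  by rewrite /B (bigD1 (Ordinal nN)) //= addrCA lerDl addr_ge0 // sumr_ge0.
case: n nN IH => [|n] nN IH.
  by rewrite a0 mul1r expr0 /B lerDl sumr_ge0.
rewrite -(ler_pM2l (ltr0Sn R n)) mulrA exp_coef_rec mulr_suml.
apply: (@le_trans _ _ (S * B)); last first.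
  by rewrite ler_pM2r // (le_trans HN0) // ler_nat.
apply: (@le_trans _ _ (\sum_(i < n.+1) f i.+1 * y ^+ i.+1 * B)).
  apply: ler_sum => i _; have iN : (i <= n)%N by rewrite -ltnS ltn_ord.
  have -> : i.+1%:R * c i.+1 * a (n - i)%N * y ^+ n.+1 =
     f i.+1 * y ^+ i.+1 * (a (n - i)%N * y ^+ (n - i)).
    by rewrite /f (_ : y ^+ n.+1 = y ^+ i.+1 * y ^+ (n - i)); [ring | rewrite -exprD addSn subnKC].
  by rewrite ler_wpM2l ?mulr_ge0 ?exprn_ge0 ?(ltW y0) // IH // ltnS leq_subr.
rewrite -mulr_suml ler_pM2r //; apply: le_trans (HS n.+2).
rewrite big_nat_recl //= /f !mul0r add0r big_mkord //.
Qed.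

Lemma psum_cauchy_prod_sub (f g f' g' h : R^nat) x :
  subexp f -> subexp g -> subexp f' -> subexp g' -> `|x| < 1 ->
  (forall n, h n = cauchy_prod f g n - cauchy_prod f' g' n) ->
  psum h x = psum f x * psum g x - psum f' x * psum g' x.
Proof.
move=> fe ge fe' ge' x1 hE; apply: psum_eq.
have e n : \sum_(0 <= i < n) h i * x ^+ i =
  \sum_(0 <= i < n) cauchy_prod f g i * x ^+ i - \sum_(0 <= i < n) cauchy_prod f' g' i * x ^+ i.
  by rewrite -sumrB; apply: eq_bigr => i _; rewrite hE mulrBl.
by rewrite (funext e); apply: cvgB; exact: psumM.
Qed.

Variable th : R.
Let A := psum (cos_part a th).
Let B := psum (sin_part a th).
Let C := psum (cos_part c th).
Let D := psum (sin_part c th).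
Let dC := psum (pseries_diffs (cos_part c th)).
Let dD := psum (pseries_diffs (sin_part c th)).

Lemma exp_coef_cos_diffs n : pseries_diffs (cos_part a th) n =
  cauchy_prod (pseries_diffs (cos_part c th)) (cos_part a th) n -
  cauchy_prod (pseries_diffs (sin_part c th)) (sin_part a th) n.
Proof.
rewrite /pseries_diffs /cos_part /sin_part /cauchy_prod mulrA exp_coef_rec mulr_suml -sumrB.
apply: eq_bigr => i _; have iN : (i <= n)%N by rewrite -ltnS ltn_ord.
have -> : n.+1%:R * th = i.+1%:R * th + (n - i)%:R * th.
  by rewrite -mulrDl -natrD addSn subnKC.
by rewrite cosD; ring.
Qed.

Lemma exp_coef_sin_diffs n : pseries_diffs (sin_part a th) n =
  cauchy_prod (pseries_diffs (sin_part c th)) (cos_part a th) n -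
  cauchy_prod (pseries_diffs (cos_part c th)) (fun n => - sin_part a th n) n.
Proof.
rewrite /pseries_diffs /cos_part /sin_part /cauchy_prod mulrA exp_coef_rec mulr_suml -sumrB.
apply: eq_bigr => i _; have iN : (i <= n)%N by rewrite -ltnS ltn_ord.
have -> : n.+1%:R * th = i.+1%:R * th + (n - i)%:R * th.
  by rewrite -mulrDl -natrD addSn subnKC.
by rewrite sinD; ring.
Qed.

(** The identity F = exp(log F) at x e^(i th), obtained by a differential equation in x for fixed
    [th]: [G1] and [G2] are the real and imaginary parts of (A + iB) exp(-(C + iD)) and have
    derivative 0. *)
Lemma psum_exp_coef x : 0 <= x < 1 ->
  A x = expR (C x) * cos (D x) /\ B x = expR (C x) * sin (D x).
Proof.
case/andP=> x0 x1; have ae := subexp_exp_coef.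
have Ae := subexp_cos_part th ae; have Be := subexp_sin_part th ae.
have Ce := subexp_cos_part th ce; have De := subexp_sin_part th ce.
have dom y : 0 <= y <= x -> `|y| < 1.
  by case/andP=> y0 yx; rewrite ger0_norm // (le_lt_trans yx).
have dCy y : 0 <= y <= x -> is_derive y 1 C (dC y) by move/dom => y1; exact: is_derive_psum.
have dDy y : 0 <= y <= x -> is_derive y 1 D (dD y) by move/dom => y1; exact: is_derive_psum.
have dAy y : 0 <= y <= x -> is_derive y 1 A (dC y * A y - dD y * B y).
  move/dom => y1; apply: (is_derive1_eq (is_derive_psum Ae y1)).
  apply: psum_cauchy_prod_sub => //; try exact: subexp_diffs.
  exact: exp_coef_cos_diffs.
have dBy y : 0 <= y <= x -> is_derive y 1 B (dD y * A y + dC y * B y).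
  move/dom => y1; apply: (is_derive1_eq (is_derive_psum Be y1)).
  have eN : (fun n => - sin_part a th n) = (fun n => - 1 * sin_part a th n).
    by apply/funext => n; rewrite mulN1r.
  rewrite (psum_cauchy_prod_sub _ _ _ _ y1 exp_coef_sin_diffs) //; try exact: subexp_diffs.
    by rewrite eN psumZ // mulN1r mulrN opprK.
  by rewrite eN; exact: subexpZ.
have const f df : derive_on f df 0 x -> (forall y, 0 <= y <= x -> df y = 0) -> f x = f 0.
  move=> fd df0; move: x0; rewrite le_eqVlt => /predU1P[<- //|xp].
  have [z /andP[z0 zx] E] := mean_value xp fd; apply/eqP; rewrite -subr_eq0 E.
  by rewrite df0 ?mul0r // !ltW.
have A0 : A 0 = 1 by rewrite /A psum_nth0 // /cos_part a0 !mul0r cos0 mulr1.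
have B0 : B 0 = 0 by rewrite /B psum_nth0 // /sin_part !mul0r sin0 mulr0.
have C0 : C 0 = 0 by rewrite /C psum_nth0 // /cos_part c00 mul0r.
have D0 : D 0 = 0 by rewrite /D psum_nth0 // /sin_part c00 mul0r.
pose G1 y := expR (- C y) * (A y * cos (D y) + B y * sin (D y)).
pose G2 y := expR (- C y) * (B y * cos (D y) - A y * sin (D y)).
have E1 : G1 x = G1 0.
  apply: (const G1 (fun=> 0)) => // y yx.
  have := dAy y yx; have := dBy y yx; have := dCy y yx; have := dDy y yx.
  move: (dC y) (dD y) => dc dd H1 H2 H3 H4; rewrite /G1.
  der; first exact: H2.
  - exact: H4.
  - exact: H1.
  - exact: H3.
  - exact: H1.
  by ring.
have E2 : G2 x = G2 0.
  apply: (const G2 (fun=> 0)) => // y yx.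
  have := dAy y yx; have := dBy y yx; have := dCy y yx; have := dDy y yx.
  move: (dC y) (dD y) => dc dd H1 H2 H3 H4; rewrite /G2.
  der; first exact: H2.
  - exact: H3.
  - exact: H1.
  - exact: H4.
  - exact: H1.
  by ring.
move: E1 E2; rewrite /G1 /G2 A0 B0 C0 D0 oppr0 expR0 cos0 sin0.
rewrite !mul0r mulr0 addr0 subr0 !mul1r.
have e0 := expR_gt0 (C x); have ei : expR (C x) * expR (- C x) = 1 by rewrite -expRD subrr expR0.
have cs := cos2Dsin2 (D x).
move: (A x) (B x) (cos (D x)) (sin (D x)) e0 ei cs => u v p q.
move: (expR (C x)) (expR (- C x)) => e e' e0 ei cs.
move=> E1 E2.
have F1 : u * p + v * q = e by rewrite -[LHS]mul1r -ei -mulrA E1 mulr1.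
have F2 : v * p - u * q = 0 by rewrite -[LHS]mul1r -ei -mulrA E2 mulr0.
split.
  rewrite -F1 -[LHS]mulr1 -cs.
  have -> : (u * p + v * q) * p = u * (p ^+ 2 + q ^+ 2) + q * (v * p - u * q) by ring.
  by rewrite F2 mulr0 addr0.
rewrite -F1 -[LHS]mulr1 -cs.
have -> : (u * p + v * q) * q = v * (p ^+ 2 + q ^+ 2) - p * (v * p - u * q) by ring.
by rewrite F2 mulr0 subr0.
Qed.

End ExponentialTransform.

(** * Differences of coefficients as Fourier integrals *)

Section Fourier.

Variable R : realType.
Let mu := @lebesgue_measure R.

Fixpoint fdiff (p : nat) (f : R^nat) (N : nat) : R :=
  if p is p'.+1 then fdiff p' f N.+1 - fdiff p' f N else f N.

Lemma sin_natmul_pi n : sin (n%:R * pi) = 0 :> R.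
Proof. by elim: n => [|n IH]; rewrite ?mul0r ?sin0 // mulrSr mulrDl mul1r sinDpi IH oppr0. Qed.

Definition harmonic_prim (s : R) (m N : nat) (u : R) : R :=
  if m == N then u else sin ((m%:R - N%:R) * (s * u)) / ((m%:R - N%:R) * s).

Lemma is_derive_harmonic_prim (s : R) m N (u : R) : s != 0 ->
  is_derive u 1 (harmonic_prim s m N) (cos ((m%:R - N%:R) * (s * u))).
Proof.
move=> s0; rewrite /harmonic_prim; case: eqVneq => [->|mN].
  by rewrite subrr mul0r cos0; exact: is_derive1_id.
have d0 : m%:R - N%:R != 0 :> R by rewrite subr_eq0 eqr_nat.
move: (m%:R - N%:R : R) d0 => d d0.
der.
by field; apply/andP; split.
Qed.

Lemma harmonic_prim_pi (s : R) m N : s != 0 ->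
  harmonic_prim s m N (pi / s) - harmonic_prim s m N (- (pi / s)) =
  if m == N then 2 * pi / s else 0.
Proof.
move=> s0; rewrite /harmonic_prim; case: eqVneq => [_|mN]; first by lra.
rewrite mulrN [s * _]mulrC divfK // mulrN sinN.
by rewrite mulrBl sinB !sin_natmul_pi mul0r mulr0 subrr oppr0 !mul0r subrr.
Qed.

Lemma is_derive1_sum (F f : nat -> R -> R) (x : R) n :
  (forall i, is_derive x 1 (F i) (f i x)) ->
  is_derive x 1 (fun y => \sum_(0 <= i < n) F i y) (\sum_(0 <= i < n) f i x).
Proof.
move=> Ff; elim: n => [|n IH].
  by rewrite big_nil; under eq_fun do rewrite big_nil; exact: is_derive1_cst.
rewrite big_nat_recr //=; under eq_fun do rewrite big_nat_recr //=.
exact: is_derive1D.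
Qed.

Lemma continuous_derive (F f : R -> R) : (forall x : R, is_derive x (1 : R) F (f x)) -> continuous F.
Proof. by move=> Ff x; have [/derivable1_diffP/differentiable_continuous] := Ff x. Qed.

Variables (a : R^nat) (x : R).
Hypothesis ae : subexp a.
Hypothesis a_ge0 : forall n, 0 <= a n.
Hypothesis x01 : 0 <= x < 1.

Let x_lt1 : `|x| < 1. Proof. by case/andP: x01 => x0 x1; rewrite ger0_norm. Qed.
Let ax_ge0 n : 0 <= a n * x ^+ n.
Proof. by case/andP: x01 => x0 _; rewrite mulr_ge0 // exprn_ge0. Qed.

Variable s : R.
Hypothesis s0 : 0 < s.

Let I : set R := `[- (pi / s), pi / s]%classic.

Let mI : measurable I. Proof. exact: measurable_itv. Qed.

(** The angle is already written as s u: with s the saddle width, the interval of integration will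
    exhaust the line. *)
Lemma fourier_coef N :
  let f u := psum (cos_part a (s * u)) x * cos (N%:R * (s * u)) +
             psum (sin_part a (s * u)) x * sin (N%:R * (s * u)) in
  mu.-integrable I (EFin \o f) /\ \int[mu]_(u in I) f u = 2 * pi / s * (a N * x ^+ N).
Proof.
move=> f.
have sn : s != 0 by rewrite gt_eqF.
pose g n u := \sum_(0 <= m < n) a m * x ^+ m * cos ((m%:R - N%:R) * (s * u)).
pose G n u := \sum_(0 <= m < n) a m * x ^+ m * harmonic_prim s m N u.
have gf u : g n u @[n --> \oo] --> f u.
  have e n : g n u = (\sum_(0 <= m < n) cos_part a (s * u) m * x ^+ m) * cos (N%:R * (s * u)) +
     (\sum_(0 <= m < n) sin_part a (s * u) m * x ^+ m) * sin (N%:R * (s * u)).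
    rewrite !mulr_suml -big_split /=; apply: eq_bigr => m _.
    by rewrite mulrBl cosB /cos_part /sin_part; ring.
  rewrite (funext e); apply: cvgD; apply: cvgMr_tmp; apply: cvg_psum => //.
    exact: subexp_cos_part.
  exact: subexp_sin_part.
have dG n u : is_derive u (1 : R) (G n) (g n u).
  have H m : is_derive u (1 : R) (fun u => a m * x ^+ m * harmonic_prim s m N u)
      (a m * x ^+ m * cos ((m%:R - N%:R) * (s * u))).
    apply: is_derive1_eq (is_derive1M (is_derive1_cst _ _) (is_derive_harmonic_prim m N u sn)) _.
    by rewrite mul0r add0r.
  exact: (@is_derive1_sum (fun m u => a m * x ^+ m * harmonic_prim s m N u)
    (fun m u => a m * x ^+ m * cos ((m%:R - N%:R) * (s * u))) u n H).
have dg n u : is_derive u (1 : R) (g n)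
    (\sum_(0 <= m < n) a m * x ^+ m * (- ((m%:R - N%:R) * s * sin ((m%:R - N%:R) * (s * u))))).
  have H m : is_derive u (1 : R) (fun u => a m * x ^+ m * cos ((m%:R - N%:R) * (s * u)))
      (a m * x ^+ m * (- ((m%:R - N%:R) * s * sin ((m%:R - N%:R) * (s * u))))).
    by der; ring.
  exact: (@is_derive1_sum (fun m u => a m * x ^+ m * cos ((m%:R - N%:R) * (s * u)))
    (fun m u => a m * x ^+ m * (- ((m%:R - N%:R) * s * sin ((m%:R - N%:R) * (s * u))))) u n H).
have cg n : continuous (g n) by apply: continuous_derive; exact: dg.
have gle n u : `|g n u| <= psum a x.
  apply: le_trans (ler_norm_sum _ _ _) _.
  apply: (@le_trans _ _ (\sum_(0 <= m < n) a m * x ^+ m)).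
    apply: ler_sum => m _; rewrite normrM ger0_norm // ler_piMr //.
    by rewrite ler_norml cos_geN1 cos_le1.
  apply: nondecreasing_cvgn_le; last exact: is_cvg_psum.
  by apply/nondecreasing_seqP => m; rewrite /pseries /series /= big_nat_recr //= lerDl.
have mg n : measurable_fun setT (g n \_ I).
  by apply/(measurable_restrictT _ mI); apply: measurable_funTS; exact: continuous_measurable_fun.
pose F := psum a x; have F0 : 0 <= F by apply: le_trans (gle 0%N 0).
(* On the bounded interval [I] the constant bound [F] lies below K / (1 + u^2). *)
pose K := F * (1 + (pi / s) ^+ 2).
have [||||i1 c1] := @Rintegral_dominated_cvg R (fun n => g n \_ I) (f \_ I) (fun u => K / (1 + u ^+ 2)).
- exact: mg.
- by move=> u; rewrite /patch; case: ifP => _; [exact: gf | exact: cvg_cst].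
- exact: integrable_oneDsqrVZ.
- move=> n u; rewrite /patch; case: ifPn => [|_]; last first.
    rewrite (_ : point = 0 :> R) // normr0 divr_ge0 ?mulr_ge0 ?addr_ge0 ?sqr_ge0 //.
  rewrite inE /I /= in_itv /= -ler_norml => uI.
  apply: le_trans (gle n u) _; rewrite ler_pdivlMr; last by rewrite ltr_wpDr // sqr_ge0.
  rewrite ler_wpM2l // lerD2l -(real_normK (num_real u)).
  by rewrite lerXn2r ?nnegrE // (le_trans _ uI).
split.
  by apply: (@integrable_mkcond _ _ _ mu I (EFin \o f) mI).2; rewrite restrict_EFin.
rewrite Rintegral_mkcond; apply: (cvg_unique (@Rhausdorff R) c1).
apply: cvg_near_cst; near=> n.
have nN : (N < n)%N by near: n; exact: nbhs_infty_gt.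
have ps : 0 < pi / s by rewrite divr_gt0 // pi_gt0.
rewrite -Rintegral_mkcond (FTC_segment _ (dG n) (cg n)); last by rewrite (lt_trans _ ps) // oppr_lt0.
rewrite /G -sumrB; under eq_bigr => m _ do rewrite -mulrBr harmonic_prim_pi //.
rewrite big_mkord (bigD1 (Ordinal nN)) //= eqxx big1 ?addr0 1?mulrC // => i iN.
by rewrite ifF ?mulr0 //; apply: contraNF iN => /eqP iN; apply/eqP/val_inj.
Unshelve. all: by end_near. Qed.

Variable c : R^nat.
Hypothesis a_exp : forall th,
  psum (cos_part a th) x = expR (psum (cos_part c th) x) * cos (psum (sin_part c th) x) /\
  psum (sin_part a th) x = expR (psum (cos_part c th) x) * sin (psum (sin_part c th) x).

(** With v = s u, the real part of F(x e^(iv)) e^(-iNv) (e^(-iv) - 1)^p, since e^(-iv) - 1 = 2 sin(v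
    / 2) e^(-i(v / 2 + pi / 2)). *)
Definition diff_kernel (p N : nat) (u : R) : R :=
  expR (psum (cos_part c (s * u)) x) * (2 * sin (s * u / 2)) ^+ p *
  cos (psum (sin_part c (s * u)) x - (N%:R + p%:R / 2) * (s * u) - p%:R * (pi / 2)).

(* Multiplying by 2 sin(v / 2) and delaying the phase by v / 2 + pi / 2 turns
   cos X into cos (X - v) - cos X. *)
Lemma diff_kernelS p N u :
  diff_kernel p.+1 N u = diff_kernel p N.+1 u - diff_kernel p N u.
Proof.
rewrite /diff_kernel exprS; set e := expR _; set P := _ ^+ p; set D := psum _ _.
have pn : p.+1%:R = p%:R + 1 :> R by rewrite -natr1.
have Nn : N.+1%:R = N%:R + 1 :> R by rewrite -natr1.
set v := s * u; set h := v / 2.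
set X := D - (N%:R + p%:R / 2) * v - p%:R * (pi / 2).
have -> : D - (N%:R + p.+1%:R / 2) * v - p.+1%:R * (pi / 2) = (X - h) - pi / 2.
  by rewrite /X pn /h; move: (pi : R) => y; field.
have -> : D - (N.+1%:R + p%:R / 2) * v - p%:R * (pi / 2) = (X - h) - h.
  by rewrite /X Nn /h; move: (pi : R) => y; field.
have {3}-> : X = (X - h) + h by ring.
by move: (X - h) => Y; rewrite (cosB Y (pi / 2)) (cosB Y h) (cosD Y h) cos_pihalf sin_pihalf; ring.
Qed.

Lemma Rintegral_diff_kernel p N :
  mu.-integrable I (EFin \o diff_kernel p N) /\
  \int[mu]_(u in I) diff_kernel p N u = 2 * pi / s * fdiff p (fun n => a n * x ^+ n) N.
Proof.
elim: p N => [|p IH] N.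
  have [h1 h2] := fourier_coef N.
  have e : (fun u => psum (cos_part a (s * u)) x * cos (N%:R * (s * u)) +
             psum (sin_part a (s * u)) x * sin (N%:R * (s * u))) = diff_kernel 0 N.
    apply/funext => u; have [-> ->] := a_exp (s * u).
    by rewrite /diff_kernel expr0 mulr1 !mul0r addr0 subr0 cosB; ring.
  by rewrite /= -h2; split; [rewrite -e | rewrite -e].
have [i1 e1] := IH N.+1; have [i2 e2] := IH N.
have e : diff_kernel p.+1 N = (fun u => diff_kernel p N.+1 u - diff_kernel p N u).
  by apply/funext => u; exact: diff_kernelS.
rewrite e; split; last by rewrite RintegralB // e1 e2 /= mulrBr.
exact: (integrableB _ i1 i2).
Qed.

End Fourier.

(** * The Poisson kernel bound on the circle *)

Section PoissonKernel.

Variable R : realType.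
Implicit Types (x q th t : R).

Lemma norm_psum_le (f g : R^nat) K x : subexp f -> subexp g -> 0 <= x < 1 ->
  (forall n, `|f n| <= K * g n) -> `|psum f x| <= K * psum g x.
Proof.
move=> fe ge /andP[x0 x1] fg; have x1' : `|x| < 1 by rewrite ger0_norm.
have xn n : 0 <= x ^+ n by rewrite exprn_ge0.
rewrite -psumZ // ler_norml; apply/andP; split; last first.
  apply: ler_psum => //; first exact: subexpZ.
  by move=> n; rewrite ler_wpM2r // (le_trans (ler_norm _)).
rewrite -mulN1r -psumZ //; last exact: subexpZ.
apply: ler_psum => // [|n]; first by apply: subexpZ; exact: subexpZ.
by rewrite ler_wpM2r // mulN1r lerNl (le_trans _ (fg n)) // -normrN ler_norm.
Qed.

Lemma cvg_norm_le0 (u v : R^nat) : (forall n, `|u n| <= v n) ->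
  v @ \oo --> (0 : R) -> u @ \oo --> (0 : R).
Proof.
move=> uv v0; apply/cvgr0Pnorm_le => e e0; near=> n.
apply: le_trans (uv n) _; apply: le_trans (ler_norm _) _.
by near: n; move/cvgr0Pnorm_le: v0; apply.
Unshelve. all: by end_near. Qed.

Lemma continuous_seq_cvg (f : R -> R) (u : R^nat) (l : R) : continuous f ->
  u @ \oo --> l -> f (u n) @[n --> \oo] --> f l.
Proof. by move=> fc ul; exact: (cvg_comp u f ul (fc l)). Qed.

(** The real part of 1 / (1 - q e^(i th)), with its denominator in a form that is visibly positive.
    [T] is the remainder of the geometric sum. *)
Lemma psum_cos q th : 0 <= q < 1 ->
  psum (cos_part (fun=> 1) th) q = (1 - q * cos th) / ((1 - q) ^+ 2 + 2 * q * (1 - cos th)).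
Proof.
move=> /andP[q0 q1]; apply: psum_eq.
have W0 : 0 < (1 - q) ^+ 2 + 2 * q * (1 - cos th).
  by rewrite ltr_pwDl ?mulr_ge0 ?exprn_gt0 ?subr_gt0 // subr_ge0 cos_le1.
set W := (_ + _) in W0 *.
pose T n := q ^+ n * cos (n%:R * th) - q ^+ n.+1 * cos (n%:R * th - th).
have e n : \sum_(0 <= i < n) cos_part (fun=> 1) th i * q ^+ i = ((1 - q * cos th) - T n) / W.
  elim: n => [|n IH].
    by rewrite big_nil /T expr0 expr1 mul0r cos0 sub0r cosN mul1r subrr mul0r.
  rewrite big_nat_recr //= IH; apply: (mulIf (lt0r_neq0 W0)).
  rewrite mulrDl !divfK ?gt_eqF // /T /cos_part mul1r -natr1 mulrDl mul1r addrK.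
  rewrite cosB cosD /W !exprS; ring.
rewrite (funext e); apply: cvgMr_tmp.
rewrite -[X in _ --> X]subr0; apply: cvgB; first exact: cvg_cst.
apply: (@cvg_norm_le0 _ (fun n => 2 * q ^+ n)).
  move=> n; rewrite /T; apply: le_trans (ler_normB _ _) _.
  have c1 m (y : R) : `|q ^+ m * cos y| <= q ^+ m.
    rewrite normrM ger0_norm ?exprn_ge0 // ler_piMr ?exprn_ge0 //.
    by rewrite ler_norml cos_geN1 cos_le1.
  have := c1 n (n%:R * th); have := c1 n.+1 (n%:R * th - th).
  have : q ^+ n.+1 <= q ^+ n by rewrite exprS ler_piMl ?exprn_ge0 // ltW.
  move: (`|_|) (`|_|) => X Y; lra.
rewrite -[X in _ --> X](mulr0 2); apply: cvgMl_tmp.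
by apply: cvg_expr; rewrite ger0_norm.
Qed.

Lemma expRN_ge_half t : 0 <= t <= 2^-1 -> 2^-1 <= expR (- t).
Proof. by case/andP=> t0 t2; apply: le_trans (expR_ge1Dx _); lra. Qed.

Lemma one_subcos_ge th : `|th| <= pi -> th ^+ 2 / 18 <= 1 - cos th.
Proof.
wlog th0 : th / 0 <= th => [hw|].
  have [/hw //|/ltW x0] := leP 0 th.
  by have := hw (- th); rewrite oppr_ge0 cosN sqrrN normrN; exact.
rewrite ger0_norm // => thpi; have p4 := pihalf_lt2 R.
have : th / 2 / 3 <= sin (th / 2) by apply: sin_ge_third; lra.
have -> : cos th = 1 - 2 * sin (th / 2) ^+ 2.
  have {1}-> : th = th / 2 + th / 2 by field.
  by rewrite cosD; have := cos2Dsin2 (th / 2); nra.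
move: (sin _) => s h; have : (th / 2 / 3) ^+ 2 <= s ^+ 2.
  by rewrite ler_sqr ?nnegrE //; lra.
rewrite opprB addrC subrK; lra.
Qed.

(** The constants come from q >= 1/2, hence q (1 + q) >= 3/4, and from 1 - cos th >= th^2 / 18. *)
Lemma psum_cos_sub_le t th : 0 < t <= 2^-1 -> `|th| <= pi ->
  psum (cos_part (fun=> 1) th) (expR (- t)) - psum (fun=> 1) (expR (- t)) <=
  - (3 / 4 * th ^+ 2 / (t * (18 * t ^+ 2 + 2 * th ^+ 2))).
Proof.
move=> /andP[t0 t2] thpi; have qh : 2^-1 <= expR (- t).
  by apply: expRN_ge_half; rewrite (ltW t0).
have q1 := expRN_lt1 t0; have q0 := expR_gt0 (- t).
rewrite ger0_norm ?(ltW q0) // in q1.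
have qt : 1 - expR (- t) <= t by have := expR_ge1Dx (- t); lra.
rewrite psum_cos ?(ltW q0) // psum1 ?ger0_norm ?(ltW q0) //.
have := one_subcos_ge thpi.
move: (expR (- t)) qh q1 q0 qt => q qh q1 q0 qt.
have cE : cos th = 1 - (1 - cos th) by ring.
move: (1 - cos th : R) cE => v -> vge.
have y0 : 0 <= th ^+ 2 by exact: sqr_ge0.
move: (th ^+ 2) y0 vge => y y0 vge.
have v0 : 0 <= v by apply: le_trans vge; rewrite divr_ge0.
have d0 : 0 < 1 - q by lra.
have W0 : 0 < (1 - q) ^+ 2 + 2 * q * v.
  by rewrite ltr_pwDl ?exprn_gt0 // !mulr_ge0 // ltW.
have -> : (1 - q * (1 - v)) / ((1 - q) ^+ 2 + 2 * q * v) - (1 - q)^-1 =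
   - (q * (1 + q) * v / ((1 - q) * ((1 - q) ^+ 2 + 2 * q * v))).
  by field; rewrite !gt_eqF.
rewrite lerN2.
have t20 : 0 < t ^+ 2 by rewrite exprn_gt0.
have z0 : 0 < t * (18 * t ^+ 2 + 2 * y) by rewrite mulr_gt0 // ltr_pwDl ?mulr_gt0 // mulr_ge0.
rewrite ler_pdivrMr // [leRHS]mulrAC ler_pdivlMr; last by rewrite mulr_gt0.
have qq : 3 / 4 <= q * (1 + q) by nra.
have s1 : (1 - q) * ((1 - q) ^+ 2 + 2 * q * v) <= t * (t ^+ 2 + 2 * v).
  apply: ler_pM => //; [exact: ltW | exact: ltW |].
  rewrite lerD //; first by rewrite lerXn2r ?nnegrE // ltW.
  by rewrite ler_wpM2r //; lra.
have s2 : y * (t ^+ 2 + 2 * v) <= v * (18 * t ^+ 2 + 2 * y) by nra.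
have s3 : y * ((1 - q) * ((1 - q) ^+ 2 + 2 * q * v)) <= v * (t * (18 * t ^+ 2 + 2 * y)).
  apply: le_trans (ler_wpM2l y0 s1) _; rewrite mulrCA [leRHS]mulrCA.
  by rewrite ler_pM2l.
rewrite -[leLHS]mulrA -[leRHS]mulrA; apply: ler_pM => //.
by rewrite mulr_ge0 // mulr_ge0 // ltW.
Qed.

End PoissonKernel.

(** * Scaled limits of the differences at the saddle point *)

Section LocalLimit.

Variable R : realType.
Let mu := @lebesgue_measure R.
Variables (a c : R^nat).
Hypothesis a0 : a 0%N = 1.
Hypothesis c00 : c 0%N = 0.
Hypothesis c_ge1 : forall n, (0 < n)%N -> 1 <= c n.
Hypothesis ce : subexp c.
Hypothesis a_rec : forall n,
  n%:R * a n = \sum_(i < n.+1) i%:R * c i * a (n - i)%N.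

Lemma log_weight_ge0 n : 0 <= c n.
Proof. by case: n => [|n]; [rewrite c00 | rewrite (le_trans _ (c_ge1 _))]. Qed.

Let c_ge0 := log_weight_ge0.

Lemma cos_part_taylor t th : 0 < t ->
  `|psum (cos_part c th) (expR (- t)) - psum c (expR (- t)) + th ^+ 2 / 2 * cumulant c 2 t|
  <= `|th| ^+ 3 * cumulant c 3 t.
Proof.
move=> t0; have q1 := expRN_lt1 t0.
have q01 : 0 <= expR (- t) < 1 by rewrite expR_ge0 /=; rewrite ger0_norm ?expR_ge0 in q1.
have s1 := subexp_cos_part th ce; have s2 := subexp_cumulant ce 2.
rewrite -[- psum c _]mulN1r -(psumZ (-1) ce q1) -(psumD s1 (subexpZ (-1) ce) q1).
have s3 := subexpD s1 (subexpZ (-1) ce).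
rewrite -(psumZ _ s2 q1) -(psumD s3 (subexpZ _ s2) q1).
apply: norm_psum_le => //; [exact: subexpD s3 (subexpZ _ s2) | exact: subexp_cumulant|].
move=> n; rewrite /cos_part.
have -> : c n * cos (n%:R * th) + -1 * c n + th ^+ 2 / 2 * (n%:R ^+ 2 * c n) =
   c n * (cos (n%:R * th) - (1 - (n%:R * th) ^+ 2 / 2)) by field.
rewrite normrM (ger0_norm (c_ge0 n)) mulrA [leRHS]mulrC ler_wpM2l //.
by apply: le_trans (cos_taylor _) _; rewrite normrM exprMn [`|n%:R|]ger0_norm // mulrC.
Qed.

Lemma sin_part_taylor t th : 0 < t ->
  `|psum (sin_part c th) (expR (- t)) - th * cumulant c 1 t| <= `|th| ^+ 3 * cumulant c 3 t.
Proof.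
move=> t0; have q1 := expRN_lt1 t0.
have q01 : 0 <= expR (- t) < 1 by rewrite expR_ge0 /=; rewrite ger0_norm ?expR_ge0 in q1.
have s1 := subexp_sin_part th ce; have s2 := subexp_cumulant ce 1.
rewrite -mulNr -(psumZ (- th) s2 q1) -(psumD s1 (subexpZ _ s2) q1).
apply: norm_psum_le => //; [exact: subexpD s1 (subexpZ _ s2) | exact: subexp_cumulant|].
move=> n; rewrite /sin_part.
have -> : c n * sin (n%:R * th) + - th * (n%:R ^+ 1 * c n) =
   c n * (sin (n%:R * th) - n%:R * th) by ring.
rewrite normrM (ger0_norm (c_ge0 n)) mulrA [leRHS]mulrC ler_wpM2l //.
by apply: le_trans (sin_taylor _) _; rewrite normrM exprMn [`|n%:R|]ger0_norm // mulrC.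
Qed.

(** Termwise comparison: cos(n th) - 1 <= 0 and c_n >= 1, so replacing every c_n by 1 can only
    increase the sum. *)
Lemma cos_part_decay t th : 0 < t <= 2^-1 -> `|th| <= pi ->
  psum (cos_part c th) (expR (- t)) - psum c (expR (- t)) <=
  - (3 / 4 * th ^+ 2 / (t * (18 * t ^+ 2 + 2 * th ^+ 2))).
Proof.
move=> tt thpi; apply: le_trans (psum_cos_sub_le tt thpi).
have t0 : 0 < t by case/andP: tt.
have q1 := expRN_lt1 t0; have s0 := subexp1 R.
have s1 := subexp_cos_part th ce; have s2 := subexp_cos_part th s0.
rewrite -[- psum c _]mulN1r -[- psum _ _ in leRHS]mulN1r -(psumZ (-1) ce q1) -(psumD s1 (subexpZ (-1) ce) q1).
rewrite -(psumZ (-1) s0 q1) -(psumD s2 (subexpZ (-1) s0) q1).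
apply: ler_psum => //; [exact: subexpD s1 (subexpZ _ ce) | exact: subexpD s2 (subexpZ _ s0)|].
move=> n; rewrite ler_wpM2r ?exprn_ge0 ?expR_ge0 // /cos_part.
case: n => [|n]; first by rewrite c00 !mul0r cos0; lra.
by have := cos_le1 (n.+1%:R * th); have := c_ge1 (ltn0Sn n); nra.
Qed.

Variables (A beta kappa C : R).
Hypothesis A0 : 0 < A.
Hypothesis C0 : 0 < C.
Hypothesis c_asymp : forall t, 0 < t ->
  `|psum c (expR (- t)) - (A / t + beta * ln t + kappa)| <= C * t.

Variables (t_ : R^nat) (N_ : nat -> nat) (d : R).
Hypothesis t_01 : forall n, 0 < t_ n <= 4^-1.
Hypothesis t_0 : t_ @ \oo --> (0 : R).
Hypothesis N_E : forall n, (N_ n)%:R + d = A / t_ n ^+ 2.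

(** The inverse standard deviation: sg^2 times the second cumulant, which is close to 2 A / t^3,
    tends to 1, so that the limit is the standard Gaussian. *)
Definition saddle_width (t : R) : R := t * Num.sqrt (t / (2 * A)).

Let sg n := saddle_width (t_ n).
Let rho n := Num.sqrt (t_ n / (2 * A)).

Let t0 n : 0 < t_ n. Proof. by case/andP: (t_01 n). Qed.
Let A2 : 0 < 2 * A. Proof. by rewrite mulr_gt0. Qed.
Let rho0 n : 0 < rho n. Proof. by rewrite sqrtr_gt0 divr_gt0. Qed.
Let sg0 n : 0 < sg n. Proof. exact: mulr_gt0 (t0 n) (rho0 n). Qed.
Let rho_sqr n : rho n ^+ 2 = t_ n / (2 * A).
Proof. by rewrite sqr_sqrtr // divr_ge0 // ltW. Qed.
Let sg_sqr n : sg n ^+ 2 = t_ n ^+ 3 / (2 * A).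
Proof. by rewrite /sg /saddle_width -/(rho n) exprMn rho_sqr; field; rewrite gt_eqF. Qed.

Let norm_sg3 n u : `|sg n * u| ^+ 3 = `|u| ^+ 3 * sg n ^+ 3.
Proof. by rewrite normrM (gtr0_norm (sg0 n)) mulrC; exact: exprMn. Qed.

Let sqrt_t_cvg : Num.sqrt (t_ n) @[n --> \oo] --> (0 : R).
Proof. by rewrite -[X in _ --> X](sqrtr0 R); apply: (continuous_seq_cvg (@sqrt_continuous R) t_0). Qed.

Let rho_cvg : rho @ \oo --> (0 : R).
Proof.
have e n : rho n = Num.sqrt (t_ n) * (Num.sqrt (2 * A))^-1.
  by rewrite /rho sqrtrM ?sqrtrV ?ltW.
rewrite (funext e) -[X in _ --> X](mul0r (Num.sqrt (2 * A))^-1).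
by apply: cvgMr_tmp.
Qed.

Let sg_cvg : sg @ \oo --> (0 : R).
Proof. by rewrite -[X in _ --> X](mul0r 0); apply: cvgM. Qed.

Let sg2_cvg : sg n ^+ 2 * cumulant c 2 (t_ n) @[n --> \oo] --> (1 : R).
Proof.
have [K K0 HK] := cumulant2_asymp ce c_ge0 A0 C0 c_asymp.
rewrite -[X in _ --> X]add0r.
have e n : sg n ^+ 2 * cumulant c 2 (t_ n) = (sg n ^+ 2 * cumulant c 2 (t_ n) - 1) + 1 by ring.
rewrite (funext e); apply: cvgD; last exact: cvg_cst.
apply: (@cvg_norm_le0 _ _ (fun n => K / (2 * A) * Num.sqrt (t_ n))).
  move=> n; have -> : sg n ^+ 2 * cumulant c 2 (t_ n) - 1 =
      (t_ n ^+ 3 * cumulant c 2 (t_ n) - 2 * A) / (2 * A).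
    by rewrite sg_sqr; field; rewrite gt_eqF.
  by rewrite normrM normfV (gtr0_norm A2) [leRHS]mulrAC ler_pM2r ?invr_gt0 // HK.
by rewrite -[X in _ --> X](mulr0 (K / (2 * A))); apply: cvgMl_tmp.
Qed.

Let sg3_cvg : sg n ^+ 3 * cumulant c 3 (t_ n) @[n --> \oo] --> (0 : R).
Proof.
have [K K0 HK] := cumulant3_bound ce c_ge0 A0 C0 c_asymp.
apply: (@cvg_norm_le0 _ _ (fun n => K / (2 * A) * rho n)).
  move=> n; have M0 := cumulant_ge0 ce c_ge0 3 (t0 n).
  have s30 : 0 <= sg n ^+ 3 by apply: exprn_ge0; exact: ltW (sg0 n).
  rewrite (ger0_norm (mulr_ge0 s30 M0)).
  have -> : sg n ^+ 3 * cumulant c 3 (t_ n) = t_ n ^+ 4 * cumulant c 3 (t_ n) / (2 * A) * rho n.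
    by rewrite exprS sg_sqr /sg /saddle_width -/(rho n); field; rewrite gt_eqF.
  rewrite ler_wpM2r ?(ltW (rho0 n)) // ler_pM2r ?invr_gt0 // HK //.
  by case/andP: (t_01 n) => -> /= h; lra.
by rewrite -[X in _ --> X](mulr0 (K / (2 * A))); apply: cvgMl_tmp.
Qed.

(** The saddle point equation: N + d = A / t^2 cancels the leading part of the linear phase. What is
    left is at most K [rho] n, and the fixed offset [d] only costs sg d. *)
Let sg1_cvg : sg n * (cumulant c 1 (t_ n) - (N_ n)%:R) @[n --> \oo] --> (0 : R).
Proof.
have [K K0 HK] := cumulant1_asymp ce c_ge0 A0 C0 c_asymp.
have e n : sg n * (cumulant c 1 (t_ n) - (N_ n)%:R) =
   sg n * (cumulant c 1 (t_ n) - A / t_ n ^+ 2) + sg n * d by rewrite -N_E; ring.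
rewrite (funext e) -[X in _ --> X]addr0; apply: cvgD; last first.
  by rewrite -[X in _ --> X](mul0r d); apply: cvgMr_tmp.
apply: (@cvg_norm_le0 _ _ (fun n => K * rho n)).
  move=> n; rewrite normrM (gtr0_norm (sg0 n)).
  have tt : 0 < t_ n <= 2^-1 by case/andP: (t_01 n) => -> /= h; lra.
  apply: le_trans (ler_wpM2l (ltW (sg0 n)) (HK _ tt)) _.
  rewrite /sg /saddle_width -/(rho n).
  have -> : t_ n * rho n * (K / t_ n) = K * rho n by field; rewrite gt_eqF.
  by [].
by rewrite -[X in _ --> X](mulr0 K); apply: cvgMl_tmp.
Qed.

Let Delta n u := psum (cos_part c (sg n * u)) (expR (- t_ n)) - psum c (expR (- t_ n)).

Let Delta_cvg u : Delta n u @[n --> \oo] --> - (u ^+ 2 / 2).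
Proof.
have e n : Delta n u = (Delta n u + (sg n * u) ^+ 2 / 2 * cumulant c 2 (t_ n)) -
    (sg n ^+ 2 * cumulant c 2 (t_ n)) * (u ^+ 2 / 2) by field.
rewrite (funext e) -[X in _ --> X]add0r; apply: cvgD.
  apply: (@cvg_norm_le0 _ _ (fun n => `|u| ^+ 3 * (sg n ^+ 3 * cumulant c 3 (t_ n)))).
    move=> n; apply: le_trans (cos_part_taylor _ (t0 n)) _.
    by rewrite norm_sg3 -[leLHS]mulrA.
  by rewrite -[X in _ --> X](mulr0 (`|u| ^+ 3)); apply: cvgMl_tmp.
by apply: cvgN; rewrite -[X in _ --> X]mul1r; apply: cvgMr_tmp.
Qed.

Let phase p n u := psum (sin_part c (sg n * u)) (expR (- t_ n)) -
  ((N_ n)%:R + p%:R / 2) * (sg n * u) - p%:R * (pi / 2).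

Let phase_cvg p u : phase p n u @[n --> \oo] --> - (p%:R * (pi / 2)).
Proof.
have e n : phase p n u =
   (psum (sin_part c (sg n * u)) (expR (- t_ n)) - sg n * u * cumulant c 1 (t_ n)) +
   (sg n * (cumulant c 1 (t_ n) - (N_ n)%:R) * u - sg n * (p%:R / 2 * u)) - p%:R * (pi / 2).
  by rewrite /phase; move: (pi : R) => y; field.
rewrite (funext e) -[X in _ --> X]add0r; apply: cvgB; last exact: cvg_cst.
rewrite -[X in _ --> X]addr0; apply: cvgD.
  apply: (@cvg_norm_le0 _ _ (fun n => `|u| ^+ 3 * (sg n ^+ 3 * cumulant c 3 (t_ n)))).
    move=> n; apply: le_trans (sin_part_taylor _ (t0 n)) _.
    by rewrite norm_sg3 -[leLHS]mulrA.
  by rewrite -[X in _ --> X](mulr0 (`|u| ^+ 3)); apply: cvgMl_tmp.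
rewrite -[X in _ --> X]subr0; apply: cvgB.
  by rewrite -[X in _ --> X](mul0r u); apply: cvgMr_tmp.
by rewrite -[X in _ --> X](mul0r (p%:R / 2 * u)); apply: cvgMr_tmp.
Qed.

Let chord n u := 2 * sin (sg n * u / 2) / sg n.

Let chord_le n u : `|chord n u| <= `|u|.
Proof.
rewrite /chord normrM normfV (gtr0_norm (sg0 n)) ler_pdivrMr // normrM ger0_norm //.
have := norm_sin_le (sg n * u / 2).
by rewrite normrM [`|sg n * u|]normrM (gtr0_norm (sg0 n)) [`|2^-1|]ger0_norm // mulrC; lra.
Qed.

Let chord_cvg u : chord n u @[n --> \oo] --> u.
Proof.
have e n : chord n u = (chord n u - u) + u by rewrite subrK.
rewrite (funext e) -[X in _ --> X]add0r; apply: cvgD; last exact: cvg_cst.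
apply: (@cvg_norm_le0 _ _ (fun n => `|u| ^+ 3 / 4 * (sg n * sg n))).
  move=> n; have -> : chord n u - u = (2 / sg n) * (sin (sg n * u / 2) - sg n * u / 2).
    by rewrite /chord; field; rewrite gt_eqF.
  have s2 : 0 < 2 / sg n by rewrite divr_gt0.
  rewrite normrM (gtr0_norm s2); apply: le_trans (ler_wpM2l (ltW s2) (sin_taylor _)) _.
  rewrite normrM [`|sg n * u|]normrM (gtr0_norm (sg0 n)) [`|2^-1|]ger0_norm //.
  by rewrite le_eqVlt; apply/orP; left; apply/eqP; field; rewrite gt_eqF.
rewrite -[X in _ --> X](mulr0 (`|u| ^+ 3 / 4)); apply: cvgMl_tmp.
by rewrite -[X in _ --> X](mul0r 0); apply: cvgM.
Qed.

Let I n : set R := `[- (pi / sg n), pi / sg n]%classic.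

Let I_norm n u : I n u -> `|sg n * u| <= pi.
Proof.
rewrite /I /= in_itv /= -ler_norml => h.
by rewrite normrM (gtr0_norm (sg0 n)) mulrC -ler_pdivlMr.
Qed.

(** The bound of [cos_part_decay] at th = sg u, after sg^2 = t^3 / (2 A) has been substituted. *)
Let E n u := 3 / 8 * u ^+ 2 / (18 * A + t_ n * u ^+ 2).

Let E_den n u : 0 < 18 * A + t_ n * u ^+ 2.
Proof. by rewrite ltr_pwDl ?mulr_gt0 // mulr_ge0 ?sqr_ge0 // ltW. Qed.

Let E_ge0 n u : 0 <= E n u.
Proof. by rewrite divr_ge0 ?(ltW (E_den _ _)) // mulr_ge0 ?sqr_ge0. Qed.

Let Delta_le n u : I n u -> Delta n u <= - E n u.
Proof.
move=> /I_norm h; have tt : 0 < t_ n <= 2^-1 by case/andP: (t_01 n) => -> /= h'; lra.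
apply: le_trans (cos_part_decay tt h) _; rewrite lerN2 /E exprMn sg_sqr.
have u0 := sqr_ge0 u; have tn := t0 n; move: (u ^+ 2) u0 => y y0; move: (t_ n) tn => t tn.
have D1 : 0 < 18 * A + t * y by rewrite ltr_pwDl ?mulr_gt0 // mulr_ge0 // ltW.
rewrite le_eqVlt; apply/orP; left; apply/eqP; field.
by rewrite !gt_eqF // ltr_pwDl ?mulr_ge0 ?mulr_gt0 // ltW.
Qed.

Let cE := 27 / (8 ^+ 3 * 4 * ((18 * A) ^+ 3 + 2 * pi ^+ 2 * A)).

Let cE0 : 0 < cE.
Proof.
have p0 := pi_gt0 R; rewrite /cE; move: (pi : R) p0 => y p0.
by rewrite divr_gt0 // mulr_gt0 ?mulr_gt0 ?exprn_gt0 // addr_gt0 ?exprn_gt0 ?mulr_gt0 ?exprn_gt0.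
Qed.

(** On [I n] the bound |sg u| <= pi means t^3 u^2 <= 2 pi^2 A, so the cube of the denominator is
    O(u^4) against u^6 above it. The factor 4 in [cE] is that of (v + w)^3 <= 4 (v^3 + w^3). *)
Let E_cube n u : I n u -> 1 <= `|u| -> cE * `|u| ^+ 2 <= E n u ^+ 3.
Proof.
move=> /I_norm h u1; rewrite real_normK ?num_real //.
have y1 : 1 <= u ^+ 2 by rewrite -(real_normK (num_real u)) exprn_ege1.
have ty : t_ n ^+ 3 * u ^+ 2 <= 2 * pi ^+ 2 * A.
  have : `|sg n * u| ^+ 2 <= pi ^+ 2 by rewrite lerXn2r ?nnegrE // ltW // pi_gt0.
  rewrite real_normK ?num_real // exprMn sg_sqr mulrAC ler_pdivrMr //; lra.
have tn := t0 n; have D0 := E_den n u.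
rewrite /E /cE; move: (u ^+ 2) y1 ty D0 => y y1 ty D0; move: (t_ n) tn ty D0 => t tn ty D0.
have p0 : 0 < (pi : R) ^+ 2 by rewrite exprn_gt0 // pi_gt0.
move: ((pi : R) ^+ 2) p0 ty => P p0 ty.
have yp : 0 < y by apply: lt_le_trans y1.
have B0 : 0 < (18 * A) ^+ 3 + 2 * P * A by rewrite addr_gt0 ?exprn_gt0 ?mulr_gt0.
rewrite [leLHS]mulrAC ler_pdivrMr; last by rewrite mulr_gt0 // mulr_gt0 // exprn_gt0.
rewrite expr_div_n [leRHS]mulrAC ler_pdivlMr ?exprn_gt0 //.
have conv (v w : R) : 0 <= v -> 0 <= w -> (v + w) ^+ 3 <= 4 * (v ^+ 3 + w ^+ 3).
  move=> v0 w0; rewrite -subr_ge0.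
  have -> : 4 * (v ^+ 3 + w ^+ 3) - (v + w) ^+ 3 = 3 * ((v + w) * (v - w) ^+ 2) by ring.
  by rewrite mulr_ge0 // mulr_ge0 ?sqr_ge0 ?addr_ge0.
have ty0 : 0 <= t * y by rewrite mulr_ge0 // ltW.
have A18 : 0 <= 18 * A by rewrite mulr_ge0 // ltW.
have h1 := conv _ _ A18 ty0.
have h2 : (t * y) ^+ 3 <= 2 * P * A * y ^+ 2.
  by rewrite exprMn (exprS y 2) mulrA ler_pM2r // exprn_gt0.
have h3 : (18 * A) ^+ 3 <= (18 * A) ^+ 3 * y ^+ 2.
  by rewrite ler_peMr ?exprn_ge0 // exprn_ege1.
have h4 : (18 * A + t * y) ^+ 3 <= 4 * (((18 * A) ^+ 3 + 2 * P * A) * y ^+ 2).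
  by apply: le_trans h1 _; rewrite mulrDl; lra.
have h5 := ler_wpM2l (ltW yp) h4.
have -> : 27 * y * (18 * A + t * y) ^+ 3 = 27 * (y * (18 * A + t * y) ^+ 3) by ring.
have -> : (3 / 8 * y) ^+ 3 * (8 ^+ 3 * 4 * ((18 * A) ^+ 3 + 2 * P * A)) =
   27 * (y * (4 * (((18 * A) ^+ 3 + 2 * P * A) * y ^+ 2))) by field.
by rewrite ler_pM2l.
Qed.

Let Psi p n u := expR (Delta n u) * chord n u ^+ p * cos (phase p n u).

Let Psi_kernel p n u : Psi p n u =
  (expR (psum c (expR (- t_ n))) * sg n ^+ p)^-1 *
  diff_kernel (expR (- t_ n)) (sg n) c p (N_ n) u.
Proof.
have g0 : sg n != 0 by rewrite gt_eqF.
rewrite /Psi /diff_kernel -/(phase p n u) /Delta expRD (expRN (psum c _)) /chord expr_div_n.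
move: (sg n) g0 (cos (phase p n u)) => g g0 w.
move: (2 * sin (g * u / 2)) (expR_gt0 (psum c (expR (- t_ n)))) => v.
move: (expR (psum c _)) (expR (psum (cos_part _ _) _)) => F X F0.
by move: (v ^+ p) (g ^+ p) (expf_neq0 p g0) => Y Z Z0; field; rewrite Z0 gt_eqF.
Qed.

Lemma local_limit p :
  fdiff p (fun m => a m * expR (- t_ n) ^+ m) (N_ n) /
    (expR (psum c (expR (- t_ n))) * saddle_width (t_ n) ^+ p.+1) @[n --> \oo]
  --> (2 * pi)^-1 * (cos (p%:R * (pi / 2)) * moment R p).
Proof.
have [K K0 HK] := @pow_mul_expRN_le R p cE cE0.
have ae := subexp_exp_coef a0 c_ge0 ce a_rec.
have a_ge0 := exp_coef_ge0 a0 c_ge0 a_rec.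
have q01 n : 0 <= expR (- t_ n) < 1.
  by rewrite expR_ge0 /=; have := expRN_lt1 (t0 n); rewrite ger0_norm ?expR_ge0.
have KI n := Rintegral_diff_kernel ae a_ge0 (q01 n) (sg0 n)
  (fun th => psum_exp_coef a0 c00 c_ge0 ce a_rec th (q01 n)) p (N_ n).
have mI n : measurable (I n) by exact: measurable_itv.
have F0 n : 0 < expR (psum c (expR (- t_ n))) * sg n ^+ p by rewrite mulr_gt0 ?expR_gt0 ?exprn_gt0.
have iPsi n : mu.-integrable (I n) (EFin \o Psi p n).
  have := @integrableZl _ _ _ mu (I n) (mI n) (expR (psum c (expR (- t_ n))) * sg n ^+ p)^-1 _ (KI n).1.
  by apply: eq_integrable => [|u _]; [exact: mI | rewrite /= Psi_kernel].
have [||||_] := @Rintegral_dominated_cvg R (fun n => Psi p n \_ (I n))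
    (fun u => cos (p%:R * (pi / 2)) * (u ^+ p * gauss_weight u)) (fun u => K / (1 + u ^+ 2)).
- move=> n; apply/(measurable_restrictT _ (mI n)).
  by apply/measurable_EFinP; have /integrableP[] := iPsi n.
- move=> u; have cP : Psi p n u @[n --> \oo] --> cos (p%:R * (pi / 2)) * (u ^+ p * gauss_weight u).
    rewrite -[cos _]cosN [X in _ --> X]mulrC; apply: cvgM; last first.
      exact: (continuous_seq_cvg (@continuous_cos R) (@phase_cvg p u)).
    rewrite [X in _ --> X]mulrC; apply: cvgM.
      exact: (continuous_seq_cvg (@continuous_expR R) (@Delta_cvg u)).
    exact: (continuous_seq_cvg (@exprn_continuous R p) (@chord_cvg u)).
  (* For a fixed [u] the restriction to [I n] is eventually invisible, since pi / sg grows without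
     bound. *)
  apply: cvg_trans cP; apply: near_eq_cvg; near=> n.
  rewrite /patch ifT // inE /I /= in_itv /= -ler_norml ler_pdivlMr //.
  have su : `|sg n| <= pi / (1 + `|u|).
    near: n; move/cvgr0Pnorm_le: sg_cvg; apply.
    by rewrite divr_gt0 ?pi_gt0 // ltr_pwDl.
  apply: le_trans (ler_wpM2l (normr_ge0 u) (le_trans (ler_norm _) su)) _.
  rewrite mulrA ler_pdivrMr ?ltr_pwDl // mulrC ler_pM2l ?pi_gt0 //.
  by rewrite lerDr.
- exact: integrable_oneDsqrVZ.
- move=> n u; rewrite /patch; case: ifPn => [|_]; last first.
    by rewrite (_ : point = 0 :> R) // normr0 divr_ge0 // ?(ltW K0) // addr_ge0 // sqr_ge0.
  rewrite inE => uI; rewrite /Psi !normrM normrX (ger0_norm (expR_ge0 _)).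
  have c1 : `|cos (phase p n u)| <= 1 by rewrite ler_norml cos_geN1 cos_le1.
  have w0 : 0 <= expR (Delta n u) * `|chord n u| ^+ p by rewrite mulr_ge0 ?expR_ge0 ?exprn_ge0.
  apply: le_trans (ler_wpM2l w0 c1) _; rewrite mulr1 mulrC.
  apply: (@le_trans _ _ (`|u| ^+ p * expR (- E n u))).
    rewrite ler_pM ?exprn_ge0 ?expR_ge0 ?ler_expR ?Delta_le //.
    by rewrite lerXn2r ?nnegrE.
  rewrite -[X in 1 + X](real_normK (num_real u)); apply: HK => //.
  exact: E_cube.
rewrite RintegralZl //; last exact: integrable_pow_gauss_weight.
move=> cv.
have e n : fdiff p (fun m => a m * expR (- t_ n) ^+ m) (N_ n) /
    (expR (psum c (expR (- t_ n))) * saddle_width (t_ n) ^+ p.+1) =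
    (2 * pi)^-1 * \int[mu]_u (Psi p n \_ (I n)) u.
  rewrite -Rintegral_mkcond.
  under eq_Rintegral => u _ do rewrite Psi_kernel.
  rewrite RintegralZl; [|exact: mI|exact: (KI n).1].
  rewrite (KI n).2 -/(sg n) exprS.
  have pi0 := pi_gt0 R; move: (pi : R) pi0 => y y0.
  by field; rewrite !gt_eqF ?exprn_gt0 ?expR_gt0.
by rewrite (funext e); apply: cvgMl_tmp.
Unshelve. all: by end_near. Qed.

End LocalLimit.

(** * Determinants of iterated differences *)

Section DifferenceDeterminants.

Variable R : realType.
Implicit Types (f : R^nat).

Lemma fdiffS p f N : fdiff p.+1 f N = fdiff p (fun n => f n.+1 - f n) N.
Proof. by elim: p N => //= p IH N; rewrite -!IH. Qed.

Lemma fdiff_add p q f N : fdiff p (fdiff q f) N = fdiff (p + q) f N.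
Proof. by elim: p N => //= p IH N; rewrite !IH. Qed.

(** The signed binomial coefficients (-1)^(p-l) C(p, l), by Pascal's rule. *)
Fixpoint diff_coef (p l : nat) : R :=
  if p is p'.+1 then (if l is l'.+1 then diff_coef p' l' else 0) - diff_coef p' l
  else (l == 0%N)%:R.

Lemma diff_coef_gt p l : (p < l)%N -> diff_coef p l = 0.
Proof.
elim: p l => [|p IH] [|l] //= pl.
by rewrite (IH l) // IH ?subr0 // ltnW.
Qed.

Lemma diff_coef_diag p : diff_coef p p = 1.
Proof. by elim: p => //= p IH; rewrite IH diff_coef_gt // subr0. Qed.

Lemma diff_coef0 p : diff_coef p 0 = (-1) ^+ p.
Proof. by elim: p => //= p IH; rewrite IH sub0r exprS mulN1r. Qed.

Lemma fdiff_coef p f N r : (p < r)%N ->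
  fdiff p f N = \sum_(l < r) diff_coef p l * f (N + l)%N.
Proof.
elim: p N r => [|p IH] N r pr.
  case: r pr => // r _; rewrite big_ord_recl /= addn0 mul1r big1 ?addr0 // => i _.
  by rewrite mul0r.
case: r pr => // r; rewrite ltnS => pr /=; rewrite (IH N.+1 r) // (IH N r.+1) ?(ltnW pr) //; last by rewrite ltnS ltnW.
rewrite [RHS]big_ord_recl [X in _ - X]big_ord_recl /=.
under [in RHS]eq_bigr => i _ do rewrite mulrBl.
rewrite big_split /= sumrN; under eq_bigr => i _ do rewrite addSnnS.
by rewrite sub0r mulNr; ring.
Qed.

(** Row i is replaced by a difference of order i of rows 0 to i, read towards decreasing index, and
    column j by a difference of order j. The column operations have determinant 1, the row
    operations have (-1)^i on the diagonal. *)
Lemma det_fdiff r f n : (r <= n)%N ->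
  \det (\matrix_(i < r, j < r) fdiff (i + j) f (n - i)%N) =
  (\prod_(i < r) (-1) ^+ i) * \det (\matrix_(i < r, j < r) f (n + j - i)%N).
Proof.
move=> rn; set B := \matrix_(i, j) f _.
pose L : 'M[R]_r := \matrix_(i, k) if (k <= i)%N then diff_coef i (i - k) else 0.
pose W : 'M[R]_r := \matrix_(i, k) diff_coef i k.
have -> : \matrix_(i < r, j < r) fdiff (i + j) f (n - i)%N = L *m B *m W^T.
  apply/matrixP => i j; rewrite !mxE -fdiff_add (fdiff_coef _ _ (ltn_ord i)).
  under [RHS]eq_bigr => l _ do rewrite !mxE mulr_suml.
  rewrite exchange_big /=.
  have E (k : 'I_r) : \sum_l L i k * B k l * diff_coef j l =
     (if (k <= i)%N then diff_coef i (i - k) * fdiff j f (n - k)%N else 0).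
    rewrite mxE; case: leqP => ki; last by rewrite big1 // => l _; rewrite !mul0r.
    rewrite (fdiff_coef _ _ (ltn_ord j)) mulr_sumr; apply: eq_bigr => l _; rewrite mxE.
    have kn : (k <= n)%N by apply: leq_trans rn; exact/ltnW/ltn_ord.
    by rewrite -addnBAC //; ring.
  under [RHS]eq_bigr => k _ do rewrite E.
  rewrite -big_mkcond /=.
  pose G l := diff_coef i l * fdiff j f (n - i + l)%N.
  have ir : (i < r)%N := ltn_ord i.
  have -> : \sum_(l < r) diff_coef i l * fdiff j f (n - i + l)%N = \sum_(0 <= l < i.+1) G l.
    rewrite -(big_mkord xpredT G) (big_cat_nat (n := i.+1)) //= [X in _ + X]big1_seq ?addr0 // => l /=.
    by rewrite mem_index_iota => /andP[il _]; rewrite /G diff_coef_gt // mul0r.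
  rewrite big_mkord (reindex_inj rev_ord_inj) /=.
  rewrite (big_ord_widen r (fun l => G (i.+1 - l.+1)%N)) //.
  apply: eq_big => [k //|k]; rewrite ltnS subSS => ki; rewrite /G; congr (_ * fdiff j f _).
  by rewrite addnBA // subnK // (leq_trans (ltnW ir)).
rewrite !det_mulmx det_tr [\det W]det_trig; last first.
  by apply/is_trig_mxP => i j ij; rewrite mxE diff_coef_gt.
rewrite [\det L]det_trig; last first.
  by apply/is_trig_mxP => i j ij; rewrite mxE leqNgt ij.
rewrite [X in _ * X]big1 => [|i _]; last by rewrite mxE diff_coef_diag.
by rewrite mulr1; congr (_ * _); apply: eq_bigr => i _; rewrite mxE leqnn subnn diff_coef0.
Qed.

Lemma det_row_col_scale r (u v : nat -> R) (M : nat -> nat -> R) :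
  \det (\matrix_(i < r, j < r) (u i * M i j * v j)) =
  (\prod_(i < r) u i) * (\prod_(i < r) v i) * \det (\matrix_(i < r, j < r) M i j).
Proof.
have -> : \matrix_(i < r, j < r) (u i * M i j * v j) =
   diag_mx (\row_i u i) *m (\matrix_(i < r, j < r) M i j) *m diag_mx (\row_i v i).
  by rewrite mul_diag_mx mul_mx_diag; apply/matrixP => i j; rewrite !mxE.
rewrite !det_mulmx !det_diag mulrAC; congr (_ * _ * _); apply: eq_bigr => i _; rewrite mxE //.
Qed.

(** The coefficient of He_i in x^k, from x He_i = He_(i+1) + i He_(i-1). *)
Fixpoint hermite_coef (k i : nat) : nat :=
  if k is k'.+1 then (if i is i'.+1 then hermite_coef k' i' else 0) +
    i.+1 * hermite_coef k' i.+1
  else (i == 0).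

Lemma hermite_coef_gt k i : (k < i)%N -> hermite_coef k i = 0%N.
Proof.
elim: k i => [|k IH] [|i] //= ki; rewrite IH // IH ?muln0 //.
lia.
Qed.

Lemma hermite_coef_diag k : hermite_coef k k = 1%N.
Proof. by elim: k => //= k ->; rewrite hermite_coef_gt ?muln0 // ltnW. Qed.

(* Coefficientwise form of the identity (x^(p+1))' = (p+1) x^p, since the
   derivative of He_(i+1) is (i+1) He_i. *)
Lemma hermite_coef_deriv p i :
  (i.+1 * hermite_coef p.+1 i.+1 = p.+1 * hermite_coef p i)%N.
Proof.
elim: p i => [|p IH] i; first by case: i => [|i] //; rewrite /= !muln0.
have IH1 := IH i.+1; have IH0 : (i * hermite_coef p.+1 i = p.+1 * (if i is i'.+1 then hermite_coef p i' else 0))%N.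
  by case: i {IH1} => [|i]; [rewrite muln0 | rewrite IH].
have E1 : hermite_coef p.+2 i.+1 = (hermite_coef p.+1 i + i.+2 * hermite_coef p.+1 i.+2)%N by [].
have E2 : hermite_coef p.+1 i = ((if i is i'.+1 then hermite_coef p i' else 0) + i.+1 * hermite_coef p i.+1)%N by [].
have E3 : (p.+1 * hermite_coef p.+1 i = i * hermite_coef p.+1 i + p.+1 * (i.+1 * hermite_coef p i.+1))%N.
  by rewrite IH0 -mulnDr -E2.
rewrite E1 IH1 [RHS]mulSn E3 mulnDr mulSn.
by ring.
Qed.

(** The mean of x^p under the standard Gaussian: He_i with i > 0 has mean 0. *)
Definition gauss_moment p := hermite_coef p 0.

Lemma gauss_momentSS p : gauss_moment p.+2 = (p.+1 * gauss_moment p)%N.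
Proof. by rewrite /gauss_moment -hermite_coef_deriv /= add0n mul1n. Qed.

Lemma gauss_moment_odd p : gauss_moment p.*2.+1 = 0%N.
Proof. by elim: p => //= p IH; rewrite doubleS gauss_momentSS IH muln0. Qed.

(* The three-term recurrence makes multiplication by x self-adjoint for the
   weights i!. *)
Lemma gauss_moment_sum k l r : (k + l < r)%N ->
  gauss_moment (k + l) = (\sum_(i < r) i`! * hermite_coef k i * hermite_coef l i)%N.
Proof.
elim: l k r => [|l IH] k r klr.
  case: r klr => // r klr; rewrite addn0 big_ord_recl big1 ?addn0; last by move=> i _; rewrite muln0.
  by rewrite fact0 mul1n muln1.
rewrite -addSnnS (IH _ r) ?addSnnS //.
case: r klr => // r klr.
have S (a b : nat) : (a + b < r)%N ->
  (\sum_(i < r.+1) i`! * hermite_coef a.+1 i * hermite_coef b i =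
   \sum_(i < r) (i.+1`! * hermite_coef a i * hermite_coef b i.+1 +
                 i.+1`! * hermite_coef a i.+1 * hermite_coef b i))%N.
  move=> abr; rewrite big_split /=.
  under eq_bigr => i _ do rewrite mulnDr mulnDl.
  rewrite big_split /=; congr addn.
    rewrite big_ord_recl muln0 mul0n add0n; apply: eq_bigr => i _ //.
  rewrite big_ord_recr /= [hermite_coef a r.+1]hermite_coef_gt ?muln0 ?mul0n ?addn0; last first.
    by rewrite ltnS (leq_trans (leq_addr b a)) // ltnW.
  by apply: eq_bigr => i _; rewrite factS; ring.
rewrite addnS ltnS in klr.
rewrite S //; under [RHS]eq_bigr => i _ do rewrite mulnAC.
by rewrite S 1?addnC //; apply: eq_bigr => i _; rewrite addnC; congr addn; rewrite mulnAC.
Qed.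

(** [gauss_moment_sum] factors the Hankel matrix as H D H^T, where H is unitriangular and D carries
    the squared norms i! of the Hermite polynomials. *)
Lemma det_gauss_moment r :
  \det (\matrix_(i < r, j < r) (gauss_moment (i + j))%:R) = \prod_(i < r) (i`!)%:R :> R.
Proof.
pose H : 'M[R]_r := \matrix_(k, i) (hermite_coef k i)%:R.
pose d : 'rV[R]_r := \row_i (i`!)%:R.
have -> : \matrix_(i < r, j < r) (gauss_moment (i + j))%:R = H *m diag_mx d *m H^T.
  apply/matrixP => k l; rewrite mul_mx_diag !mxE.
  have klr : (k + l < r + r)%N by rewrite -addSn leq_add ?ltn_ord // ltnW.
  rewrite (gauss_moment_sum klr) natr_sum big_split_ord /= [X in _ + X]big1 ?addr0; last first.
    move=> i _; rewrite (@hermite_coef_gt k) ?muln0 //.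
    by rewrite (leq_trans (ltn_ord k)) // leq_addr.
  by apply: eq_bigr => i _; rewrite !mxE !natrM; ring.
rewrite !det_mulmx det_tr det_diag [\det H]det_trig; last first.
  by apply/is_trig_mxP => i j ij; rewrite mxE hermite_coef_gt.
rewrite big1 => [|i _]; last by rewrite mxE hermite_coef_diag.
by rewrite mul1r mulr1; apply: eq_bigr => i _; rewrite mxE.
Qed.

(** For odd [p] the cosine vanishes, so odd moments need no evaluation. *)
Lemma moment_gauss p : cos (p%:R * (pi / 2)) * moment R p =
  cos (p%:R * (pi / 2)) * (Num.sqrt (pi *+ 2) * (gauss_moment p)%:R).
Proof.
rewrite -(odd_double_half p); case: (odd p) => /=; last first.
  congr (_ * _); rewrite add0n; elim: (p./2) => [|m IH]; first by rewrite moment0 mulr1.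
  by rewrite doubleS moment_odd_even_rec IH gauss_momentSS natrM mulrCA.
rewrite add1n gauss_moment_odd mulr0.
have -> : cos ((p./2).*2.+1%:R * (pi / 2)) = 0 :> R; last by rewrite !mul0r.
rewrite -addn1 natrD mulrDl mul1r cosDpihalf -muln2 natrM -mulrA.
have -> : 2 * (pi / 2) = pi :> R by rewrite mulrC divfK.
by rewrite sin_natmul_pi oppr0.
Qed.

Lemma cos_natmul_pi n : cos (n%:R * pi) = (-1) ^+ n :> R.
Proof.
elim: n => [|n IH]; first by rewrite mul0r cos0.
by rewrite mulrSr mulrDl mul1r cosDpi IH exprS mulN1r.
Qed.

(** For i + j even, the cosine is (-1)^((i+j)/2), and with (-1)^i it splits into one sign for the
    row and one for the column. These signs then square away in the determinant. *)
Lemma cos_gauss_moment_sign i j :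
  (-1) ^+ i * (cos ((i + j)%:R * (pi / 2)) * (gauss_moment (i + j))%:R) =
  (-1) ^+ i./2 * (gauss_moment (i + j))%:R * (-1) ^+ j./2 :> R.
Proof.
rewrite [LHS]mulrA [RHS]mulrAC; case ij: (odd (i + j)).
  by rewrite -(odd_double_half (i + j)) ij add1n gauss_moment_odd !mulr0.
congr (_ * _).
have -> : cos ((i + j)%:R * (pi / 2)) = (-1) ^+ (i + j)./2 :> R.
  rewrite -(cos_natmul_pi) -{1}(odd_double_half (i + j)) ij add0n -muln2 natrM -mulrA.
  by congr (cos (_ * _)); rewrite mulrC divfK.
rewrite -!exprD -[LHS]signr_odd -[RHS]signr_odd; congr (_ ^+ _); congr nat_of_bool.
lia.
Qed.

Lemma det_cos_moment r :
  (\prod_(i < r) (-1) ^+ i) * \det (\matrix_(i < r, j < r)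
     ((2 * pi)^-1 * (cos ((i + j)%:R * (pi / 2)) * moment R (i + j)))) =
  (Num.sqrt (pi *+ 2)) ^- r * \prod_(i < r) (i`!)%:R :> R.
Proof.
set s := Num.sqrt (pi *+ 2); have p0 : 0 < pi *+ 2 :> R by rewrite mulrn_wgt0 ?pi_gt0.
have s0 : 0 < s by rewrite sqrtr_gt0.
have sE : (2 * pi)^-1 * s = s^-1.
  have -> : 2 * pi = s ^+ 2 :> R by rewrite sqr_sqrtr ?ltW // mulr_natl.
  by field; rewrite gt_eqF.
have -> : (\prod_(i < r) (-1) ^+ i) * \det (\matrix_(i < r, j < r)
     ((2 * pi)^-1 * (cos ((i + j)%:R * (pi / 2)) * moment R (i + j)))) =
   \det (\matrix_(i < r, j < r) ((s^-1 * (-1) ^+ i./2) * (gauss_moment (i + j))%:R * (-1) ^+ j./2)).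
  have := @det_row_col_scale r (fun i => (-1) ^+ i) (fun=> 1)
     (fun i j => (2 * pi)^-1 * (cos ((i + j)%:R * (pi / 2)) * moment R (i + j))).
  rewrite big1_eq mulr1 => <-.
  congr (\det _); apply/matrixP => i j; rewrite !mxE mulr1 moment_gauss -/s.
  have -> : s^-1 * (-1) ^+ i./2 * (gauss_moment (i + j))%:R * (-1) ^+ j./2 =
     s^-1 * ((-1) ^+ i./2 * (gauss_moment (i + j))%:R * (-1) ^+ j./2) by ring.
  rewrite -cos_gauss_moment_sign -sE.
  by move: ((2 * pi)^-1) (cos _) => w z; ring.
rewrite (det_row_col_scale r (fun i => s^-1 * (-1) ^+ i./2) (fun j => (-1) ^+ j./2)
  (fun i j => (gauss_moment (i + j))%:R)) det_gauss_moment; congr (_ * _).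
rewrite -big_split /= (eq_bigr (fun=> s^-1)) => [|i _].
  by rewrite prodr_const card_ord exprVn.
by rewrite -mulrA -expr2 sqrr_sign mulr1.
Qed.

End DifferenceDeterminants.

(** * From limits of differences to the Toeplitz determinant *)

Section ToeplitzAsymptotics.

Variable R : realType.

Lemma cvg_bigsum (I : Type) (s : seq I) (f : I -> R^nat) (l : I -> R) :
  (forall i, f i @ \oo --> l i) ->
  \sum_(i <- s) f i n @[n --> \oo] --> \sum_(i <- s) l i.
Proof.
move=> fl; elim: s => [|i s IH].
  by rewrite big_nil; under eq_fun do rewrite big_nil; exact: cvg_cst.
by rewrite big_cons; under eq_fun do rewrite big_cons; exact: cvgD.
Qed.

Lemma cvg_bigprod (I : Type) (s : seq I) (f : I -> R^nat) (l : I -> R) :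
  (forall i, f i @ \oo --> l i) ->
  \prod_(i <- s) f i n @[n --> \oo] --> \prod_(i <- s) l i.
Proof.
move=> fl; elim: s => [|i s IH].
  by rewrite big_nil; under eq_fun do rewrite big_nil; exact: cvg_cst.
by rewrite big_cons; under eq_fun do rewrite big_cons; exact: cvgM.
Qed.

Lemma cvg_det r (M : nat -> nat -> R^nat) (L : nat -> nat -> R) :
  (forall i j, M i j @ \oo --> L i j) ->
  \det (\matrix_(i < r, j < r) M i j n) @[n --> \oo] --> \det (\matrix_(i < r, j < r) L i j).
Proof.
move=> ML; rewrite /determinant; apply: cvg_bigsum => s; apply: cvgMl_tmp.
rewrite (_ : (fun n => _) = fun n => \prod_(i < r) M i (s i) n); last first.
  by apply/funext => n; apply: eq_bigr => i _; rewrite mxE.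
rewrite (_ : \prod_(i < r) _ = \prod_(i < r) L i (s i)); last first.
  by apply: eq_bigr => i _; rewrite mxE.
exact: cvg_bigprod.
Qed.

Lemma prod_expr_sqr (x : R) r : (\prod_(i < r) x ^+ i) ^+ 2 = x ^+ (r * r.-1).
Proof.
elim: r => [|r IH]; first by rewrite big_ord0 expr1n.
rewrite big_ord_recr /= exprMn IH -exprM -exprD; congr (_ ^+ _).
by case: r {IH} => //= r; ring.
Qed.

Lemma iota_sign_sqr r : (\prod_(i < r) (-1) ^+ i) * (\prod_(i < r) (-1) ^+ i) = 1 :> R.
Proof. by rewrite -big_split big1 // => i _ /=; rewrite -expr2 sqrr_sign. Qed.

Lemma mulKr_sign r (x : R) : (\prod_(i < r) (-1) ^+ i) * ((\prod_(i < r) (-1) ^+ i) * x) = x.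
Proof. by rewrite mulrA iota_sign_sqr mul1r. Qed.

(** The sequence [al n] depends on [n] because the tilt q does. Every fixed shift [s] is required,
    since row i of the differenced matrix is evaluated at n - i. *)
Definition diff_profile (al : nat -> R^nat) (G sg : R^nat) (h : nat -> R) :=
  forall p s, fdiff p (al n) (n - s)%N / (G n * sg n ^+ p.+1) @[n --> \oo] --> h p.

(** Row i carries G sg sg^i and column j carries sg^j; the product over rows and columns is (G sg)^r
    sg^(r(r-1)). *)
Lemma det_diff_profile r al (G sg : R^nat) h : diff_profile al G sg h ->
  (\forall n \near \oo, 0 < G n /\ 0 < sg n) ->
  \det (\matrix_(i < r, j < r) al n (n + j - i)%N) / ((G n * sg n) ^+ r * sg n ^+ (r * r.-1))
    @[n --> \oo] --> (\prod_(i < r) (-1) ^+ i) * \det (\matrix_(i < r, j < r) h (i + j)%N).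
Proof.
move=> alh G0.
pose x i j n := fdiff (i + j) (al n) (n - i)%N / (G n * sg n ^+ (i + j).+1).
have c : (\prod_(i < r) (-1) ^+ i) * \det (\matrix_(i < r, j < r) x i j n) @[n --> \oo] -->
    (\prod_(i < r) (-1) ^+ i) * \det (\matrix_(i < r, j < r) h (i + j)%N).
  apply: cvgMl_tmp.
  by apply: (@cvg_det r x (fun i j => h (i + j)%N)) => i j; exact: alh.
apply: cvg_trans c; apply: near_eq_cvg; near=> n.
have [Gn sn] : 0 < G n /\ 0 < sg n by near: n.
have rn : (r <= n)%N by near: n; exact: nbhs_infty_ge.
rewrite -[\det (\matrix_(i < r, j < r) al n (n + j - i)%N)](mulKr_sign r) -det_fdiff //.
have -> : \matrix_(i < r, j < r) fdiff (i + j) (al n) (n - i)%N =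
    \matrix_(i < r, j < r) ((G n * sg n * sg n ^+ i) * x i j n * sg n ^+ j).
  apply/matrixP => i j; rewrite !mxE /x exprS exprD; field.
  by rewrite !gt_eqF ?exprn_gt0.
rewrite (det_row_col_scale r (fun i => G n * sg n * sg n ^+ i) (fun j => sg n ^+ j) (fun i j => x i j n)).
rewrite big_split /= prodr_const card_ord -prod_expr_sqr.
have p0 : 0 < \prod_(i < r) sg n ^+ i by apply: prodr_gt0 => i _; rewrite exprn_gt0.
have q0 : 0 < (G n * sg n) ^+ r by rewrite exprn_gt0 ?mulr_gt0.
move: (\prod_(i < r) sg n ^+ i) ((G n * sg n) ^+ r) p0 q0 => P Q P0 Q0.
by field; rewrite !gt_eqF.
Unshelve. all: by end_near. Qed.

Lemma fdiff_shift p (f : R^nat) N : fdiff p f N.+1 = fdiff p (fun m => f m.+1) N.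
Proof. by elim: p N => //= p IH N; rewrite !IH. Qed.

Lemma fdiff_lin p (f g : R^nat) c N :
  fdiff p (fun m => f m + c * g m) N = fdiff p f N + c * fdiff p g N.
Proof. by elim: p N => //= p IH N; rewrite !IH; ring. Qed.

(* Writing q f(m) as f(m) - (1 - q) f(m), the q-difference is dominated by its
   (1 - q) part, because one more difference costs a factor sg << 1 - q. *)
Lemma diff_profile_bdiff (al al' : nat -> R^nat) (G sg q : R^nat) h :
  diff_profile al G sg h ->
  (forall n m, al' n m.+1 = al n m.+1 - q n * al n m) ->
  (\forall n \near \oo, [/\ 0 < G n, 0 < sg n & q n < 1]) ->
  sg n / (1 - q n) @[n --> \oo] --> (0 : R) ->
  diff_profile al' (fun n => (1 - q n) * G n) sg h.
Proof.
move=> alh alE G0 sq p s.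
have c : fdiff p (al n) (n - s.+1)%N / (G n * sg n ^+ p.+1) + sg n / (1 - q n) *
   (fdiff p.+1 (al n) (n - s.+1)%N / (G n * sg n ^+ p.+2)) @[n --> \oo] --> h p.
  rewrite -[X in _ --> X]addr0; apply: cvgD; first exact: alh.
  by rewrite -[X in _ --> X](mul0r (h p.+1)); apply: cvgM => //; exact: alh.
apply: cvg_trans c; apply: near_eq_cvg; near=> n.
have [Gn sn qn] : [/\ 0 < G n, 0 < sg n & q n < 1] by near: n.
have ns : (s < n)%N by near: n; exact: nbhs_infty_gt.
(* [alE] describes [al'] at successors only, so n - s is written as one. *)
rewrite -(subnSK ns) fdiff_shift.
rewrite (_ : (fun m => al' n m.+1) = (fun m => (al n m.+1 - al n m) + (1 - q n) * al n m)); last first.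
  by apply/funext => m; rewrite alE; ring.
rewrite fdiff_lin -fdiffS.
rewrite [sg n ^+ p.+2]exprS.
have s0 : 0 < sg n ^+ p.+1 by rewrite exprn_gt0.
move: (sg n ^+ p.+1) s0 (fdiff p _ _) (fdiff p.+1 _ _) => S S0 d1 d2.
by field; rewrite !gt_eqF // subr_gt0.
Unshelve. all: by end_near. Qed.

End ToeplitzAsymptotics.

(** * Toeplitz determinants for a general product of powers of P(q^a) *)

Section EulerProductAsymptotics.

Variable R : realType.

Lemma equiv_of_ratio (f g : nat -> R^o) : (\forall n \near \oo, g n != 0) ->
  (f n / g n : R) @[n --> \oo] --> (1 : R) -> f ~_\oo g.
Proof.
move=> g0 fg; apply/eqaddoP => e e0; near=> n.
have gn : g n != 0 by near: n.
have : `|1 - f n / g n| <= e by near: n; move/cvgrPdist_le: fg; apply.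
have -> : (f - g) n = (f n / g n - 1) * g n by rewrite mulrBl mul1r divfK.
by rewrite normrM distrC => h; rewrite ler_wpM2r.
Unshelve. all: by end_near. Qed.

Lemma one_subexpRN_ratio (t : R) : 0 < t -> `|(1 - expR (- t)) / t - 1| <= t.
Proof.
move=> t0; have t1 : 0 < 1 + t by rewrite addr_gt0.
have h1 := expR_ge1Dx (- t); have h2 := expR_ge1Dx t.
have h3 : expR (- t) <= (1 + t)^-1 by rewrite expRN lef_pV2 // posrE ?expR_gt0.
have h4 : (1 + t)^-1 <= 1 - t + t ^+ 2.
  rewrite -[leLHS]mul1r ler_pdivrMr //.
  have -> : (1 - t + t ^+ 2) * (1 + t) = 1 + t ^+ 3 by ring.
  by rewrite lerDl exprn_ge0 // ltW.
have -> : (1 - expR (- t)) / t - 1 = (1 - expR (- t) - t) / t by field; rewrite gt_eqF.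
rewrite normrM [`|t^-1|]gtr0_norm ?invr_gt0 // ler_pdivrMr // ler_norml.
by apply/andP; split; lra.
Qed.

Variables (s : seq (nat * int)) (f : nat -> int).
Hypothesis s_gt0 : all (fun p => 0 < p.1)%N s.
Hypothesis s_weight : forall d, (0 < d)%N -> 1 <= divisor_weight s d.
Hypothesis f0 : f 0%N = 1.
Hypothesis f_log : log_deriv (weighted_divsum s) f.

Let A := saddle_A R s.
Let beta := saddle_beta R s.
Let kappa := saddle_kappa R s.
Hypothesis A0 : 0 < A.

Let c := log_coef R s.
Let a (n : nat) : R := (f n)%:~R.

Lemma weighted_divsum0 : weighted_divsum s 0 = 0.
Proof. by rewrite /weighted_divsum big_geq. Qed.

Lemma log_coef0 : c 0%N = 0.
Proof. by rewrite /c /log_coef invr0 mulr0. Qed.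

(** The divisor d = N alone contributes at least N to the divisor sum, and the other divisors
    contribute nonnegative terms. *)
Lemma log_coef_ge1 N : (0 < N)%N -> 1 <= c N.
Proof.
move=> N0; rewrite /c /log_coef ler_pdivlMr ?ltr0n // mul1r -[N%:R]/((N%:Z)%:~R) ler_int.
rewrite /weighted_divsum big_mkcond big_nat_recr //= dvdnn.
rewrite ler_wpDl //.
  rewrite big_nat_cond; apply: sumr_ge0 => d /andP[/andP[d0 _] _]; case: ifP => // _.
  by rewrite mulr_ge0 // (le_trans _ (s_weight d0)).
by rewrite ler_peMl // s_weight.
Qed.

Lemma coef_rec n : n%:R * a n = \sum_(i < n.+1) i%:R * c i * a (n - i)%N.
Proof.
have := congr1 (fun z : int => z%:~R : R) (f_log n); rewrite /fps_euler /fps_mul rmorphM /= => ->.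
rewrite rmorph_sum /=; apply: eq_bigr => i _; rewrite rmorphM /=; congr (_ * _).
rewrite /c /log_coef; case: (val i) => [|j]; first by rewrite weighted_divsum0 !mul0r.
by rewrite mulrC divfK // pnatr_eq0.
Qed.

(** The minimum point of A / t + n t. *)
Definition saddle_t (n : nat) : R := Num.sqrt (A / n%:R).

Let t_gt0 n : (0 < n)%N -> 0 < saddle_t n.
Proof. by move=> n0; rewrite sqrtr_gt0 divr_gt0 // ltr0n. Qed.

Let t_sqr n : saddle_t n ^+ 2 = A / n%:R.
Proof. by rewrite sqr_sqrtr // divr_ge0 // ltW. Qed.

Let q n := expR (- saddle_t n).
Let F n := expR (psum c (q n)).
Let sg n := saddle_width A (saddle_t n).
Let h p := (2 * pi)^-1 * (cos (p%:R * (pi / 2)) * moment R p).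

Lemma saddle_t_cvg : saddle_t @ \oo --> (0 : R).
Proof.
rewrite -[X in _ --> X](sqrtr0 R); apply: (continuous_seq_cvg (@sqrt_continuous R)).
rewrite -[X in _ --> X](mulr0 A); apply: cvgMl_tmp.
apply: (@cvg_bound_harmonic _ 1) => n n0.
by rewrite subr0 mul1r gtr0_norm // invr_gt0 ltr0n.
Qed.

Lemma diff_profile_saddle : diff_profile (fun n m => a m * q n ^+ m) F sg h.
Proof.
move=> p d; have ce := subexp_log_coef R s_gt0.
have [C C0 HC] := psum_log_coef R s_gt0.
(* [local_limit] wants its hypotheses at every index. Beyond [n0] the subtraction n - d is exact,
   and n >= 16 A gives t <= 1/4. *)
pose n0 := (maxn d (Num.trunc (16 * A)).+1).
have n0A : 16 * A <= n0%:R.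
  by apply/ltW; apply: lt_le_trans (truncnS_gt _) _; rewrite ler_nat leq_maxr.
have n0p n : (0 < n + n0)%N by rewrite addn_gt0 /n0 leq_max orbT orbT.
rewrite -(cvg_shiftn n0).
apply: (@local_limit R a c _ log_coef0 log_coef_ge1 ce coef_rec A beta kappa C A0 C0 HC
  (fun n => saddle_t (n + n0)) (fun n => (n + n0 - d)%N) d%:R).
- by rewrite /a f0.
- move=> n; rewrite t_gt0 //=.
  have : saddle_t (n + n0) ^+ 2 <= 4^-1 ^+ 2.
    rewrite t_sqr ler_pdivrMr ?ltr0n // natrD.
    have : 0 <= n%:R :> R by []; lra.
  by rewrite ler_sqr ?nnegrE ?invr_ge0 // ltW // t_gt0.
- have := saddle_t_cvg; rewrite -(cvg_shiftn n0); exact.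
- move=> n; rewrite t_sqr invf_div mulrC divfK ?gt_eqF // -natrD subnK //.
  by rewrite (leq_trans _ (leq_addl _ _)) // leq_maxl.
Qed.

Let one_subq n : (0 < n)%N -> 0 < 1 - q n.
Proof. by move=> n0; rewrite subr_gt0 expR_lt1 oppr_lt0 t_gt0. Qed.

Let sg_gt0 n : (0 < n)%N -> 0 < sg n.
Proof.
move=> n0; rewrite /sg /saddle_width mulr_gt0 ?t_gt0 // sqrtr_gt0 divr_gt0 ?t_gt0 //.
by rewrite mulr_gt0.
Qed.

Lemma one_subq_cvg : (1 - q n) / saddle_t n @[n --> \oo] --> (1 : R).
Proof.
suff H : (1 - q n.+1) / saddle_t n.+1 @[n --> \oo] --> (1 : R) by rewrite -cvg_shiftS.
have e n : (1 - q n.+1) / saddle_t n.+1 = ((1 - q n.+1) / saddle_t n.+1 - 1) + 1 by rewrite subrK.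
rewrite (funext e) -[X in _ --> X]add0r; apply: cvgD; last exact: cvg_cst.
have t0 : saddle_t n.+1 @[n --> \oo] --> (0 : R) by rewrite cvg_shiftS; exact: saddle_t_cvg.
by apply: (cvg_norm_le0 _ t0) => n; apply: one_subexpRN_ratio; exact: t_gt0.
Qed.

Lemma diff_profile_iter_bdiff k :
  diff_profile (fun n m => (iter k bdiff f m)%:~R * q n ^+ m) (fun n => (1 - q n) ^+ k * F n) sg h.
Proof.
elim: k => [|k IH] /=.
  have := diff_profile_saddle; rewrite (_ : (fun n => (1 - q n) ^+ 0 * F n) = F) //.
  by apply/funext => n; rewrite expr0 mul1r.
rewrite (_ : (fun n => _ * F n) = (fun n => (1 - q n) * ((1 - q n) ^+ k * F n))); last first.
  by apply/funext => n; rewrite exprS mulrA.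
apply: (diff_profile_bdiff IH).
- by move=> n m; rewrite /bdiff rmorphB /= exprS; ring.
- near=> n; have n0 : (0 < n)%N by near: n; exact: nbhs_infty_gt.
  have := one_subq n0; rewrite subr_gt0 => q1; split => //; last exact: sg_gt0.
  by rewrite mulr_gt0 ?expR_gt0 // exprn_gt0 // subr_gt0.
- have e n : sg n / (1 - q n) = Num.sqrt (saddle_t n / (2 * A)) * ((1 - q n) / saddle_t n)^-1.
    by rewrite /sg /saddle_width invf_div; ring.
  rewrite (funext e) -[X in _ --> X](mul0r 1^-1); apply: cvgM.
    rewrite -[X in _ --> X](sqrtr0 R); apply: (continuous_seq_cvg (@sqrt_continuous R)).
    rewrite -[X in _ --> X](mul0r (2 * A)^-1); apply: cvgMr_tmp; exact: saddle_t_cvg.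
  by apply: cvgV; [exact: oner_neq0 | exact: one_subq_cvg].
Unshelve. all: by end_near. Qed.

Let expo n := A / saddle_t n + beta * ln (saddle_t n) + kappa.

Lemma F_cvg : F n * expR (- expo n) @[n --> \oo] --> (1 : R).
Proof.
have [C C0 HC] := psum_log_coef R s_gt0.
suff H : F n.+1 * expR (- expo n.+1) @[n --> \oo] --> (1 : R) by rewrite -cvg_shiftS.
have e n : F n.+1 * expR (- expo n.+1) = expR (psum c (q n.+1) - expo n.+1) by rewrite -expRD.
rewrite (funext e) -[X in _ --> X](expR0); apply: (continuous_seq_cvg (@continuous_expR R)).
have t0 : C * saddle_t n.+1 @[n --> \oo] --> (0 : R).
  rewrite -[X in _ --> X](mulr0 C); apply: cvgMl_tmp.
  by rewrite cvg_shiftS; exact: saddle_t_cvg.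
by apply: (cvg_norm_le0 _ t0) => n; apply: HC; exact: t_gt0.
Qed.

(** Row i carries x^(n-i) and column i carries x^i, together x^n for each of the r indices. *)
Lemma toeplitz_det_scale r (b : nat -> int) n (x : R) : (r <= n)%N ->
  \det (\matrix_(i < r, j < r) ((b (n + j - i)%N)%:~R * x ^+ (n + j - i))) =
  x ^+ (n * r) * (toeplitz_det r b n)%:~R.
Proof.
move=> rn; have -> : \matrix_(i < r, j < r) ((b (n + j - i)%N)%:~R * x ^+ (n + j - i)) =
   \matrix_(i < r, j < r) (x ^+ (n - i) * (b (n + j - i)%N)%:~R * x ^+ j).
  apply/matrixP => i j; rewrite !mxE -addnBAC ?exprD; last by rewrite (leq_trans _ rn) // ltnW.
  by ring.
rewrite (det_row_col_scale r (fun i => x ^+ (n - i)) (fun j => x ^+ j) (fun i j => (b (n + j - i)%N)%:~R)).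
congr (_ * _).
  rewrite -big_split /= (eq_bigr (fun=> x ^+ n)) ?prodr_const ?card_ord ?exprM // => i _.
  by rewrite -exprD subnK // (leq_trans _ rn) // ltnW.
by rewrite /toeplitz_det -det_map_mx; congr (\det _); apply/matrixP => i j; rewrite !mxE.
Qed.

(** The normalisation of [det_diff_profile] with 1 - q replaced by t and F(q) by the exponential of
    its asymptotic form; exp(t n) per row undoes the tilt, and the last factor is the limit computed
    in [det_cos_moment]. *)
Definition toeplitz_main r k n : R :=
  (saddle_t n ^+ k * expR (expo n + saddle_t n * n%:R) * sg n) ^+ r * sg n ^+ (r * r.-1) *
  (Num.sqrt (pi *+ 2) ^- r * \prod_(i < r) (i`!)%:R).

Lemma toeplitz_det_cvg r k :
  (toeplitz_det r (iter k bdiff f) n)%:~R / toeplitz_main r k n @[n --> \oo] --> (1 : R).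
Proof.
have pr := @diff_profile_iter_bdiff k.
have pos : \forall n \near \oo, 0 < (1 - q n) ^+ k * F n /\ 0 < sg n.
  near=> n; have n0 : (0 < n)%N by near: n; exact: nbhs_infty_gt.
  by split; [rewrite mulr_gt0 ?expR_gt0 // exprn_gt0 // one_subq | exact: sg_gt0].
have := @det_diff_profile R r _ _ _ _ pr pos; rewrite /h det_cos_moment.
set ci := (_ * _) => c1.
have ci0 : 0 < ci.
  have p0 : 0 < pi *+ 2 :> R by rewrite mulrn_wgt0 // pi_gt0.
  rewrite /ci; move: (pi *+ 2 : R) p0 => y y0; rewrite mulr_gt0 ?invr_gt0 ?exprn_gt0 ?sqrtr_gt0 //.
  by apply: prodr_gt0 => i _; rewrite ltr0n fact_gt0.
pose u n := ((1 - q n) / saddle_t n) ^+ k * (F n * expR (- expo n)).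
have cu : u @ \oo --> (1 : R).
  rewrite -[X in _ --> X]mul1r -[X in X * _](expr1n R k); apply: cvgM; last exact: F_cvg.
  exact: (continuous_seq_cvg (@exprn_continuous R k) one_subq_cvg).
have cur : u n ^+ r @[n --> \oo] --> (1 : R).
  by rewrite -[X in _ --> X](expr1n R r); exact: (continuous_seq_cvg (@exprn_continuous R r) cu).
have cc : \det (\matrix_(i < r, j < r) ((iter k bdiff f (n + j - i)%N)%:~R * q n ^+ (n + j - i))) /
    (((1 - q n) ^+ k * F n * sg n) ^+ r * sg n ^+ (r * r.-1)) * u n ^+ r * ci^-1 @[n --> \oo] --> (1 : R).
  by rewrite -[X in _ --> X](divff (lt0r_neq0 ci0)) -{2}[ci]mulr1; apply: cvgMr_tmp; apply: cvgM.
apply: cvg_trans cc; apply: near_eq_cvg; near=> n.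
have n0 : (0 < n)%N by near: n; exact: nbhs_infty_gt.
have rn : (r <= n)%N by near: n; exact: nbhs_infty_ge.
rewrite /= toeplitz_det_scale // /toeplitz_main -/ci /u.
have -> : q n ^+ (n * r) = (expR (saddle_t n * n%:R)) ^- r.
  by rewrite exprM /q -expRM_natl -exprVn -expRN mulrN mulrC.
have t0 := t_gt0 n0; have s0 := sg_gt0 n0; have F0 : 0 < F n := expR_gt0 _.
have q0 := one_subq n0.
rewrite expRD expRN.
move: (expR (expo n)) (expR_gt0 (expo n)) (expR (saddle_t n * _)) (expR_gt0 (saddle_t n * n%:R)) => E E0 E' E'0.
have Q0 : 0 < (1 - q n) ^+ k by rewrite exprn_gt0.
have T0 : 0 < saddle_t n ^+ k by rewrite exprn_gt0.
rewrite expr_div_n; move: ((1 - q n) ^+ k) (saddle_t n ^+ k) Q0 T0 => Q T Q0 T0.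
have -> : Q / T * (F n * E^-1) = (Q * F n * sg n) / (T * (E * E') * sg n) * E'.
  by move: (F n) (sg n) s0 => F' s' s0; field; rewrite !gt_eqF.
set X := Q * F n * sg n; set Y := _ * sg n.
have X0 : X ^+ r != 0 by rewrite expf_neq0 // gt_eqF // mulr_gt0 // mulr_gt0.
have Y0 : Y ^+ r != 0 by rewrite expf_neq0 // gt_eqF // mulr_gt0 // mulr_gt0 // mulr_gt0.
have S0 : 0 < sg n ^+ (r * r.-1) by rewrite exprn_gt0.
have W0 : E' ^+ r != 0 by rewrite expf_neq0 // gt_eqF.
rewrite [(X / Y * E') ^+ r]exprMn [(X / Y) ^+ r]expr_div_n.
move: (X ^+ r) (Y ^+ r) (E' ^+ r) (sg n ^+ (r * r.-1)) X0 Y0 W0 S0 => X' Y' W S X0 Y0 W0 S0.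
by field; rewrite X0 Y0 W0 !gt_eqF.
Unshelve. all: by end_near. Qed.

End EulerProductAsymptotics.

(** * Closed forms *)

Section ClosedForms.

Variable R : realType.

Lemma sqrt_expR (x : R) : Num.sqrt (expR x) = expR (x / 2).
Proof.
have -> : expR x = expR (x / 2) ^+ 2 by rewrite -expRM_natl mulrC divfK.
by rewrite sqrtr_sqr ger0_norm // expR_ge0.
Qed.

Lemma expR_lnK (x : R) : 0 < x -> x = expR (ln x).
Proof. by move=> x0; rewrite lnK // posrE. Qed.

Lemma powR_expR (a e : R) : 0 < a -> a `^ e = expR (e * ln a).
Proof. by move=> a0; rewrite /powR gt_eqF. Qed.

(** Reconciles the stated constant with the Hankel determinant 0! 1! ... (r-1)!. *)
Lemma prod_fact_div r : (0 < r)%N ->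
  (r.-1)`!%:R ^+ r / (\prod_(2 <= j < r) j%:R ^+ j) = \prod_(i < r) (i`!)%:R :> R.
Proof.
case: r => // r _ /=.
have D0 n : 0 < \prod_(2 <= j < n) j%:R ^+ j :> R.
  by rewrite big_nat_cond; apply: prodr_gt0 => j /andP[/andP[j2 _] _]; rewrite exprn_gt0 // ltr0n ltnW.
apply: (mulIf (lt0r_neq0 (D0 r.+1))); rewrite divfK ?gt_eqF //.
elim: r => [|r IH]; first by rewrite big_geq // big_ord_recl big_ord0 fact0 !mulr1.
rewrite big_ord_recr /=; case: r IH => [|r] IH.
  by rewrite big_geq // big_ord1 (_ : 1`! = 1%N) // fact0 expr1n !mulr1.
rewrite big_nat_recr //= mulrACA -IH mulrC.
rewrite exprS -mulrA -exprMn; congr (_ * _ ^+ _).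
by rewrite -natrM -factS.
Qed.

Variables (s : seq (nat * int)) (f : nat -> int).
Hypothesis s_gt0 : all (fun p => 0 < p.1)%N s.
Hypothesis s_weight : forall d, (0 < d)%N -> 1 <= divisor_weight s d.
Hypothesis f0 : f 0%N = 1.
Hypothesis f_log : log_deriv (weighted_divsum s) f.
Hypothesis A0 : 0 < saddle_A R s.

Let A := saddle_A R s.
Let beta := saddle_beta R s.
Let kappa := saddle_kappa R s.

(** Everything is put under one exponential, affine in the logarithms of A, n, 2 and pi and in the
    square root of A n. Comparison with a closed form is then a field identity between exponents. *)
Lemma toeplitz_mainE r k n : (0 < n)%N -> (0 < r)%N ->
  toeplitz_main R s r k n = (\prod_(i < r) (i`!)%:R) *
    expR (r%:R * ((k%:R + beta) * (ln A - ln n%:R) / 2 + kappa + 2 * Num.sqrt (A * n%:R) +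
      r%:R * (ln A / 4 - 3 / 4 * ln n%:R - ln 2 / 2) - (ln 2 + ln pi) / 2)).
Proof.
move=> n0 r0; have nr : 0 < n%:R :> R by rewrite ltr0n.
set L := ln A; set l := ln n%:R; set l2 := ln 2.
have AE : A = expR L by exact: expR_lnK.
have nE : n%:R = expR l by exact: expR_lnK.
have tE : saddle_t R s n = expR ((L - l) / 2).
  by rewrite /saddle_t -/A AE nE -expRN -expRD sqrt_expR.
have lt : ln (saddle_t R s n) = (L - l) / 2 by rewrite tE expRK.
have sE : saddle_width A (saddle_t R s n) = expR (L / 4 - 3 / 4 * l - l2 / 2).
  have e : 2 * A = expR (l2 + L) by rewrite expRD -AE -expR_lnK.
  rewrite /saddle_width tE e -expRN -expRD sqrt_expR -expRD.
  by congr expR; rewrite -/l2; field.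
have ptE : Num.sqrt (pi *+ 2) = expR ((l2 + ln pi) / 2) :> R.
  have -> : pi *+ 2 = expR (l2 + ln pi) :> R.
    by rewrite expRD -!expR_lnK ?pi_gt0 // mulr_natl.
  by rewrite sqrt_expR.
(* The minimum value of A / t + n t. *)
have e2 : A / saddle_t R s n + saddle_t R s n * n%:R = 2 * Num.sqrt (A * n%:R).
  rewrite tE AE nE -expRN -!expRD sqrt_expR mulr_natl mulr2n.
  by congr (expR _ + expR _); field.
rewrite /toeplitz_main -/A lt sE ptE.
have -> : A / saddle_t R s n + saddle_beta R s * ((L - l) / 2) + saddle_kappa R s + saddle_t R s n * n%:R =
    2 * Num.sqrt (A * n%:R) + beta * ((L - l) / 2) + kappa by rewrite -e2 -/beta -/kappa; ring.
rewrite tE [LHS]mulrA [LHS]mulrC; congr (_ * _).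
rewrite -!expRM_natl -expRN -!expRD -expRM_natl -!expRD; congr expR.
have rr : (r * r.-1)%:R = r%:R * (r%:R - 1) :> R by case: r r0 => // r _; rewrite natrM -natr1 addrK.
rewrite rr; by move: (Num.sqrt _) (ln pi) => S lp; field.
Qed.

Lemma toeplitz_equiv r k (g : nat -> R^o) : (0 < r)%N ->
  (forall n, (0 < n)%N -> g n = (\prod_(i < r) (i`!)%:R) *
    expR (r%:R * ((k%:R + beta) * (ln A - ln n%:R) / 2 + kappa + 2 * Num.sqrt (A * n%:R) +
      r%:R * (ln A / 4 - 3 / 4 * ln n%:R - ln 2 / 2) - (ln 2 + ln pi) / 2))) ->
  (fun n => (toeplitz_det r (iter k bdiff f) n)%:~R : R^o) ~_\oo g.
Proof.
move=> r0 gE; apply: equiv_of_ratio.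
  near=> n; rewrite gE; last by near: n; exact: nbhs_infty_gt.
  by rewrite gt_eqF // mulr_gt0 ?expR_gt0 //; apply: prodr_gt0 => i _; rewrite ltr0n fact_gt0.
apply: cvg_trans (toeplitz_det_cvg s_gt0 s_weight f0 f_log A0 r k).
apply: near_eq_cvg; near=> n; have n0 : (0 < n)%N by near: n; exact: nbhs_infty_gt.
by rewrite toeplitz_mainE // gE.
Unshelve. all: by end_near. Qed.

End ClosedForms.

(** * The three families *)

Section Instances.

Variable R : realType.

Lemma ln_zeta2 : ln (zeta2 R) = 2 * ln pi - ln 2 - ln 3.
Proof.
rewrite /zeta2 (_ : 6 = 2 * 3); last by rewrite -natrM.
have p0 := pi_gt0 R; rewrite ln_div ?posrE ?exprn_gt0 ?mulr_gt0 // lnXn // lnM ?posrE //.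
by rewrite mulr_natl; ring.
Qed.

Lemma zeta2_gt0 : 0 < zeta2 R.
Proof. by rewrite divr_gt0 // exprn_gt0 // pi_gt0. Qed.

Lemma sqrt_pi2 (u : R) : 0 <= u -> 2 * Num.sqrt (pi ^+ 2 / 4 * u) = pi * Num.sqrt u :> R.
Proof.
move=> u0; have p0 := pi_gt0 R.
have -> : pi ^+ 2 / 4 = (pi / 2) ^+ 2 :> R by rewrite expr_div_n -natrX.
by rewrite sqrtrM ?sqr_ge0 // sqrtr_sqr ger0_norm ?divr_ge0 ?ltW // mulrA [2 * _]mulrC divfK.
Qed.

Lemma prod_selfpow_gt0 r : 0 < \prod_(2 <= j < r) j%:R ^+ j :> R.
Proof.
rewrite big_nat_cond; apply: prodr_gt0 => j /andP[/andP[j2 _] _].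
by rewrite exprn_gt0 // ltr0n ltnW.
Qed.

Lemma expR_quotient (N D u v x y : R) : 0 < D ->
  N * expR u / (expR v * D) * (expR x / expR y) = N / D * expR (u - v + x - y).
Proof.
move=> D0; rewrite !expRD !expRN; have := expR_gt0 v; have := expR_gt0 y.
move: (expR u) (expR v) (expR x) (expR y) => a b d e e0 b0.
by field; rewrite !gt_eqF.
Qed.

Lemma partitions_equiv r k : (0 < r)%N ->
  (fun n => (toeplitz_det r (iter k bdiff partitions) n)%:~R : R^o) ~_\oo
  (fun n => (((r.-1)`!%:R ^+ r * pi `^ (r%:R * (r%:R - 1) / 2 + k%:R * r%:R))
    / (2 `^ ((3 * r%:R ^+ 2 + (2 * k%:R + 5) * r%:R) / 4)
      * 3 `^ ((r%:R ^+ 2 + (2 * k%:R + 1) * r%:R) / 4) * \prod_(2 <= j < r) j%:R ^+ j)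
    * (expR (pi * r%:R * Num.sqrt (2 / 3 * n%:R))
       / n%:R `^ ((3 * r%:R ^+ 2 + (2 * k%:R + 1) * r%:R) / 4)) : R^o)).
Proof.
move=> r0.
have AE : saddle_A R [:: (1%N, 1)] = zeta2 R.
  by rewrite /saddle_A big_seq1 /= divr1 mulr1.
have bE : saddle_beta R [:: (1%N, 1)] = 2^-1 by rewrite /saddle_beta big_seq1 mul1r.
have kE : saddle_kappa R [:: (1%N, 1)] = - (ln 2 + ln pi) / 2.
  by rewrite /saddle_kappa big_seq1 /= ln1 sub0r mul1r lnM ?posrE ?pi_gt0.
apply: (@toeplitz_equiv R [:: (1%N, 1)] partitions) => //.
- by move=> d d0; rewrite /divisor_weight big_seq1 dvd1n.
- exact: partitions0.
- exact: log_deriv_partitions.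
- by rewrite AE zeta2_gt0.
move=> n n0; rewrite AE bE kE -prod_fact_div // ln_zeta2.
have nr : 0 < n%:R :> R by rewrite ltr0n.
have -> : 2 * Num.sqrt (zeta2 R * n%:R) = pi * Num.sqrt (2 / 3 * n%:R).
  rewrite -sqrt_pi2 ?mulr_ge0 ?divr_ge0 ?(ltW nr) //; congr (2 * Num.sqrt _).
  by rewrite /zeta2; move: (pi : R) => y; field.
rewrite !powR_expR ?pi_gt0 //.
have D0 := prod_selfpow_gt0 r; set S := Num.sqrt _.
rewrite -expRD (expR_quotient _ _ _ _ _ D0); congr (_ * expR _).
by move: (pi : R) (ln pi) (ln 2) (ln 3) (ln n%:R) => p a b c d; field.
Qed.

Lemma overpartitions_equiv r k : (0 < r)%N ->
  (fun n => (toeplitz_det r (iter k bdiff overpartitions) n)%:~R : R^o) ~_\oo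
  (fun n => (((r.-1)`!%:R ^+ r * pi `^ (r%:R * (r%:R - 1) / 2 + k%:R * r%:R))
    / (2 `^ (r%:R ^+ 2 + (k%:R + 2) * r%:R) * \prod_(2 <= j < r) j%:R ^+ j)
    * (expR (pi * r%:R * Num.sqrt n%:R)
       / n%:R `^ ((3 * r%:R ^+ 2 + (2 * k%:R + 1) * r%:R) / 4)) : R^o)).
Proof.
move=> r0; pose s := [:: (1%N, 2%:Z); (2%N, -1)].
have AE : saddle_A R s = pi ^+ 2 / 4.
  by rewrite /saddle_A !big_cons big_nil /= /zeta2; move: (pi : R) => y; field.
have bE : saddle_beta R s = 2^-1 by rewrite /saddle_beta !big_cons big_nil /=; field.
have kE : saddle_kappa R s = - (2 * ln 2 + ln pi) / 2.
  rewrite /saddle_kappa !big_cons big_nil /= ln1 lnM ?posrE ?pi_gt0 //.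
  by move: (ln pi) (ln 2) => a b; field.
apply: (@toeplitz_equiv R s overpartitions) => //.
(* The weight is 2 at odd [d] and 1 at even [d]. *)
- by move=> d d0; rewrite /divisor_weight !big_cons big_nil dvd1n /=; case: ifP.
- exact: overpartitions0.
- exact: log_deriv_overpartitions.
- by rewrite AE divr_gt0 // exprn_gt0 // pi_gt0.
move=> n n0; rewrite AE bE kE -prod_fact_div //.
have nr : 0 < n%:R :> R by rewrite ltr0n.
have p0 := pi_gt0 R; rewrite sqrt_pi2 ?(ltW nr) //.
have -> : ln (pi ^+ 2 / 4) = 2 * ln pi - 2 * ln 2 :> R.
  rewrite (_ : 4 = 2 ^+ 2); last by rewrite -natrX.
  by rewrite ln_div ?posrE ?exprn_gt0 // !lnXn // !mulr_natl.
rewrite !powR_expR //.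
have D0 := prod_selfpow_gt0 r; set S := Num.sqrt _.
rewrite (expR_quotient _ _ _ _ _ D0); congr (_ * expR _).
by move: (pi : R) (ln pi) (ln 2) (ln n%:R) => p a b d; field.
Qed.

Lemma broken_diamond_equiv r k : (0 < r)%N -> (1 <= k)%N ->
  (fun n => (toeplitz_det r (broken_diamond k) n)%:~R : R^o) ~_\oo
  (fun n => (((r.-1)`!%:R ^+ r * pi `^ (r%:R * (r%:R - 1) / 2)
      * (5 * k%:R + 2) `^ (r%:R ^+ 2 / 4 + r%:R / 2))
    / (2 `^ (3 * r%:R ^+ 2 / 4 + 2 * r%:R) * 3 `^ (r%:R ^+ 2 / 4 + r%:R / 2)
      * (2 * k%:R + 1) `^ (r%:R ^+ 2 / 4 + r%:R / 2) * \prod_(2 <= j < r) j%:R ^+ j)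
    * (expR (pi * r%:R * Num.sqrt (2 * (5 * k%:R + 2) / (3 * (2 * k%:R + 1)) * n%:R))
       / n%:R `^ (3 * r%:R ^+ 2 / 4 + r%:R / 2)) : R^o)).
Proof.
move=> r0 k1; have mE : (2 * k + 1)%:R = 2 * k%:R + 1 :> R by rewrite natrD natrM.
have k0 : 0 <= k%:R :> R by [].
have u0 : 0 < 5 * k%:R + 2 :> R by rewrite ltr_wpDl ?mulr_ge0.
have v0 : 0 < 2 * k%:R + 1 :> R by rewrite ltr_wpDl ?mulr_ge0.
have p0 := pi_gt0 R.
(* With m = 2k + 1, the sum 3 + 1 / (2m) - 1/2 - 1 / m equals (5m - 1) / (2m), that is (5k + 2) /
   (2k + 1). *)
have AE : saddle_A R (broken_diamond_exps k) =
    zeta2 R * ((5 * k%:R + 2) / (2 * k%:R + 1)).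
  rewrite /saddle_A /broken_diamond_exps !big_cons big_nil /= natrM mE; congr (_ * _).
  by field; rewrite gt_eqF.
have bE : saddle_beta R (broken_diamond_exps k) = 1.
  by rewrite /saddle_beta /broken_diamond_exps !big_cons big_nil /=; field.
(* The contributions of ln m and of ln 2 from the exponents at 2m, 2 and m cancel, leaving only the
   terms in ln (2 pi). *)
have kE : saddle_kappa R (broken_diamond_exps k) = - (ln 2 + ln pi).
  rewrite /saddle_kappa /broken_diamond_exps !big_cons big_nil /= ln1 natrM mE !lnM ?posrE //.
  by move: (ln pi) (ln 2) (ln (2 * k%:R + 1)) => a b d; field.
have := @toeplitz_equiv R (broken_diamond_exps k) (broken_diamond k) _ _ _ _ _ r 0; apply => //.
- by rewrite /= muln_gt0 addn1.
(* The weight at [d] is 3 and at most two units are taken away. *)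
- move=> d d0; rewrite /divisor_weight /broken_diamond_exps !big_cons big_nil dvd1n /=.
  by do 3! case: ifP.
- exact: broken_diamond0.
- exact: log_deriv_broken_diamond.
- by rewrite AE mulr_gt0 ?zeta2_gt0 // divr_gt0.
move=> n n0; rewrite AE bE kE -prod_fact_div //.
have nr : 0 < n%:R :> R by rewrite ltr0n.
rewrite lnM ?posrE ?zeta2_gt0 ?divr_gt0 // ln_zeta2 ln_div ?posrE //.
have -> : 2 * Num.sqrt (zeta2 R * ((5 * k%:R + 2) / (2 * k%:R + 1)) * n%:R) =
    pi * Num.sqrt (2 * (5 * k%:R + 2) / (3 * (2 * k%:R + 1)) * n%:R).
  rewrite -sqrt_pi2; last by rewrite mulr_ge0 ?(ltW nr) // divr_ge0 // mulr_ge0 // ltW.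
  congr (2 * Num.sqrt _); rewrite /zeta2; move: (pi : R) => y.
  by field; rewrite gt_eqF.
rewrite !powR_expR //.
have D0 := prod_selfpow_gt0 r; set S := Num.sqrt _.
rewrite -[_ * expR _ * expR _ in LHS]mulrA -!expRD (expR_quotient _ _ _ _ _ D0); congr (_ * expR _).
by move: (pi : R) (ln pi) (ln 2) (ln 3) (ln n%:R) (ln (5 * k%:R + 2)) (ln (2 * k%:R + 1)) => p a b c d e g; field.
Qed.

End Instances.

Theorem theorem1p18 (R : realType) (r k : nat) (hr : (2 <= r)%N)
    (hk : (1 <= k)%N) :
  let x : R := r%:R in
  let y : R := k%:R in
  let D : R := \prod_(2 <= j < r) j%:R ^+ j in
  let T : (nat -> int) -> nat -> R^o :=
    fun a n => (toeplitz_det r a n)%:~R in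
  let f1 : nat -> R^o := fun n =>
    ((r.-1)`!%:R ^+ r * pi `^ (x * (x - 1) / 2)
      * (5 * y + 2) `^ (x ^+ 2 / 4 + x / 2))
    / (2 `^ (3 * x ^+ 2 / 4 + 2 * x) * 3 `^ (x ^+ 2 / 4 + x / 2)
      * (2 * y + 1) `^ (x ^+ 2 / 4 + x / 2) * D)
    * (expR (pi * x * Num.sqrt (2 * (5 * y + 2) / (3 * (2 * y + 1)) * n%:R))
       / n%:R `^ (3 * x ^+ 2 / 4 + x / 2)) in
  let f2 : nat -> R^o := fun n =>
    ((r.-1)`!%:R ^+ r * pi `^ (x * (x - 1) / 2 + y * x))
    / (2 `^ ((3 * x ^+ 2 + (2 * y + 5) * x) / 4)
      * 3 `^ ((x ^+ 2 + (2 * y + 1) * x) / 4) * D)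
    * (expR (pi * x * Num.sqrt (2 / 3 * n%:R))
       / n%:R `^ ((3 * x ^+ 2 + (2 * y + 1) * x) / 4)) in
  let f3 : nat -> R^o := fun n =>
    ((r.-1)`!%:R ^+ r * pi `^ (x * (x - 1) / 2 + y * x))
    / (2 `^ (x ^+ 2 + (y + 2) * x) * D)
    * (expR (pi * x * Num.sqrt n%:R)
       / n%:R `^ ((3 * x ^+ 2 + (2 * y + 1) * x) / 4)) in
  [/\ T (broken_diamond k) ~_\oo f1,
      T (iter k bdiff partitions) ~_\oo f2 &
      T (iter k bdiff overpartitions) ~_\oo f3].
Proof.
move=> x y D T f1 f2 f3; have r0 : (0 < r)%N by exact: ltn_trans hr.
split.
- exact: broken_diamond_equiv.
- exact: partitions_equiv.
- exact: overpartitions_equiv.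
Qed.
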